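(* For every $0<\varepsilon\le\frac12$ there exists $C>0$ such that the following holds. Let $f:\mathbb N\to(0,\infty)$ be a function with $C\log m\le f(m)\le m$ for all sufficiently large $m$, and let $\rho(m)=f(m)/m^{2}$. Then asymptotically almost surely (as $m\to\infty$) a random group in the binomial triangular model $\Gamma(m,\rho)$ has property $FL^p_{(2-2\varepsilon)^{1/(2p)}}$ for every $p\in\left[2,\ \frac1C\left(\frac{\log f(m)}{\log\log f(m)}\right)^{1/2}\right]$. In particular, asymptotically almost surely, for every such $p$, every affine action of the random group on an $L^p$ space that is $(2-2\varepsilon)^{1/(2p)}$-Lipschitz has a fixed point. Moreover, if $f(m)/\log m\to\infty$ as $m\to\infty$, then $C$ can be chosen independent of $\varepsilon$.
   Context: Binomial triangular model $\Gamma(m,\rho)$: take a set of generators $S$ with $|S|=m$ and the group $\Gamma=\langle S\mid R\rangle$, where $R$ is a random subset of the set of all cyclically reduced words of length 3 in $S\cup S^{-1}$, each such word being included in $R$ independently with probability $\rho(m)$. A property holds asymptotically almost surely (a.a.s.) if the probability that $\Gamma\in\Gamma(m,\rho)$ satisfies it tends to $1$ as $m\to\infty$. Let $p\in(0,\infty)$, $L\ge1$, $n_0\in\mathbb N$. A Banach space has $L$-bi-Lipschitz $L^p$ geometry above dimension $n_0$ if every $n_0$-dimensional subspace of it is contained in a subspace that is $L$-bi-Lipschitz equivalent either to $\ell^p_n$ ($\mathbb R^n$ with the $p$-norm) for some $n\ge n_0$, or to $\ell^p_\infty$ (the space of $p$-summable sequences), or to some space $L^p(X,\mu)$. Here two spaces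 are $L$-bi-Lipschitz equivalent if there is a bijection $F$ between them with $L^{-1}\|u-v\|\le\|F(u)-F(v)\|\le L\|u-v\|$ for all $u,v$. If this holds for every $n_0$, the Banach space has $L$-bi-Lipschitz $L^p$ geometry in finite dimension. A (topological) group $\Gamma$ has property $FL^p_L$ if every affine isometric continuous action of $\Gamma$ on a Banach space with $L$-bi-Lipschitz $L^p$ geometry in finite dimension has a global fixed point (continuity means that all orbit maps are continuous; the random groups are discrete). An affine action $\gamma\cdot v=\pi_\gamma v+b_\gamma$ of $\Gamma$ on $L^p(X,\mu)$ is $L$-Lipschitz if $\|\pi_\gamma\|\le L$ for all $\gamma\in\Gamma$. *)

(* Defs.v *)
From Stdlib Require Import Relation_Operators.
From HB Require Import structures.
From mathcomp Require Import all_boot all_order all_algebra.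
From mathcomp Require Import all_classical all_reals all_analysis.
From mathcomp Require Import measurable_realfun ess_sup_inf.
Set Implicit Arguments.
Unset Strict Implicit.
Unset Printing Implicit Defensive.
Import Order.TTheory GRing.Theory Num.Theory.
Import numFieldNormedType.Exports.
Local Open Scope classical_set_scope.
Local Open Scope ring_scope.

(* The library's [LspaceType mu p1] (classes of measurable functions with finite
   p-norm, modulo almost everywhere equality) is given here the normed module
   structure it lacks, with norm ['N[mu]_p]. *)

Section LpSpace.
Context d (T : measurableType d) (R : realType).
Variables (mu : {measure set T -> \bar R}) (p : \bar R) (p1 : (1 <= p)%E).
Local Notation Lp := (LspaceType mu p1).
Local Notation Lf := (LfunType mu p1).

Lemma ae_eq_Lnorm (f g : T -> R) :
  measurable_fun [set: T] f -> measurable_fun [set: T] g ->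
  f = g %[ae mu] -> 'N[mu]_p[EFin \o f]%E = 'N[mu]_p[EFin \o g]%E.
Proof.
rewrite unlock => mf mg; case: p p1 => [r r1|_|//] fg.
  have m (h : T -> R) : measurable_fun [set: T] h ->
      measurable_fun setT (fun x => (`|(EFin \o h) x| `^ r)%E).
    move=> mh; apply: (@measurableT_comp _ _ _ _ _ _ (fun x : \bar R => (x `^ r)%E)).
      exact: measurable_poweR.
    by do 2 apply: measurableT_comp => //.
  congr (_ `^ _)%E; apply: ae_eq_integral => //; [exact: m|exact: m|].
  by apply: filterS fg => x /= /(_ I) ->.
case: ifPn => // _; apply: eq_ess_sup.
by apply: filterS fg => x /= /(_ I) ->.
Qed.

Definition Lrepr (x : Lp) : {mfun T >-> measurableTypeR R} :=
  repr (LebesgueSpace.sort x).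

Lemma Lrepr_Lfun (x : Lp) : (Lrepr x : T -> R) \in Lfun mu p.
Proof.
rewrite inE; apply/andP; split; first exact: (valP (Lrepr x)).
by rewrite inE/=; exact: (@Lebesgue_finite _ _ _ _ _ p1 x).
Qed.

Definition Lfun_of (x : Lp) : Lf := Lfun_Sub p1 (Lrepr_Lfun x).

Definition mfun_toR (f : {mfun T >-> R}) : T -> measurableTypeR R := f.

Lemma measurable_mfun_toR (f : {mfun T >-> R}) :
  measurable_fun [set: T] (mfun_toR f).
Proof. exact: (@measurable_funPT _ _ _ _ f). Qed.

HB.instance Definition _ f :=
  isMeasurableFun.Build _ _ _ _ (mfun_toR f) (measurable_mfun_toR f).

Definition mfun_pi (f : {mfun T >-> R}) : {mfun_ mu, T >-> measurableTypeR R} :=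
  (\pi_({mfun_ mu, T >-> measurableTypeR R}) (mfun_toR f))%qT.

Lemma mfun_piE (f : {mfun T >-> R}) : (repr (mfun_pi f) : T -> R) = f %[ae mu].
Proof.
have := reprK (mfun_pi f).
by move=> /(@eqmodP _ (ae_eq_op_canonical (measurableTypeR R) mu)) /asboolP.
Qed.

Lemma Lclass_subproof (f : Lf) : finite_norm mu p (mfun_pi f).
Proof.
rewrite /finite_norm (@ae_eq_Lnorm (repr (mfun_pi f)) f _ _ (mfun_piE f)).
- exact: Lfunction_finite.
- exact: (@measurable_funPT _ _ _ _ (repr (mfun_pi f))).
- exact: (@measurable_funPT _ _ _ _ f).
Qed.

Definition Lclass (f : Lf) : Lp :=
  LebesgueSpace.Pack (LebesgueSpace.Class
    (@isFinLebesgue.Axioms_ _ _ _ _ _ p1 _ (Lclass_subproof f))).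

Lemma Lspace_inj (x y : Lp) :
  LebesgueSpace.sort x = LebesgueSpace.sort y -> x = y.
Proof.
case: x y => [x [[xfin]]] [y [[yfin]]] /= xy; case: y / xy yfin => yfin.
by rewrite (Prop_irrelevance xfin yfin).
Qed.

Lemma eq_Lclass (f g : Lf) : f = g %[ae mu] -> Lclass f = Lclass g.
Proof.
move=> fg; apply: Lspace_inj.
apply/(@eqmodP _ (ae_eq_op_canonical (measurableTypeR R) mu)).
exact/asboolP.
Qed.

Lemma Lfun_ofK : cancel Lfun_of Lclass.
Proof.
move=> x; apply: Lspace_inj; rewrite -[RHS]reprK.
apply/(@eqmodP _ (ae_eq_op_canonical (measurableTypeR R) mu))/asboolP.
exact: ae_eq_refl.
Qed.

Lemma LclassK (f : Lf) : Lfun_of (Lclass f) = f %[ae mu].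
Proof. exact: mfun_piE. Qed.

HB.instance Definition _ := gen_eqMixin Lp.
HB.instance Definition _ := gen_choiceMixin Lp.

Let zero : Lp := Lclass 0.
Let opp (x : Lp) : Lp := Lclass (- Lfun_of x).
Let add (x y : Lp) : Lp := Lclass (Lfun_of x + Lfun_of y).
Let scale (a : R) (x : Lp) : Lp := Lclass (a *: Lfun_of x).

Let addC : commutative add.
Proof. by move=> x y; rewrite /add addrC. Qed.

Let add_class (f g : Lf) : add (Lclass f) (Lclass g) = Lclass (f + g).
Proof.
apply: eq_Lclass; have := LclassK g; have := LclassK f.
by apply: filterS2 => t /= + + _; move=> /(_ I) ef /(_ I) eg; congr (_ + _).
Qed.

Let opp_class (f : Lf) : opp (Lclass f) = Lclass (- f).
Proof.
apply: eq_Lclass; have := LclassK f.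
by apply: filterS => t /= + _; move=> /(_ I) ef; congr (- _).
Qed.

Let scale_class a (f : Lf) : scale a (Lclass f) = Lclass (a *: f).
Proof.
apply: eq_Lclass; have := LclassK f.
by apply: filterS => t /= + _; move=> /(_ I) ef; congr (_ *: _).
Qed.

Let Lp_ind (P : Lp -> Prop) : (forall f, P (Lclass f)) -> forall x, P x.
Proof. by move=> Pc x; rewrite -(Lfun_ofK x). Qed.

Let addA : associative add.
Proof. by do 3 elim/Lp_ind=> ?; rewrite !add_class addrA. Qed.

Let add0 : left_id zero add.
Proof. by elim/Lp_ind=> f; rewrite add_class add0r. Qed.

Let addN : left_inverse zero opp add.
Proof. by elim/Lp_ind=> f; rewrite opp_class add_class addNr. Qed.

HB.instance Definition _ := GRing.isZmodule.Build Lp addA addC add0 addN.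

Let scaleA a b x : scale a (scale b x) = scale (a * b) x.
Proof. by elim/Lp_ind: x => f; rewrite !scale_class scalerA. Qed.

Let scale1 : left_id 1 scale.
Proof. by elim/Lp_ind=> f; rewrite scale_class scale1r. Qed.

Let scaleDr : right_distributive scale +%R.
Proof.
move=> a; elim/Lp_ind=> f; elim/Lp_ind=> g.
by rewrite /GRing.add/= add_class !scale_class add_class scalerDr.
Qed.

Let scaleDl x : {morph scale^~ x : a b / a + b}.
Proof.
elim/Lp_ind: x => f a b.
by rewrite !scale_class [RHS]add_class scalerDl.
Qed.

HB.instance Definition _ :=
  GRing.Zmodule_isLmodule.Build R Lp scaleA scale1 scaleDr scaleDl.

Definition Lp_norm (x : Lp) : R := fine ('N[mu]_p[EFin \o Lfun_of x])%E.

Lemma Lp_norm_class (f : Lf) :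
  Lp_norm (Lclass f) = fine ('N[mu]_p[EFin \o f])%E.
Proof.
congr fine; apply: ae_eq_Lnorm (LclassK f).
- exact: (@measurable_funPT _ _ _ _ (Lfun_of (Lclass f))).
- exact: (@measurable_funPT _ _ _ _ f).
Qed.

Let Lp_normD x y : Lp_norm (x + y) <= Lp_norm x + Lp_norm y.
Proof. by rewrite Lp_norm_class; exact: ler_LnormD. Qed.

Let Lp_normZ a x : Lp_norm (a *: x) = `|a| * Lp_norm x.
Proof.
rewrite Lp_norm_class; apply: EFin_inj.
rewrite EFinM !finite_norm_fine; exact: LnormZ.
Qed.

Let Lp_norm0 x : Lp_norm x = 0 -> x = 0.
Proof.
move=> x0; rewrite -[x]Lfun_ofK; apply: eq_Lclass.
exact: fine_Lnormr_eq0.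
Qed.

HB.instance Definition _ := Lmodule_isNormed.Build R Lp Lp_normD Lp_normZ Lp_norm0.

End LpSpace.

HB.mixin Record isTopologicalGroup G of Group G & Topological G := {
  mulg_continuous : continuous (fun xy : G * G => (xy.1 * xy.2)%g);
  invg_continuous : continuous (fun x : G => (x^-1)%g)
}.

#[short(type="topologicalGroupType")]
HB.structure Definition TopologicalGroup :=
  {G of isTopologicalGroup G & Group G & Topological G}.

(* [(x, true)] stands for the generator x and [(x, false)] for its formal
   inverse. The group <X | rels> is the quotient of the monoid of words by the
   congruence generated by x x^-1 = 1 (x a letter) and r = 1 (r in rels); it
   carries the discrete topology. *)

Section Presentation.
Context {X : choiceType}.

Definition letter : Type := (X * bool)%type.
HB.instance Definition _ := Choice.on letter.

Definition letter_inv (x : letter) : letter := (x.1, ~~ x.2).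
Definition word_inv (w : seq letter) : seq letter := rev (map letter_inv w).

(* [cycle] also compares the last letter with the first one. *)
Definition cyclically_reduced (w : seq letter) : bool :=
  cycle (fun x y => y != letter_inv x) w.

Variable rels : set (seq letter).

Inductive word_step : seq letter -> seq letter -> Prop :=
| step_cancel u v x : word_step (u ++ [:: x; letter_inv x] ++ v) (u ++ v)
| step_relator u v r : rels r -> word_step (u ++ r ++ v) (u ++ v).

Definition word_eqv (u v : seq letter) : bool :=
  `[< clos_refl_sym_trans _ word_step u v >].

Let word_eqv_refl : reflexive word_eqv.
Proof. by move=> u; apply/asboolP/rst_refl. Qed.

Let word_eqv_sym : symmetric word_eqv.
Proof.
by move=> u v; apply/idP/idP => /asboolP uv; apply/asboolP/rst_sym.
Qed.

Let word_eqv_trans : transitive word_eqv.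
Proof.
move=> v u w /asboolP uv /asboolP vw; apply/asboolP.
exact: rst_trans uv vw.
Qed.

Canonical word_eqv_equiv :=
  EquivRel word_eqv word_eqv_refl word_eqv_sym word_eqv_trans.

Local Open Scope quotient_scope.

Definition presented : Type := {eq_quot word_eqv}.
HB.instance Definition _ := Choice.on presented.
HB.instance Definition _ := EqQuotient.on presented.

Let cls (w : seq letter) : presented := \pi_presented w.

Let cls_ind (P : presented -> Prop) : (forall w, P (cls w)) -> forall g, P g.
Proof. by move=> Pc g; rewrite -[g]reprK; exact: Pc. Qed.

Let eq_cls u v : clos_refl_sym_trans _ word_step u v -> cls u = cls v.
Proof. by move=> uv; apply/eqmodP/asboolP. Qed.

Let reprP w : clos_refl_sym_trans _ word_step (repr (cls w)) w.
Proof. by have /eqmodP/asboolP := reprK (cls w). Qed.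

Let step_catl w u v : word_step u v -> word_step (w ++ u) (w ++ v).
Proof.
by case=> {u v} [u v x|u v r rr]; rewrite !(catA w);
  [exact: step_cancel|exact: step_relator].
Qed.

Let step_catr w u v : word_step u v -> word_step (u ++ w) (v ++ w).
Proof.
by case=> {u v} [u v x|u v r rr]; rewrite -!catA;
  [exact: step_cancel|exact: step_relator].
Qed.

Let rst_cat u u' v v' :
  clos_refl_sym_trans _ word_step u u' -> clos_refl_sym_trans _ word_step v v' ->
  clos_refl_sym_trans _ word_step (u ++ v) (u' ++ v').
Proof.
move=> uu vv; apply: (@rst_trans _ _ _ (u' ++ v)).
  elim: uu => [x y /step_catr xy|x|x y _|x y z _ xy _ yz].
  - exact/rst_step.
  - exact: rst_refl.
  - exact: rst_sym.
  - exact: rst_trans xy yz.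
elim: vv => [x y /step_catl xy|x|x y _|x y z _ xy _ yz].
- exact/rst_step.
- exact: rst_refl.
- exact: rst_sym.
- exact: rst_trans xy yz.
Qed.

Let word_invK : involutive word_inv.
Proof.
move=> w; rewrite /word_inv map_rev revK -map_comp -[RHS]map_id.
by apply: eq_map => -[x b]; rewrite /letter_inv/= negbK.
Qed.

Let rst_mulV w : clos_refl_sym_trans _ word_step (w ++ word_inv w) [::].
Proof.
elim: w => [|x w IH]; first exact: rst_refl.
have -> : (x :: w) ++ word_inv (x :: w) =
    [:: x] ++ ((w ++ word_inv w) ++ [:: letter_inv x]).
  by rewrite /word_inv/= rev_cons -cats1 catA.
apply: (@rst_trans _ _ _ ([:: x] ++ ([::] ++ [:: letter_inv x]))).
  apply: rst_cat; first exact: rst_refl.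
  by apply: rst_cat => //; exact: rst_refl.
exact/rst_step/(step_cancel [::] [::] x).
Qed.

Let rst_Vmul w : clos_refl_sym_trans _ word_step (word_inv w ++ w) [::].
Proof. by have := rst_mulV (word_inv w); rewrite word_invK. Qed.

Let rst_inv u v : clos_refl_sym_trans _ word_step u v ->
  clos_refl_sym_trans _ word_step (word_inv u) (word_inv v).
Proof.
move=> uv; apply: (@rst_trans _ _ _ (word_inv u ++ (v ++ word_inv v))).
  apply: rst_sym; rewrite -[X in clos_refl_sym_trans _ _ _ X]cats0.
  by apply: rst_cat => //; exact: rst_refl.
rewrite catA -[X in clos_refl_sym_trans _ _ _ X]cat0s.
apply: rst_cat; last exact: rst_refl.
apply: rst_trans (rst_Vmul u).
by apply: rst_cat; [exact: rst_refl|exact: rst_sym].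
Qed.

Let one : presented := cls [::].
Let mul (g h : presented) : presented := cls (repr g ++ repr h).
Let inv (g : presented) : presented := cls (word_inv (repr g)).

Let mul_cls u v : mul (cls u) (cls v) = cls (u ++ v).
Proof. exact/eq_cls/rst_cat. Qed.

Let inv_cls u : inv (cls u) = cls (word_inv u).
Proof. exact/eq_cls/rst_inv. Qed.

Let mulA : associative mul.
Proof. by do 3 elim/cls_ind=> ?; rewrite !mul_cls catA. Qed.

Let mul1 : left_id one mul.
Proof. by elim/cls_ind=> u; rewrite mul_cls. Qed.

Let mulr1 : right_id one mul.
Proof. by elim/cls_ind=> u; rewrite mul_cls cats0. Qed.

Let mulV : left_inverse one inv mul.
Proof. by elim/cls_ind=> u; rewrite inv_cls mul_cls; exact: eq_cls. Qed.

Let mulrV : right_inverse one inv mul.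
Proof. by elim/cls_ind=> u; rewrite inv_cls mul_cls; exact: eq_cls. Qed.

HB.instance Definition _ := isGroup.Build presented mulA mul1 mulr1 mulV mulrV.

HB.instance Definition _ := hasNbhs.Build presented principal_filter.
HB.instance Definition _ := Discrete_ofNbhs.Build presented erefl.

Let mul_continuous :
  continuous (fun xy : presented * presented => (xy.1 * xy.2)%g).
Proof.
move=> [x y] A /=; rewrite nbhs_principalE => /principal_filterP xyA.
exists ([set x], [set y]) => /=.
  by split; apply/principal_filterP.
by move=> [x' y'] /= [-> ->].
Qed.

Let inv_continuous : continuous (fun x : presented => (x^-1)%g).
Proof.
move=> x A /=; rewrite nbhs_principalE => /principal_filterP xA.
by apply/principal_filterP.
Qed.

HB.instance Definition _ :=
  isTopologicalGroup.Build presented mul_continuous inv_continuous.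

End Presentation.
Arguments letter : clear implicits.
Arguments presented {X} rels.

Section Geometry.
Context {R : realType}.

(* The bijection f is not required to be linear. Distances are explicit so that E
   and F may be subsets of a larger type. *)
Definition bilipschitz_equiv (V W : Type) (dV : V -> V -> R) (dW : W -> W -> R)
    (L : R) (E : set V) (F : set W) : Prop :=
  exists2 f : V -> W, set_bij E F f &
    forall u v, E u -> E v ->
      L^-1 * dV u v <= dW (f u) (f v) <= L * dV u v.

Definition norm_dist (V : normedModType R) (u v : V) : R := `|u - v|.

Definition finite_lp_norm (p : R) n (x : 'rV[R]_n) : R :=
  (\sum_(i < n) `|x 0 i| `^ p) `^ p^-1.

Definition finite_lp_dist (p : R) n (x y : 'rV[R]_n) : R :=
  finite_lp_norm p (x - y).

Definition lp_space (p : R) : set (nat -> R) :=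
  [set x | cvgn (series (fun k => `|x k| `^ p))].

Definition lp_norm (p : R) (x : nat -> R) : R :=
  limn (series (fun k => `|x k| `^ p)) `^ p^-1.

Definition lp_dist (p : R) (x y : nat -> R) : R := lp_norm p (x \- y).

Definition linear_subspace (V : lmodType R) (E : set V) : Prop :=
  E 0 /\ forall (a : R) u v, E u -> E v -> E (a *: u + v).

(* E is a linear subspace of dimension n. *)
Definition has_dim (V : lmodType R) (n : nat) (E : set V) : Prop :=
  exists e : 'I_n -> V,
    (forall c : 'I_n -> R, \sum_i c i *: e i = 0 -> forall i, c i = 0) /\
    E = range (fun c : 'I_n -> R => \sum_i c i *: e i).

(* The exponent is restricted to p >= 1, the range in which the L^p spaces are
   normed. *)
Definition Lp_geometry_above (p : R) (p1 : (1 <= p%:E)%E) (L : R) (n0 : nat)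
    (V : normedModType R) : Prop :=
  forall E : set V, has_dim n0 E ->
  exists F : set V, [/\ linear_subspace F, E `<=` F &
    [\/ exists2 n : nat, (n0 <= n)%N &
          bilipschitz_equiv (@norm_dist V) (@finite_lp_dist p n) L F setT,
        bilipschitz_equiv (@norm_dist V) (lp_dist p) L F (lp_space p) |
        exists (d : measure_display) (T : measurableType d)
               (mu : {measure set T -> \bar R}),
          bilipschitz_equiv (@norm_dist V)
            (@norm_dist (LspaceType mu p1)) L F setT]].

Definition Lp_geometry (p : R) (p1 : (1 <= p%:E)%E) (L : R)
    (V : normedModType R) : Prop :=
  forall n0 : nat, Lp_geometry_above p1 L n0 V.

(* [affine_action pi b]: the maps [v |-> pi g v + b g] define an action of G. *)
Definition affine_action (G : groupType) (V : lmodType R)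
    (pi : G -> {linear V -> V}) (b : G -> V) : Prop :=
  (forall v, pi 1%g v + b 1%g = v) /\
  (forall g h v, pi (g * h)%g v + b (g * h)%g = pi g (pi h v + b h) + b g).

Definition has_fixed_point (G : groupType) (V : lmodType R)
    (pi : G -> {linear V -> V}) (b : G -> V) : Prop :=
  exists v, forall g, pi g v + b g = v.

Definition FLp (p : R) (p1 : (1 <= p%:E)%E) (L : R)
    (G : topologicalGroupType) : Prop :=
  forall V : completeNormedModType R, Lp_geometry p1 L V ->
  forall (pi : G -> {linear V -> V}) (b : G -> V),
    affine_action pi b ->
    (forall g v, `|pi g v| = `|v|) ->
    (forall v, continuous (fun g => pi g v + b g)) ->
    has_fixed_point pi b.

(* [forall v, `|pi g v| <= L * `|v|] says that the operator norm of [pi g] is at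
   most L. *)
Definition Lp_lipschitz_fixed_points (p : R) (p1 : (1 <= p%:E)%E) (L : R)
    (G : groupType) : Prop :=
  forall (d : measure_display) (T : measurableType d)
         (mu : {measure set T -> \bar R})
         (pi : G -> {linear LspaceType mu p1 -> LspaceType mu p1})
         (b : G -> LspaceType mu p1),
    affine_action pi b ->
    (forall g v, `|pi g v| <= L * `|v|) ->
    has_fixed_point pi b.

End Geometry.

Section RandomGroup.
Context {R : realType}.

Definition triangular_words (m : nat) : {set 3.-tuple (letter 'I_m)} :=
  [set w : 3.-tuple (letter 'I_m) | cyclically_reduced w]%SET.

Definition triangular_group (m : nat) (A : {set 3.-tuple (letter 'I_m)}) :
  topologicalGroupType := presented (@tval 3 (letter 'I_m) @` [set` A]).

(* Distinct words are distinct potential relators, even when they are cyclic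
   conjugates or inverses of each other. *)
Definition triangular_prob (m : nat) (rho : R)
    (P : topologicalGroupType -> Prop) : R :=
  \sum_(A : {set 3.-tuple (letter 'I_m)} |
      (A \subset triangular_words m) && `[< P (triangular_group A) >])
    rho ^+ #|A| * (1 - rho) ^+ (#|triangular_words m| - #|A|).

Definition triangular_aas (rho : nat -> R)
    (P : nat -> topologicalGroupType -> Prop) : Prop :=
  (fun m => triangular_prob m (rho m) (P m)) @ \oo --> (1 : R).

Definition p_range (C : R) (f : nat -> R) (m : nat) (p : R) : Prop :=
  2 <= p <= C^-1 * Num.sqrt (ln (f m) / ln (ln (f m))).

Definition aas_FLp_conclusion (eps C : R) (f : nat -> R) : Prop :=
  triangular_aas (fun m => f m / m%:R ^+ 2)
    (fun m G => forall (p : R) (p1 : (1 <= p%:E)%E), p_range C f m p ->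
       FLp p1 ((2 - 2 * eps) `^ (2 * p)^-1) G) /\
  triangular_aas (fun m => f m / m%:R ^+ 2)
    (fun m G => forall (p : R) (p1 : (1 <= p%:E)%E), p_range C f m p ->
       Lp_lipschitz_fixed_points p1 ((2 - 2 * eps) `^ (2 * p)^-1) G).

End RandomGroup.

(* Main.v *)
Require Import Defs.
From Stdlib Require Import Relation_Operators.
From HB Require Import structures.
From mathcomp Require Import all_boot all_order all_algebra.
From mathcomp Require Import all_classical all_reals all_analysis.
From mathcomp Require Import measurable_realfun.
From mathcomp Require Import zify ring lra.
Set Implicit Arguments.
Unset Strict Implicit.
Unset Printing Implicit Defensive.
Import Order.TTheory GRing.Theory Num.Theory.
Import numFieldNormedType.Exports.
Local Open Scope ring_scope.

(** A triangular group acts on its presentation complex, and the link of a vertex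
    is a finite graph [X] on the letters, in which a relator [x y z] joins [x] to
    [z^-1], [y] to [x^-1] and [z] to [y^-1].  The theorem follows from a
    Poincare inequality on [X] with exponent [p] and a constant close to the
    optimal value [2], uniformly in the range of [p].

    _From Poincare to fixed points._  Take an affine action that preserves a norm,
    and let the energy of a point [v] be the sum over the letters [s] of
    [deg s |s v - v|^p].  For a relator [x y z], the points [x v] and
    [z^-1 v = x y v] are at distance [|v - y v|], so the energy is also the sum of
    [|s v - t v|^p] over the edges of [X].  A Poincare inequality with constant
    [lam > 1] then provides a centre [v'] for which the sum of
    [deg s |s v - v'|^p] is at most the energy of [v] divided by [lam].  By
    convexity and isometry this sum bounds the energy of the midpoint of [v] and
    [v'], so iterating gives a sequence that converges geometrically to a fixed
    point ([letters_fixed_point]).  The Poincare inequality for real functions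
    integrates to all [L^p] spaces because its centre is the arithmetic mean, and
    an [L]-bi-Lipschitz change of space divides the constant by
    [L^(2p) = 2 - 2 eps] ([bilipschitz_poincare]).  For Lipschitz actions on [L^p] the supremum of the
    norm over the orbit is an invariant norm.

    _The Poincare inequality._  For [p >= 2],
    [[
      |a - b|^p >= |a|^p + |b|^p - p a b max(|a|,|b|)^(p-2)
    ]]
    ([powR_dist_ge]), and with [F(a) = a |a|^(p-2)] the cross term
    [a b max(|a|,|b|)^(p-2)] equals
    [F(a) b + a F(b) - a b min(|a|^(p-2), |b|^(p-2))], where the last product is a
    positive definite kernel ([psd_kernel_min]).  Against a constant weight and
    for [f] of mean zero, the first two terms cancel and the cross terms sum to a
    nonpositive number.  So it remains to bound bilinear expressions in [F(f)] and
    [f] for the difference [B] of the adjacency kernel of [X] and a constant.  On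
    a block of two dyadic level sets of [f] such an expression is controlled by
    the discrepancy of [B], the number of edges between two sets minus its
    expected value; blocks of very different levels contribute little because row
    sums are bounded ([discrepancy_form]).  The loss is a factor
    [2^(p N)] for [2 N] levels, which [p <= c sqrt (ln f)] and [N ~ sqrt (ln f)]
    turn into a small power of [f].

    _Random graphs._  The number of link edges between two sets of letters is a
    sum of independent variables, one for each possible relator.  A Chernoff
    bound with exponent proportional to [1 + ln (n / b)], [b] the size of the
    larger set, beats the number of pairs of sets of these sizes, and gives a
    discrepancy [f^(3/4)] for all pairs at once, as soon as the degrees are of
    order [f]; the latter holds when [f >= 16 ln m] ([prob_quasirandom]).  Since
    discrepancy controls the graph on its own scale, degrees may fluctuate by
    constant factors, and the constant [16] serves for all [eps]. *)

(** * Elementary inequalities *)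

Section PowerInequalities.
Context {R : realType}.
Implicit Types a b x p q : R.

Lemma powR_bernoulli a x q : 0 <= a -> 0 <= x -> 1 <= q ->
  a `^ q + q * a `^ (q - 1) * (x - a) <= x `^ q.
Proof.
move=> a0 x0 q1; have q0 : 0 < q by lra.
have [->|q_neq1] := eqVneq q 1.
  by rewrite subrr powRr0 !powRr1// !mul1r; lra.
have q'1 : 0 < q - 1 by move: q_neq1; rewrite neq_lt; lra.
have [->|a_neq0] := eqVneq a 0.
  by rewrite !powR0 ?gt_eqF// mulr0 mul0r addr0 powR_ge0.
have pa : 0 < a by rewrite lt0r a_neq0.
have pp : 0 < a `^ (q - 1) by exact: powR_gt0.
(* Young's inequality for the pair x and a^(q-1) *)
have q'0 : 0 < q / (q - 1) by rewrite divr_gt0.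
have := @conjugate_powR _ x (a `^ (q - 1)) q (q / (q - 1)) x0 (ltW pp) q0 q'0.
rewrite -powRrM mulrCA mulfV ?gt_eqF// mulr1.
have -> : q^-1 + (q / (q - 1))^-1 = 1 by field; rewrite ?gt_eqF.
move=> /(_ erefl) H.
have aq : a `^ q = a * a `^ (q - 1) by rewrite mulr_powRB1.
have {}H : q * (x * a `^ (q - 1)) <= q * (x `^ q / q + a `^ q / (q / (q - 1))).
  by rewrite ler_pM2l.
have E : q * (x `^ q / q + a `^ q / (q / (q - 1))) = x `^ q + a `^ q * (q - 1).
  by field; rewrite ?gt_eqF.
rewrite E aq in H; rewrite aq; nra.
Qed.

Lemma powR_superadd a b q : 0 <= a -> 0 <= b -> 1 <= q ->
  a `^ q + b `^ q <= (a + b) `^ q.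
Proof.
move=> a0 b0 q1; have q0 : 0 < q by lra.
rewrite -!(@mulr_powRB1 _ _ q) ?addr_ge0// mulrDl lerD// ler_wpM2l//.
  by apply: ge0_ler_powR; rewrite ?nnegrE ?subr_ge0 ?addr_ge0// lerDl.
by apply: ge0_ler_powR; rewrite ?nnegrE ?subr_ge0 ?addr_ge0// lerDr.
Qed.

Lemma powR_add_ge a b p : 0 <= a -> 0 <= b -> 2 <= p ->
  a `^ p + b `^ p + p * (a * b * a `^ (p - 2)) <= (a + b) `^ p.
Proof.
move=> a0 b0 p2; have p0 : 0 < p by lra.
have p1 : 0 < p - 1 by lra.
have E x : 0 <= x -> x `^ p = x * x `^ (p - 1) by move=> x0; rewrite mulr_powRB1.
have q1 : 1 <= p - 1 by lra.
have E2 : a `^ (p - 1) = a * a `^ (p - 2).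
  by rewrite -(@mulr_powRB1 _ a (p - 1))//; congr (_ * _ `^ _); lra.
have H1 := @powR_bernoulli a (a + b) (p - 1) a0 (addr_ge0 a0 b0) q1.
have H2 := @powR_superadd a b (p - 1) a0 b0 q1.
have F : p - 1 - 1 = p - 2 by lra.
rewrite F [a + b - a](_ : _ = b) in H1; last by lra.
have G1 := ler_wpM2l a0 H1.
have G2 := ler_wpM2l b0 H2.
rewrite !E ?addr_ge0//; rewrite E2 in G1 G2 *.
set u := a `^ (p - 2) in G1 G2 *.
set v := b `^ (p - 1) in G1 G2 *.
set w := (a + b) `^ (p - 1) in G1 G2 *.
clearbody u v w; nra.
Qed.

Lemma powR_sub_ge a b p : 0 <= b <= a -> 2 <= p ->
  a `^ p + b `^ p - p * (a * b * a `^ (p - 2)) <= (a - b) `^ p.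
Proof.
move=> /andP[b0 ba] p2; have p0 : 0 < p by lra.
have a0 : 0 <= a by exact: le_trans ba.
have ab0 : 0 <= a - b by rewrite subr_ge0.
have p1 : 0 < p - 1 by lra.
have E x : 0 <= x -> x `^ p = x * x `^ (p - 1) by move=> x0; rewrite mulr_powRB1.
have q1 : 1 <= p - 1 by lra.
have E2 x : 0 <= x -> x `^ (p - 1) = x * x `^ (p - 2).
  by move=> x0; rewrite -(@mulr_powRB1 _ x (p - 1))//; congr (_ * _ `^ _); lra.
have H1 := @powR_bernoulli a (a - b) (p - 1) a0 ab0 q1.
have F : p - 1 - 1 = p - 2 by lra.
rewrite F [a - b - a](_ : _ = - b) in H1; last by lra.
have G1 := ler_wpM2l ab0 H1.
have G2 : b `^ (p - 2) <= a `^ (p - 2).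
  by apply: ge0_ler_powR; rewrite ?nnegrE//; lra.
have G3 : 0 <= a `^ (p - 2) by exact: powR_ge0.
rewrite !E//; rewrite !E2// in G1 *.
set u := a `^ (p - 2) in G1 G2 G3 *.
set v := b `^ (p - 2) in G1 G2 G3 *.
apply: le_trans G1.
have : b * (b * v) <= b * (b * u) by rewrite !ler_wpM2l.
have : 0 <= (p - 2) * (b * (b * u)) by rewrite !mulr_ge0// subr_ge0.
clearbody u v; nra.
Qed.

Lemma powR_expn (x q : R) k : 0 <= x -> (x ^+ k) `^ q = (x `^ q) ^+ k.
Proof.
move=> x0; elim: k => [|k IH]; first by rewrite !expr0 powR1.
by rewrite !exprS powRM ?exprn_ge0// IH.
Qed.

Lemma powR_midpoint (x y p : R) : 0 <= x -> 0 <= y -> 1 <= p ->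
  ((x + y) / 2) `^ p <= (x `^ p + y `^ p) / 2.
Proof.
move=> x0 y0 p1; pose m := (x + y) / 2.
have m0 : 0 <= m by rewrite /m; lra.
have := powR_bernoulli m0 x0 p1; have := powR_bernoulli m0 y0 p1.
have -> : p * m `^ (p - 1) * (x - m) = - (p * m `^ (p - 1) * (y - m)).
  by rewrite /m; field.
rewrite -/m; lra.
Qed.

Lemma expR_le_quad (x : R) : 0 <= x -> expR x <= 1 + x + x ^+ 2 * expR x.
Proof.
move=> x0.
have h : expR x <= 1 + x * expR x.
  have := ler_wpM2r (expR_ge0 x) (expR_ge1Dx (- x)).
  rewrite -expRD addNr expR0; lra.
have := ler_wpM2l x0 h; rewrite expr2; nra.
Qed.

Lemma expRN_le_quad (x : R) : 0 <= x -> expR (- x) <= 1 - x + x ^+ 2.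
Proof.
move=> x0; rewrite expRN.
have x1 : 0 < 1 + x by rewrite ltr_pwDl.
apply: (@le_trans _ _ (1 + x)^-1).
  by rewrite lef_pV2 ?posrE ?expR_gt0// expR_ge1Dx.
rewrite -[leLHS]mul1r ler_pdivrMr// expr2; nra.
Qed.

Lemma expR1_le4 : expR (1 : R) <= 4.
Proof.
have h : expR (2^-1 : R) <= 2.
  have := expR_ge1Dx (- 2^-1 : R); rewrite expRN => h.
  rewrite -[leLHS]invrK invf_ple ?posrE ?invr_gt0 ?expR_gt0//; lra.
have -> : (1 : R) = 2^-1 + 2^-1 by field.
by rewrite expRD; have := expR_gt0 (2^-1 : R); nra.
Qed.

(** The expansion of [|a - b|^p] around the larger of the two arguments. Its
    cross term [a b max(|a|,|b|)^(p-2)] is a sum of products of a function of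
    [a] and one of [b] minus a positive definite kernel; this is what lets an
    energy of exponent [p] be compared with bilinear forms. *)
Lemma powR_dist_ge a b p : 2 <= p ->
  `|a| `^ p + `|b| `^ p - p * (a * b * (Num.max `|a| `|b|) `^ (p - 2))
    <= `|a - b| `^ p.
Proof.
wlog ba : a b / `|b| <= `|a|.
  move=> H p2; case/orP: (le_total `|b| `|a|) => [ba|ab]; first exact: H.
  have := H b a ab p2.
  by rewrite [`|b| `^ p + _]addrC [b * a]mulrC maxC distrC.
move=> p2; rewrite max_l//.
have [ab|ab] := leP 0 (a * b).
  have -> : a * b = `|a| * `|b| by rewrite -normrM ger0_norm.
  have -> : `|a - b| = `|a| - `|b|.
    have [a0|a0] := leP 0 a.
      have [b0|b0] := leP 0 b.
        rewrite (ger0_norm a0) (ger0_norm b0) in ba *.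
        by rewrite ger0_norm// subr_ge0.
      have a00 : a = 0 by nra.
      by move: ba b0; rewrite a00 normr0 normr_le0 => /eqP ->; rewrite ltxx.
    have b0 : b <= 0 by nra.
    rewrite (ltr0_norm a0) (ler0_norm b0) in ba *.
    by rewrite ler0_norm; lra.
  by apply: powR_sub_ge; rewrite ?normr_ge0.
have -> : a * b = - (`|a| * `|b|) by rewrite -normrM ltr0_norm// opprK.
have -> : `|a - b| = `|a| + `|b|.
  have [a0|a0] := leP 0 a.
    have b0 : b < 0 by nra.
    by rewrite (ltr0_norm b0) !ger0_norm//; lra.
  have b0 : 0 < b by nra.
  by rewrite (gtr0_norm b0) !ltr0_norm//; lra.
rewrite mulNr mulrN opprK; exact: powR_add_ge.
Qed.

End PowerInequalities.

(** * Kernels on a finite set *)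

Section Kernels.
Context {R : realType} {T : finType}.
Implicit Types (Q B A : T -> T -> R) (f g h c : T -> R) (S U : {set T}).

Definition psd_kernel Q := forall u, 0 <= \sum_s \sum_t Q s t * (u s * u t).

(** Layer-cake: [min(h s, h t)] is a positive combination of the products
    [1_S(s) 1_S(t)], [S] running over the superlevel sets of [h]. The induction
    peels off the lowest layer. *)
Lemma psd_kernel_min Q g h : psd_kernel Q -> (forall s, 0 <= h s) ->
  0 <= \sum_s \sum_t Q s t * (g s * g t * Num.min (h s) (h t)).
Proof.
move=> Q0; move En : #|[set s | 0 < h s]| => n.
have {En} : (#|[set s | (0 < h s)%R]| <= n)%N by rewrite En.
elim: n h => [|n IH] h hn h0.
  rewrite leqn0 cards_eq0 in hn.
  rewrite big1// => s _; rewrite big1// => t _.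
  have hs u : h u = 0.
    apply/eqP; rewrite eq_le h0 andbT leNgt.
    by have := finset.in_set0 u; rewrite -(eqP hn) inE => ->.
  by rewrite !hs minxx !mulr0.
have [S0|[s0 s0S]] := set_0Vmem [set s | 0 < h s].
  by apply: IH => //; rewrite S0 cards0.
case: (arg_minP h s0S) => s1 s1S s1min.
change (is_true (s1 \in [set s | 0 < h s])) in s1S.
set m := h s1 in s1min *; set S := [set s | 0 < h s] in s0S s1S s1min hn *.
have m0 : 0 < m by move: s1S; rewrite inE.
pose i s : R := if s \in S then 1 else 0.
pose h' s := h s - m * i s.
have {}s1min s : s \in S -> m <= h s by exact: s1min.
have hS s : s \notin S -> h s = 0.
  by rewrite inE -leNgt => hs; apply/eqP; rewrite eq_le hs h0.
have h'0 s : 0 <= h' s.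
  rewrite /h' /i; case: ifPn => sS /=; last by rewrite mulr0 subr0.
  by rewrite mulr1 subr_ge0; exact: s1min.
have minE s t : Num.min (h s) (h t) = m * (i s * i t) + Num.min (h' s) (h' t).
  rewrite /h' /i; have [sS|sS] := boolP (s \in S); have [tS|tS] := boolP (t \in S).
  - by rewrite /= !mulr1 !minEle lerD2r; case: ifP => _; ring.
  - by rewrite /= (hS t tS) !(mulr0,mulr1) add0r subr0 !min_r// subr_ge0; exact: s1min.
  - by rewrite /= (hS s sS) !(mulr0,mulr1,mul0r) add0r subr0 !min_l// subr_ge0; exact: s1min.
  - by rewrite /= (hS s sS) (hS t tS) !(mulr0,mul0r) add0r subr0.
have IH' : 0 <= \sum_s \sum_t Q s t * (g s * g t * Num.min (h' s) (h' t)).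
  apply: IH => //; rewrite -ltnS; apply: leq_trans hn; apply: proper_card.
  apply/fintype.properP; split.
    apply/fintype.subsetP => s; rewrite !inE /h' /i.
    move=> /lt_le_trans -> //; rewrite gerBl mulr_ge0 ?(ltW m0)//.
    by case: ifP.
  by exists s1 => //; rewrite inE /h' /i s1S /= mulr1 -/m subrr ltxx.
have -> : \sum_s \sum_t Q s t * (g s * g t * Num.min (h s) (h t)) =
  m * (\sum_s \sum_t Q s t * ((g s * i s) * (g t * i t))) +
  \sum_s \sum_t Q s t * (g s * g t * Num.min (h' s) (h' t)).
  rewrite mulr_sumr -big_split; apply: eq_bigr => s _ /=.
  rewrite mulr_sumr -big_split; apply: eq_bigr => t _ /=.
  by rewrite minE; ring.
by rewrite addr_ge0// mulr_ge0// ltW.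
Qed.

(** [c] summed against a bounded weight is controlled by its sums over sets,
    since the extreme weights on a cube are signs. *)
Lemma sum_weight_le S c g (a M : R) :
  (forall s, s \in S -> `|g s| <= a) -> 0 <= a ->
  (forall S', S' \subset S -> `|\sum_(s in S') c s| <= M) ->
  `|\sum_(s in S) g s * c s| <= 2 * a * M.
Proof.
move=> ga a0 cM.
have H : `|\sum_(s in S) g s * c s| <= a * \sum_(s in S) `|c s|.
  apply: le_trans (ler_norm_sum _ _ _) _; rewrite mulr_sumr.
  by apply: ler_sum => s sS; rewrite normrM ler_wpM2r//; exact: ga.
apply: (le_trans H); rewrite -mulrA mulrCA ler_wpM2l//.
rewrite (bigID (fun s => 0 <= c s))/=.
have -> : \sum_(i in S | 0 <= c i) `|c i| = \sum_(i in [set i in S | 0 <= c i]) c i.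
  rewrite [RHS](eq_bigl (fun i => (i \in S) && (0 <= c i))); last first.
    by move=> i; rewrite !inE.
  by apply: eq_bigr => i /andP[_ ci]; rewrite ger0_norm.
have -> : \sum_(i in S | ~~ (0 <= c i)) `|c i| =
    - \sum_(i in [set i in S | ~~ (0 <= c i)]) c i.
  rewrite [in RHS](eq_bigl (fun i => (i \in S) && ~~ (0 <= c i))); last first.
    by move=> i; rewrite !inE.
  rewrite -sumrN.
  by apply: eq_bigr => i /andP[_]; rewrite -ltNge => ci; rewrite ltr0_norm.
rewrite mulr_natl mulr2n lerD//.
  apply: le_trans (ler_norm _) (cM _ _).
  by apply/fintype.subsetP => s; rewrite inE => /andP[].
apply: le_trans (ler_norm _) _; rewrite normrN; apply: cM.
by apply/fintype.subsetP => s; rewrite inE => /andP[].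
Qed.

Lemma block_weight_le B S U g h (a b M : R) :
  (forall s, s \in S -> `|g s| <= a) -> 0 <= a ->
  (forall t, t \in U -> `|h t| <= b) -> 0 <= b ->
  (forall S' U', S' \subset S -> U' \subset U ->
     `|\sum_(s in S') \sum_(t in U') B s t| <= M) ->
  `|\sum_(s in S) \sum_(t in U) B s t * (g s * h t)| <= 4 * a * b * M.
Proof.
move=> ga a0 hb b0 BM.
have -> : \sum_(s in S) \sum_(t in U) B s t * (g s * h t) =
    \sum_(s in S) g s * (\sum_(t in U) B s t * h t).
  apply: eq_bigr => s _; rewrite mulr_sumr; apply: eq_bigr => t _; ring.
have -> : 4 * a * b * M = 2 * a * (2 * b * M) by ring.
apply: sum_weight_le => // S' S'S.
rewrite exchange_big/=.
under eq_bigr do rewrite -mulr_suml mulrC.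
apply: sum_weight_le => // U' U'U.
by rewrite exchange_big/=; exact: BM.
Qed.

(** For [B] the difference between a weighted graph and a constant, this is the
    expander mixing estimate for the number of edges between two sets. *)
Definition discrepancy B (al : R) := forall S U,
  `|\sum_(s in S) \sum_(t in U) B s t| <= al * Num.sqrt (#|S|%:R * #|U|%:R).

Lemma near_count M N (j : 'I_M) :
  (#|[set k : 'I_M | (j <= k + N) && (k <= j + N)]| <= N.*2.+1)%N.
Proof.
have -> : N.*2.+1 = size (iota (j - N) (N.*2.+1)) by rewrite size_iota.
rewrite cardE -(size_map val); apply: uniq_leq_size.
  by rewrite map_inj_uniq ?enum_uniq//; exact: val_inj.
move=> x /mapP[k]; rewrite mem_enum inE => /andP[jk kj] ->.
rewrite mem_iota leq_subLR addnC jk/= -addnn.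
by apply: leq_ltn_trans kj _; rewrite addnS ltnS addnA leq_add2r addnC -leq_subLR.
Qed.

Lemma dyadic_levels f : exists (a : R) (M : nat) (lev : T -> 'I_M.+1), 0 < a /\
  forall s, f s != 0 -> a * 2 ^+ lev s <= `|f s| <= 2 * (a * 2 ^+ lev s).
Proof.
pose a := \big[Num.min/1]_(s | f s != 0) `|f s|.
have a0 : 0 < a.
  rewrite /a; apply: (big_ind (fun x : R => 0 < x)) => //; first by move=> x y x0 y0; rewrite lt_min x0.
  by move=> s; rewrite normr_gt0.
have af s : f s != 0 -> a <= `|f s| by move=> fs; exact: bigmin_le_cond.
have H s : exists k : nat, f s != 0 -> a * 2 ^+ k <= `|f s| <= 2 * (a * 2 ^+ k).
  have [fs0|fs0] := eqVneq (f s) 0; first by exists 0%N.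
  have ex : exists k : nat, `|f s| / a < 2 ^+ k.
    exists (Num.bound (`|f s| / a)).
    apply: lt_trans (archi_boundP (divr_ge0 (normr_ge0 _) (ltW a0))) _.
    by rewrite -natrX ltr_nat ltn_expl.
  case: (ex_minnP ex) => -[|k] kP kmin.
    exfalso; move: kP; rewrite expr0 ltr_pdivrMr// mul1r => /lt_le_trans/(_ (af _ fs0)).
    by rewrite ltxx.
  exists k => _; apply/andP; split.
    rewrite mulrC -ler_pdivlMr// leNgt; apply/negP => /kmin; by rewrite ltnn.
  by move: kP; rewrite ltr_pdivrMr// exprS => /ltW; rewrite mulrC mulrCA.
have [lev levP] := fin_all_exists H.
pose M := (\max_s lev s)%N.
exists a, M, (fun s => inord (lev s)); split=> // s fs.
by rewrite inordK ?levP// ltnS; exact: leq_bigmax.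
Qed.

End Kernels.

(** * The Poincare inequality from discrepancy *)

Section DiscrepancyForms.
Context {R : realType} {T : finType}.
Implicit Types (Q B A : T -> T -> R) (f g h c : T -> R) (S U : {set T}).
Implicit Types (al D p : R) (N : nat).

Lemma powR_sqr (z p : R) : 0 <= z -> 2 <= p -> z `^ p = z * z * z `^ (p - 2).
Proof.
move=> z0 p2; rewrite -(@mulr_powRB1 _ z p)//; last by lra.
rewrite -(@mulr_powRB1 _ z (p - 1))//; last by lra.
by rewrite mulrA; congr (_ * _ `^ _); lra.
Qed.

(** The first term accounts for the pairs of nearby dyadic levels, the second
    one, through the row sums, for the pairs of levels more than [N] apart. *)
Definition form_bound (al D p : R) (N : nat) : R :=
  4 * al * 2 `^ p * (2 ^+ N) `^ p * N.*2.+1%:R + 2 * D / 2 ^+ N.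

Lemma form_bound_ge0 al D p N : 0 <= al -> 0 <= D -> 0 <= form_bound al D p N.
Proof.
by move=> al0 D0; rewrite addr_ge0 ?mulr_ge0 ?powR_ge0 ?invr_ge0 ?exprn_ge0.
Qed.

Lemma le_form_bound al D p q N : 0 <= al -> p <= q ->
  form_bound al D p N <= form_bound al D q N.
Proof.
move=> al0 pq; rewrite lerD2r ler_wpM2r// -!mulrA; apply: ler_wpM2l => //.
apply: ler_wpM2l => //.
apply: ler_pM; rewrite ?powR_ge0//; apply: ler_powR => //; first by lra.
by rewrite exprn_ege1//; lra.
Qed.

Section LevelSums.
Variables (f : T -> R) (M : nat) (lev : T -> 'I_M).
Let lset j := [set s | (f s != 0) && (lev s == j)]%SET.

Lemma level_sum (X : T -> R) : (forall s, f s = 0 -> X s = 0) ->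
  \sum_s X s = \sum_j \sum_(s in lset j) X s.
Proof.
move=> X0; rewrite (partition_big lev predT)//=; apply: eq_bigr => j _.
rewrite big_mkcond [RHS]big_mkcond; apply: eq_bigr => s _; rewrite inE.
by case: (eqVneq (f s) 0) => [/X0 ->|] //=; case: ifP.
Qed.

Lemma level_sum2 (X : T -> T -> R) : (forall s t, f s = 0 -> X s t = 0) ->
  (forall s t, f t = 0 -> X s t = 0) ->
  \sum_s \sum_t X s t =
  \sum_j \sum_k \sum_(s in lset j) \sum_(t in lset k) X s t.
Proof.
move=> X0 X1; rewrite level_sum; last first.
  by move=> s s0; rewrite big1// => t _; exact: X0.
apply: eq_bigr => j _; rewrite [RHS]exchange_big/=; apply: eq_bigr => s _.
by rewrite level_sum// => t; exact: X1.
Qed.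

End LevelSums.

Lemma near_level_block B al N p f S U (x y : R) : 0 <= al -> 2 <= p ->
  discrepancy B al ->
  0 <= x -> 0 <= y -> x <= 2 ^+ N * y -> y <= 2 ^+ N * x ->
  (forall s, s \in S -> x <= `|f s| <= 2 * x) ->
  (forall s, s \in U -> y <= `|f s| <= 2 * y) ->
  `|\sum_(s in S) \sum_(t in U) B s t * (f s * `|f s| `^ (p - 2) * f t)|
  <= 2 * al * 2 `^ p * (2 ^+ N) `^ p *
     (\sum_(s in S) `|f s| `^ p + \sum_(s in U) `|f s| `^ p).
Proof.
move=> al0 p2 Bal x0 y0 xy yx fS fU.
have p20 : 0 <= p - 2 by lra.
have N1 : 1 <= 2 ^+ N :> R by rewrite exprn_ege1//; lra.
have mono u v : 0 <= u -> u <= v -> u `^ (p - 2) <= v `^ (p - 2).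
  by move=> u0 uv; apply: ge0_ler_powR; rewrite ?nnegrE// (le_trans u0).
have := @block_weight_le _ _ B S U (fun s => f s * `|f s| `^ (p - 2)) f
  (2 * x * (2 * x) `^ (p - 2)) (2 * y) (al * Num.sqrt (#|S|%:R * #|U|%:R)).
move=> /(_ _ _ _ _ _) H; apply: le_trans (H _ _ _ _ _) _ => {H}.
- move=> s /fS/andP[_ fs]; rewrite normrM (ger0_norm (powR_ge0 _ _)).
  by rewrite ler_pM ?powR_ge0//; exact: mono.
- by rewrite !mulr_ge0 ?powR_ge0.
- by move=> s /fU/andP[].
- by rewrite mulr_ge0.
- move=> S' U' S'S U'U; apply: le_trans (Bal _ _) _; rewrite ler_wpM2l//.
  by rewrite ler_sqrt ?mulr_ge0// ler_pM// ler_nat subset_leq_card.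
pose n : R := #|S|%:R; pose m : R := #|U|%:R; rewrite -/n -/m.
have n0 : 0 <= n by []. have m0 : 0 <= m by [].
have nm : Num.sqrt (n * m) <= (n + m) / 2.
  have h0 : 0 <= (n + m) / 2 by lra.
  rewrite -[leRHS](ger0_norm h0) -sqrtr_sqr ler_sqrt ?sqr_ge0//.
  by have := sqr_ge0 (n - m); nra.
pose Z := 2 * x * (2 * x) `^ (p - 2) * (2 * y).
have ZE z : 0 <= z -> x <= z -> y <= z -> Z <= 2 `^ p * z `^ p.
  move=> z0 xz yz; rewrite -powRM// (@powR_sqr (2 * z) p)// ?mulr_ge0//.
  rewrite mulrAC /Z; apply: ler_pM; rewrite ?mulr_ge0 ?powR_ge0//; last first.
    by rewrite ler_wpM2l.
  apply: ler_pM; rewrite ?powR_ge0 ?mulr_ge0 ?ler_wpM2l//.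
  by apply: mono; rewrite ?mulr_ge0 ?ler_wpM2l.
have cnt (V : {set T}) z : 0 <= z -> (forall s, s \in V -> z <= `|f s| <= 2 * z) ->
    z `^ p * #|V|%:R <= \sum_(s in V) `|f s| `^ p.
  move=> z0 fV; rewrite mulr_natr -sumr_const; apply: ler_sum => s sV.
  by apply: ge0_ler_powR; rewrite ?nnegrE//; [lra|have /andP[] := fV _ sV].
have Zn : Z * n <= 2 `^ p * (2 ^+ N) `^ p * \sum_(s in S) `|f s| `^ p.
  apply: (@le_trans _ _ (2 `^ p * (2 ^+ N) `^ p * (x `^ p * n))).
    rewrite !mulrA ler_wpM2r// -mulrA -powRM// ?exprn_ge0//.
    apply: ZE => //; first by rewrite mulr_ge0 ?exprn_ge0.
    by rewrite ler_peMl.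
  by rewrite ler_wpM2l ?mulr_ge0 ?powR_ge0// cnt.
have Zm : Z * m <= 2 `^ p * (2 ^+ N) `^ p * \sum_(s in U) `|f s| `^ p.
  apply: (@le_trans _ _ (2 `^ p * (2 ^+ N) `^ p * (y `^ p * m))).
    rewrite !mulrA ler_wpM2r// -mulrA -powRM// ?exprn_ge0//.
    apply: ZE => //; first by rewrite mulr_ge0 ?exprn_ge0.
    by rewrite ler_peMl.
  by rewrite ler_wpM2l ?mulr_ge0 ?powR_ge0// cnt.
have Z0 : 0 <= Z by rewrite /Z !mulr_ge0 ?powR_ge0.
have -> : 4 * (2 * x * (2 * x) `^ (p - 2)) * (2 * y) * (al * Num.sqrt (n * m)) =
    4 * al * (Z * Num.sqrt (n * m)) by rewrite /Z; ring.
have H1 : Z * Num.sqrt (n * m) <= (Z * n + Z * m) / 2.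
  have -> : (Z * n + Z * m) / 2 = Z * ((n + m) / 2) by ring.
  by rewrite ler_wpM2l.
have H2 : 4 * al * (Z * Num.sqrt (n * m)) <= 4 * al * ((Z * n + Z * m) / 2).
  by rewrite ler_wpM2l// mulr_ge0.
apply: (le_trans H2).
have := ler_wpM2l (mulr_ge0 (ler0n _ 2) al0) (lerD Zn Zm).
set P1 := 2 `^ p; set P2 := (2 ^+ N) `^ p; set s1 := \sum_(s in S) _.
by set s2 := \sum_(s in U) _; clearbody P1 P2 s1 s2; nra.
Qed.

(** Pairs of vertices where the two values of [|f|] differ by a factor above
    [2^N] are harmless because of the row sums; the other pairs fall in blocks of
    dyadic level sets of [f], to each of which the discrepancy applies. *)
Lemma discrepancy_form B al D N p f : 0 <= al -> 2 <= p ->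
  (forall s t, B s t = B t s) -> discrepancy B al ->
  (forall s, \sum_t `|B s t| <= D) ->
  `|\sum_s \sum_t B s t * (f s * `|f s| `^ (p - 2) * f t)|
  <= form_bound al D p N * \sum_s `|f s| `^ p.
Proof.
move=> al0 p2 Bsym Bal BD.
have [a [M [lev [a0 levP]]]] := dyadic_levels f.
pose near (j k : 'I_M.+1) := (j <= k + N)%N && (k <= j + N)%N.
pose W s t := B s t * (f s * `|f s| `^ (p - 2) * f t).
pose lset j := [set s | (f s != 0) && (lev s == j)]%SET.
have p20 : 0 <= p - 2 by lra.
have N0 : 0 < 2 ^+ N :> R by rewrite exprn_gt0.
have -> : \sum_s \sum_t B s t * (f s * `|f s| `^ (p - 2) * f t) =
    \sum_s \sum_t (if near (lev s) (lev t) then W s t else 0) +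
    \sum_s \sum_t (if near (lev s) (lev t) then 0 else W s t).
  rewrite -big_split; apply: eq_bigr => s _; rewrite -big_split.
  by apply: eq_bigr => t _ /=; case: ifP; rewrite ?addr0 ?add0r.
apply: le_trans (ler_normD _ _) _; rewrite /form_bound mulrDl; apply: lerD.
- rewrite (@level_sum2 f _ lev); last 2 first.
    by move=> s t fs; case: ifP => // _; rewrite /W fs !(mul0r,mulr0).
    by move=> s t ft; case: ifP => // _; rewrite /W ft !(mul0r,mulr0).
  rewrite -/lset; pose K := 2 * al * 2 `^ p * (2 ^+ N) `^ p.
  have K0 : 0 <= K by rewrite /K !mulr_ge0 ?powR_ge0.
  pose c j := \sum_(s in lset j) `|f s| `^ p.
  have c0 j : 0 <= c j by apply: sumr_ge0 => s _; exact: powR_ge0.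
  have nearC j k : near j k = near k j by rewrite /near andbC.
  apply: (@le_trans _ _ (\sum_j \sum_(k | near j k) K * (c j + c k))).
    apply: le_trans (ler_norm_sum _ _ _) _; apply: ler_sum => j _.
    apply: le_trans (ler_norm_sum _ _ _) _; rewrite [leRHS]big_mkcond/=.
    apply: ler_sum => k _.
    have E : \sum_(s in lset j) \sum_(t in lset k)
       (if near (lev s) (lev t) then W s t else 0) =
       if near j k then \sum_(s in lset j) \sum_(t in lset k) W s t else 0.
      case: ifPn => jk.
        apply: eq_bigr => s; rewrite inE => /andP[_ /eqP ->].
        by apply: eq_bigr => t; rewrite inE => /andP[_ /eqP ->]; rewrite jk.
      apply: big1 => s; rewrite inE => /andP[_ /eqP ->].
      by apply: big1 => t; rewrite inE => /andP[_ /eqP ->]; rewrite (negPf jk).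
    rewrite E; case: ifPn => [/andP[jk kj]|_]; last by rewrite normr0.
    apply: (@near_level_block _ _ _ _ _ _ _ (a * 2 ^+ j) (a * 2 ^+ k)) => //.
    + by rewrite mulr_ge0 ?exprn_ge0// ltW.
    + by rewrite mulr_ge0 ?exprn_ge0// ltW.
    + rewrite mulrCA ler_wpM2l ?(ltW a0)// -exprD.
      by rewrite ler_weXn2l ?(addnC N)//; lra.
    + rewrite mulrCA ler_wpM2l ?(ltW a0)// -exprD.
      by rewrite ler_weXn2l ?(addnC N)//; lra.
    + by move=> s; rewrite inE => /andP[fs /eqP <-]; exact: levP.
    + by move=> s; rewrite inE => /andP[fs /eqP <-]; exact: levP.
  have E : \sum_j \sum_(k | near j k) K * (c j + c k) =
      2 * K * \sum_j \sum_(k | near j k) c j.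
    have E1 : \sum_j \sum_(k | near j k) c k = \sum_j \sum_(k | near j k) c j.
      rewrite (exchange_big_dep predT)//=; apply: eq_bigr => j _.
      by apply: eq_bigl => k; rewrite nearC.
    under eq_bigr do (rewrite -mulr_sumr big_split/=).
    rewrite -mulr_sumr big_split/= E1; ring.
  have -> : \sum_s `|f s| `^ p = \sum_j c j.
    by apply: level_sum => s ->; rewrite normr0 powR0//; lra.
  rewrite E; have -> : 4 * al * 2 `^ p * (2 ^+ N) `^ p * N.*2.+1%:R * (\sum_j c j) =
    2 * K * (N.*2.+1%:R * \sum_j c j) by rewrite /K; ring.
  rewrite ler_wpM2l ?mulr_ge0// mulr_sumr; apply: ler_sum => j _.
  rewrite (eq_bigl (fun k => k \in [set k | near j k]%SET)); last first.
    by move=> k; rewrite inE.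
  by rewrite sumr_const -[leLHS]mulr_natl ler_wpM2r// ler_nat; exact: near_count.
- apply: (@le_trans _ _ (\sum_s \sum_t `|B s t| * ((2 ^+ N)^-1 *
      (`|f s| `^ p + `|f t| `^ p)))).
    apply: le_trans (ler_norm_sum _ _ _) _; apply: ler_sum => s _.
    apply: le_trans (ler_norm_sum _ _ _) _; apply: ler_sum => t _.
    have P0 : 0 <= (2 ^+ N)^-1 * (`|f s| `^ p + `|f t| `^ p).
      by rewrite mulr_ge0 ?invr_ge0 ?addr_ge0 ?powR_ge0// ltW.
    case: ifPn => st; first by rewrite normr0 mulr_ge0.
    rewrite /W normrM ler_wpM2l// !normrM (ger0_norm (powR_ge0 _ _)).
    have [fs|fs] := eqVneq (f s) 0; first by rewrite {1 2}fs normr0 !mul0r.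
    have [ft|ft] := eqVneq (f t) 0; first by rewrite {1}ft normr0 mulr0.
    have main (u v : R) : 0 <= u -> 0 <= v -> 2 ^+ N * v <= u ->
        u * u `^ (p - 2) * v <= (2 ^+ N)^-1 * u `^ p /\
        v * v `^ (p - 2) * u <= (2 ^+ N)^-1 * u `^ p.
      move=> u0 v0 uv; have vu : v <= (2 ^+ N)^-1 * u.
        by rewrite mulrC ler_pdivlMr// mulrC.
      have vu' : v <= u.
        apply: le_trans uv; rewrite ler_peMl// exprn_ege1//; lra.
      rewrite (@powR_sqr u p)//; split.
        have -> : (2 ^+ N)^-1 * (u * u * u `^ (p - 2)) =
          u * u `^ (p - 2) * ((2 ^+ N)^-1 * u) by ring.
        by rewrite ler_wpM2l// mulr_ge0 ?powR_ge0.
      have -> : (2 ^+ N)^-1 * (u * u * u `^ (p - 2)) =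
          ((2 ^+ N)^-1 * u) * u `^ (p - 2) * u by ring.
      rewrite ler_wpM2r// ler_pM ?powR_ge0//.
      by apply: ge0_ler_powR; rewrite ?nnegrE.
    move: (levP s fs) (levP t ft) => /andP[s1 s2] /andP[t1 t2].
    have step (j k : nat) (u v : R) : (k + N < j)%N -> a * 2 ^+ j <= u ->
        v <= 2 * (a * 2 ^+ k) -> 2 ^+ N * v <= u.
      move=> jk ju vk; apply: le_trans ju.
      apply: (@le_trans _ _ (2 ^+ N * (2 * (a * 2 ^+ k)))); first by rewrite ler_wpM2l// ltW.
      have -> : 2 ^+ N * (2 * (a * 2 ^+ k)) = a * 2 ^+ (k + N).+1.
        by rewrite exprS exprD; ring.
      by rewrite ler_wpM2l ?(ltW a0)// ler_weXn2l//; lra.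
    move: st; rewrite /near negb_and -!ltnNge => /orP[st|st].
      have := main `|f s| `|f t| (normr_ge0 _) (normr_ge0 _) (step _ _ _ _ st s1 t2).
      by case=> + _; move/le_trans; apply; rewrite ler_wpM2l ?invr_ge0 ?(ltW N0)// lerDl powR_ge0.
    have := main `|f t| `|f s| (normr_ge0 _) (normr_ge0 _) (step _ _ _ _ st t1 s2).
    by case=> _; move/le_trans; apply; rewrite ler_wpM2l ?invr_ge0 ?(ltW N0)// lerDr powR_ge0.
  have E1 : \sum_s \sum_t `|B s t| * ((2 ^+ N)^-1 * (`|f s| `^ p + `|f t| `^ p)) =
      2 / 2 ^+ N * \sum_s (\sum_t `|B s t|) * `|f s| `^ p.
    under eq_bigr => s _ do under eq_bigr => t _ do
      rewrite mulrCA mulrDr.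
    under eq_bigr do rewrite -mulr_sumr big_split/=.
    rewrite -mulr_sumr big_split/= [X in _ + X]exchange_big/=.
    have -> : \sum_j \sum_i `|B i j| * `|f j| `^ p = \sum_i \sum_t `|B i t| * `|f i| `^ p.
      by apply: eq_bigr => s _; apply: eq_bigr => t _; rewrite Bsym.
    under [in RHS]eq_bigr do rewrite mulr_suml.
    ring.
  rewrite E1; set X := \sum_s `|f s| `^ p.
  have -> : 2 * D / 2 ^+ N * X = 2 / 2 ^+ N * (D * X) by ring.
  rewrite ler_wpM2l ?divr_ge0 ?(ltW N0)//.
  rewrite mulr_sumr; apply: ler_sum => s _.
  by rewrite ler_wpM2r ?powR_ge0.
Qed.

(** By [powR_dist_ge] the energy of [f] is at least [2 sum deg |f|^p] minus [p]
    times the sum of [A] against the cross terms.  Against the constant weight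
    [th] the cross terms are nonpositive: their products cancel because [f] has
    mean zero and what remains is minus a positive definite form.  Against
    [A - th] they are small by [discrepancy_form]. *)
Lemma discrepancy_poincare A (th al D d0 p : R) N f :
  (forall s t, A s t = A t s) -> (forall s t, 0 <= A s t) -> 0 <= th ->
  0 <= al -> discrepancy (fun s t => A s t - th) al ->
  (forall s, \sum_t `|A s t - th| <= D) -> 0 <= D ->
  0 < d0 -> (forall s, d0 <= \sum_t A s t) ->
  2 <= p -> \sum_s f s = 0 ->
  (2 - 3 * p * form_bound al D p N / d0) *
     (\sum_s (\sum_t A s t) * `|f s| `^ p) <=
  \sum_s \sum_t A s t * `|f s - f t| `^ p.
Proof.
move=> Asym A0 th0 al0 Aal AD D0 d00 Ad0 p2 f0.
pose B s t := A s t - th.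
have Bsym s t : B s t = B t s by rewrite /B Asym.
pose F s := f s * `|f s| `^ (p - 2).
pose h s := `|f s| `^ (p - 2).
have h0 s : 0 <= h s by exact: powR_ge0.
pose kap s t := f s * f t * (Num.max `|f s| `|f t|) `^ (p - 2).
pose mn s t := f s * f t * Num.min (h s) (h t).
have p0 : 0 <= p by lra.
have kapE s t : kap s t = F s * f t + F t * f s - mn s t.
  rewrite /kap /mn /F -/(h s) -/(h t).
  have -> : Num.max `|f s| `|f t| `^ (p - 2) = Num.max (h s) (h t).
    have mono (u v : R) : 0 <= u -> u <= v -> u `^ (p - 2) <= v `^ (p - 2).
      move=> u0 uv; apply: ge0_ler_powR => //; rewrite ?nnegrE//.
        by lra.
      exact: le_trans uv.
    by case: (leP `|f s| `|f t|) => fst; [rewrite max_r|rewrite max_l] => //;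
      apply: mono => //; rewrite ltW.
  have -> : Num.max (h s) (h t) = h s + h t - Num.min (h s) (h t).
    by rewrite minEle maxEle; case: ifP => _; ring.
  ring.
pose S := \sum_s `|f s| `^ p.
have S0 : 0 <= S by apply: sumr_ge0 => s _; exact: powR_ge0.
pose eta := form_bound al D p N.
have eta0 : 0 <= eta by exact: form_bound_ge0.
have Fform : `|\sum_s \sum_t B s t * (F s * f t)| <= eta * S.
  exact: discrepancy_form.
have minform : - (eta * S) <= \sum_s \sum_t B s t * mn s t.
  pose eta2 := form_bound al D 2 N.
  have eta20 : 0 <= eta2 by exact: form_bound_ge0.
  pose Q s t := B s t + eta2 * (s == t)%:R.
  have diagE (X : T -> T -> R) :
      \sum_s \sum_t Q s t * X s t = \sum_s \sum_t B s t * X s t + eta2 * \sum_s X s s.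
    rewrite mulr_sumr -big_split; apply: eq_bigr => s _ /=.
    under eq_bigr do rewrite mulrDl.
    rewrite big_split/=; congr (_ + _).
    rewrite (bigD1 s)//= eqxx mulr1 big1 ?addr0// => t ts.
    by rewrite eq_sym (negPf ts) mulr0 mul0r.
  have Qpsd : psd_kernel Q.
    move=> u; rewrite diagE.
    have := @discrepancy_form B al D N 2 u al0 (lexx _) Bsym Aal AD.
    rewrite -/eta2 subrr.
    under eq_bigr do under eq_bigr do rewrite powRr0 mulr1.
    have -> : \sum_s `|u s| `^ 2 = \sum_s u s * u s.
      by apply: eq_bigr => s _; rewrite powR_mulrn// real_normK ?num_real// expr2.
    by rewrite ler_norml => /andP[+ _]; rewrite -subr_ge0 opprK.
  have := @psd_kernel_min _ _ Q f h Qpsd h0; rewrite diagE.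
  have -> : \sum_s f s * f s * Num.min (h s) (h s) = S.
    apply: eq_bigr => s _; rewrite minxx (@powR_sqr `|f s|)//.
    by rewrite -[X in _ = X * _]expr2 real_normK ?num_real.
  rewrite -/mn => H.
  have : eta2 * S <= eta * S by rewrite ler_wpM2r// le_form_bound.
  by move: H; rewrite -/(\sum_s \sum_t B s t * mn s t); lra.
have kap_th : \sum_s \sum_t kap s t <= 0.
  have -> : \sum_s \sum_t kap s t = - \sum_s \sum_t 1 * mn s t.
    under eq_bigr => s _ do under eq_bigr => t _ do rewrite kapE.
    under eq_bigr do rewrite !big_split/=.
    rewrite !big_split/= -sumrN.
    rewrite (big1 _ _ (fun s => \sum_t F s * f t)); last first.
      by move=> s _; rewrite -mulr_sumr f0 mulr0.
    rewrite exchange_big/= (big1 _ _ (fun t => \sum_s F t * f s)); last first.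
      by move=> s _; rewrite -mulr_sumr f0 mulr0.
    rewrite !add0r; apply: eq_bigr => s _; rewrite -sumrN.
    by apply: eq_bigr => t _; rewrite mul1r.
  rewrite oppr_le0; apply: psd_kernel_min => // u.
  under eq_bigr do under eq_bigr do rewrite mul1r.
  under eq_bigr do rewrite -mulr_sumr.
  by rewrite -mulr_suml -expr2 sqr_ge0.
have kapA : \sum_s \sum_t A s t * kap s t <= 3 * (eta * S).
  have -> : \sum_s \sum_t A s t * kap s t =
      th * (\sum_s \sum_t kap s t) + (\sum_s \sum_t B s t * (F s * f t)) +
      (\sum_s \sum_t B s t * (F t * f s)) - \sum_s \sum_t B s t * mn s t.
    rewrite mulr_sumr -!big_split -sumrB; apply: eq_bigr => s _ /=.
    rewrite mulr_sumr -!big_split -sumrB; apply: eq_bigr => t _ /=.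
    rewrite kapE /B; ring.
  have -> : \sum_s \sum_t B s t * (F t * f s) = \sum_s \sum_t B s t * (F s * f t).
    rewrite exchange_big/=; apply: eq_bigr => s _; apply: eq_bigr => t _.
    by rewrite Bsym.
  have := ler_norm (\sum_s \sum_t B s t * (F s * f t)).
  have := mulr_ge0_le0 th0 kap_th; lra.
pose W := \sum_s (\sum_t A s t) * `|f s| `^ p.
have SW : d0 * S <= W.
  by rewrite /S /W mulr_sumr; apply: ler_sum => s _; rewrite ler_wpM2r ?powR_ge0.
have E : 2 * W - p * (\sum_s \sum_t A s t * kap s t) <=
    \sum_s \sum_t A s t * `|f s - f t| `^ p.
  have -> : 2 * W - p * (\sum_s \sum_t A s t * kap s t) =
     \sum_s \sum_t A s t * (`|f s| `^ p + `|f t| `^ p - p * kap s t).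
    have -> : 2 * W = \sum_s \sum_t A s t * `|f s| `^ p +
                     \sum_s \sum_t A s t * `|f t| `^ p.
      have -> : \sum_s \sum_t A s t * `|f t| `^ p = W.
        rewrite exchange_big/= /W; apply: eq_bigr => s _; rewrite mulr_suml.
        by apply: eq_bigr => t _; rewrite Asym.
      have -> : \sum_s \sum_t A s t * `|f s| `^ p = W.
        by rewrite /W; apply: eq_bigr => s _; rewrite mulr_suml.
      ring.
    rewrite mulr_sumr -big_split -sumrB; apply: eq_bigr => s _ /=.
    rewrite mulr_sumr -big_split -sumrB; apply: eq_bigr => t _ /=; ring.
  apply: ler_sum => s _; apply: ler_sum => t _; rewrite ler_wpM2l//.
  exact: powR_dist_ge.
apply: le_trans E; rewrite -/W -/eta.
have -> : (2 - 3 * p * eta / d0) * W = 2 * W - p * (3 * (eta / d0 * W)).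
  by field; rewrite gt_eqF.
rewrite lerD2l lerN2 ler_wpM2l//; apply: (le_trans kapA); rewrite ler_wpM2l//.
by rewrite -mulrA ler_wpM2l// ler_pdivlMl.
Qed.

End DiscrepancyForms.

(** * Poincare inequalities with values in Lebesgue spaces *)

Section PoincareSpaces.
Local Open Scope classical_set_scope.
Context {R : realType} {T : finType}.
Variables (A : T -> T -> R) (p lam : R).

Definition poincare_on (W : Type) (d : W -> W -> R) (H : set W) :=
  forall u : T -> W, (forall s, H (u s)) -> exists2 c, H c &
  lam * (\sum_s (\sum_t A s t) * d (u s) c `^ p) <=
  \sum_s \sum_t A s t * d (u s) (u t) `^ p.

Hypothesis A0 : forall s t, 0 <= A s t.
Hypothesis lam0 : 0 <= lam.
Hypothesis p1 : 1 <= p.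

Let p0 : 0 < p. Proof. exact: lt_le_trans p1. Qed.

Definition mean_zero_poincare := forall f : T -> R, \sum_s f s = 0 ->
  lam * (\sum_s (\sum_t A s t) * `|f s| `^ p) <=
  \sum_s \sum_t A s t * `|f s - f t| `^ p.

Hypothesis real_poincare : mean_zero_poincare.

Let deg s := \sum_t A s t.
Let deg0 s : 0 <= deg s. Proof. by apply: sumr_ge0. Qed.

Let mean_poincare (f : T -> R) :
  \sum_s (lam * deg s) * `|f s - #|T|%:R^-1 * \sum_t f t| `^ p <=
  \sum_(st : T * T) A st.1 st.2 * `|f st.1 - f st.2| `^ p.
Proof.
have [T0|T0] := posnP #|T|.
  rewrite big1 ?sumr_ge0// => [st _|s _]; first by rewrite mulr_ge0 ?powR_ge0.
  by have := fintype0 s; rewrite T0 => /(_ erefl).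
have := real_poincare (f := fun s => f s - #|T|%:R^-1 * \sum_t f t).
rewrite sumrB sumr_const -[X in _ - X]mulr_natl mulVKf ?pnatr_eq0 -?lt0n//.
move=> /(_ (subrr _)); rewrite mulr_sumr.
under eq_bigr do rewrite mulrA; move=> /le_trans; apply.
rewrite pair_big/=; apply: ler_sum => -[s t] _ /=.
by rewrite opprB addrA subrK.
Qed.

Lemma finite_lp_poincare n : poincare_on (@finite_lp_dist R p n) setT.
Proof.
move=> u _.
have dE x y : @finite_lp_dist R p n x y `^ p = \sum_i `|(x - y) 0 i| `^ p.
  rewrite /finite_lp_dist /finite_lp_norm -powRrM mulVf ?gt_eqF// powRr1//.
  by apply: sumr_ge0 => i _; exact: powR_ge0.
exists (\row_i (#|T|%:R^-1 * \sum_t u t 0 i)) => //.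
have -> : lam * \sum_s (\sum_t A s t) *
     finite_lp_dist p (u s) (\row_i (#|T|%:R^-1 * \sum_t u t 0 i)) `^ p =
   \sum_i \sum_s (lam * deg s) * `|u s 0 i - #|T|%:R^-1 * \sum_t u t 0 i| `^ p.
  rewrite [RHS]exchange_big/= mulr_sumr; apply: eq_bigr => s _.
  rewrite dE mulrA mulr_sumr; apply: eq_bigr => i _.
  by rewrite !mxE.
have -> : \sum_s \sum_t A s t * finite_lp_dist p (u s) (u t) `^ p =
   \sum_i \sum_(st : T * T) A st.1 st.2 * `|u st.1 0 i - u st.2 0 i| `^ p.
  rewrite [RHS]exchange_big/= pair_big/=; apply: eq_bigr => st _.
  by rewrite dE mulr_sumr; apply: eq_bigr => i _; rewrite !mxE.
by apply: ler_sum => i _; exact: (mean_poincare (fun s => u s 0 i)).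
Qed.

Lemma powR_normD_le (a b : R) :
  `|a + b| `^ p <= 2 `^ p * (`|a| `^ p + `|b| `^ p).
Proof.
have H x y : `|x| <= `|y| -> `|x + y| `^ p <= 2 `^ p * (`|x| `^ p + `|y| `^ p) :> R.
  move=> xy; apply: (@le_trans _ _ ((2 * `|y|) `^ p)).
    apply: ge0_ler_powR; rewrite ?nnegrE ?mulr_ge0 ?(ltW p0)//.
    by have := ler_normD x y; lra.
  by rewrite powRM// ler_wpM2l ?powR_ge0// lerDr powR_ge0.
case/orP: (le_total `|a| `|b|) => ab; first exact: H.
by rewrite addrC [X in _ * X]addrC; exact: H.
Qed.

Lemma lp_space_le x y (z : nat -> R) : (forall k, `|z k| <= `|x k| + `|y k|) ->
  lp_space p x -> lp_space p y -> lp_space p z.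
Proof.
move=> zxy xp yp; rewrite /lp_space/=.
apply: (@series_le_cvg _ _ (fun k => 2 `^ p * (`|x k| `^ p + `|y k| `^ p))).
- by move=> k; exact: powR_ge0.
- by move=> k; rewrite mulr_ge0 ?addr_ge0 ?powR_ge0.
- move=> k; have := powR_normD_le `|x k| `|y k|; rewrite !normr_id; apply: le_trans.
  rewrite [X in _ <= X `^ _]ger0_norm ?addr_ge0//.
  by apply: ge0_ler_powR; rewrite ?nnegrE ?addr_ge0// ltW.
- rewrite (_ : (fun k => _) = 2 `^ p *: ((fun k => `|x k| `^ p) + (fun k => `|y k| `^ p)))//.
  by apply: is_cvg_seriesZ; exact: (is_cvg_seriesD xp yp).
Qed.

Lemma lp_spaceD x y : lp_space p x -> lp_space p y -> lp_space p (x \+ y).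
Proof. by apply: lp_space_le => k; exact: ler_normD. Qed.

Lemma lp_spaceB x y : lp_space p x -> lp_space p y -> lp_space p (x \- y).
Proof. by apply: lp_space_le => k; exact: ler_normB. Qed.

Lemma lp_spaceZ a x : lp_space p x -> lp_space p (fun k => a * x k).
Proof.
move=> xp; rewrite /lp_space/=.
rewrite (_ : (fun k => _) = `|a| `^ p *: (fun k => `|x k| `^ p)).
  exact: is_cvg_seriesZ.
by apply/funext => k; rewrite normrM powRM.
Qed.

Lemma lp_space0 : lp_space p (fun=> 0).
Proof.
rewrite /lp_space/=.
have -> : series (fun k : nat => `|(0 : R)| `^ p) = fun=> 0.
  apply/funext => n; rewrite /series/= big1// => k _.
  by rewrite normr0 powR0// gt_eqF.
exact: is_cvg_cst.
Qed.

Lemma lp_space_sum (u : T -> nat -> R) (r : seq T) : (forall s, lp_space p (u s)) ->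
  lp_space p (fun k => \sum_(s <- r) u s k).
Proof.
move=> up; elim: r => [|s r IH].
  rewrite (_ : (fun k => _) = fun=> 0); first exact: lp_space0.
  by apply/funext => k; rewrite big_nil.
rewrite (_ : (fun k => _) = u s \+ (fun k => \sum_(s <- r) u s k)).
  exact: (lp_spaceD (up s) IH).
by apply/funext => k; rewrite big_cons.
Qed.

Lemma cvg_sum_seq (I : Type) (r : seq I) (F : I -> nat -> R) (l : I -> R) :
  (forall i, F i @ \oo --> l i) ->
  (fun n => \sum_(i <- r) F i n) @ \oo --> \sum_(i <- r) l i.
Proof.
move=> Fl; elim: r => [|i r IH].
  rewrite big_nil (_ : (fun n => _) = fun=> 0); first exact: cvg_cst.
  by apply/funext => n; rewrite big_nil.
rewrite big_cons (_ : (fun n => _) = F i \+ (fun n => \sum_(i <- r) F i n)).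
  exact: (cvgD (Fl i) IH).
by apply/funext => n; rewrite big_cons.
Qed.

Lemma lp_poincare : poincare_on (lp_dist p) (lp_space p).
Proof.
move=> u up; pose c k := #|T|%:R^-1 * \sum_t u t k.
have cp : lp_space p c by apply: lp_spaceZ; exact: lp_space_sum.
exists c => //.
have dE x y : lp_space p x -> lp_space p y ->
    series (fun k => `|x k - y k| `^ p) @ \oo --> lp_dist p x y `^ p.
  move=> xp yp; have c1 : cvgn (series (fun k => `|x k - y k| `^ p)) by exact: (lp_spaceB xp yp).
  rewrite /lp_dist /lp_norm -powRrM mulVf ?gt_eqF// powRr1//.
  apply: limr_ge => //; apply: nearW => n.
  by apply: sumr_ge0 => k _; exact: powR_ge0.
have H1 : (fun n => \sum_s (lam * deg s) * series (fun k => `|u s k - c k| `^ p) n)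
     @ \oo --> lam * \sum_s (\sum_t A s t) * lp_dist p (u s) c `^ p.
  rewrite mulr_sumr; under [X in _ --> X]eq_bigr do rewrite mulrA.
  by apply: cvg_sum_seq => s; apply: cvgMl_tmp; exact: dE.
have H2 : (fun n => \sum_(st : T * T) A st.1 st.2 *
       series (fun k => `|u st.1 k - u st.2 k| `^ p) n)
     @ \oo --> \sum_s \sum_t A s t * lp_dist p (u s) (u t) `^ p.
  rewrite pair_big/=.
  by apply: cvg_sum_seq => s; apply: cvgMl_tmp; exact: dE.
apply: (ler_cvg_to H1 H2); apply: nearW => n.
rewrite (eq_bigr (fun s => \sum_(0 <= k < n) (lam * deg s) * `|u s k - c k| `^ p)); last first.
  by move=> s _; rewrite /series/= mulr_sumr.
rewrite [leRHS](eq_bigr (fun st => \sum_(0 <= k < n) A st.1 st.2 * `|u st.1 k - u st.2 k| `^ p)); last first.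
  by move=> s _; rewrite /series/= mulr_sumr.
rewrite exchange_big [leRHS]exchange_big/=; apply: ler_sum => k _.
exact: (mean_poincare (fun s => u s k)).
Qed.

Section Lp.
Context d (X : measurableType d) (mu : {measure set X -> \bar R}).
Variable p1e : (1 <= p%:E)%E.
Local Notation Lp := (LspaceType mu p1e).
Local Notation Lf := (LfunType mu p1e).

Lemma Lclass_sub (f g : Lf) : Lclass f - Lclass g = Lclass (f - g).
Proof.
rewrite {1}/GRing.add/= {1}/GRing.opp/=.
apply: eq_Lclass; have := LclassK f; have := LclassK (- Lfun_of (Lclass g)).
have := LclassK g.
apply: filterS3 => t /= + + + _; move=> /(_ I) eg /(_ I) eng /(_ I) ef.
congr (_ + _); first exact: ef.
by apply: etrans eng _; congr (- _); exact: eg.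
Qed.

Lemma measurable_normpowR (f : X -> R) : measurable_fun setT f ->
  measurable_fun setT (fun x => (`|f x| `^ p)%:E).
Proof.
move=> mf; apply/measurable_EFinP.
apply: (@measurableT_comp _ _ _ _ _ _ (fun x : R => x `^ p)).
  exact: measurable_powR.
exact: measurableT_comp.
Qed.

Lemma Lnorm_powR (f : Lf) :
  ((`|Lclass f| `^ p)%:E = \int[mu]_x (`|f x| `^ p)%:E)%E.
Proof.
rewrite [`|_|]Lp_norm_class -poweR_EFin finite_norm_fine poweR_Lnorm ?gt_eqF//.
Qed.

Lemma Lp_sum_le (I J : finType) (a : I -> R) (b : J -> R) (g : I -> Lf) (h : J -> Lf) :
  (forall i, 0 <= a i) -> (forall j, 0 <= b j) ->
  (forall x, \sum_i a i * `|g i x| `^ p <= \sum_j b j * `|h j x| `^ p) ->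
  \sum_i a i * `|Lclass (g i)| `^ p <= \sum_j b j * `|Lclass (h j)| `^ p.
Proof.
move=> a0 b0 gh.
have E (K : finType) (e : K -> R) (k : K -> Lf) : (forall i, 0 <= e i) ->
    ((\sum_i e i * `|Lclass (k i)| `^ p)%:E =
     \int[mu]_x (\sum_i e i * `|k i x| `^ p)%:E)%E.
  move=> e0; under eq_integral do rewrite -sumEFin.
  rewrite ge0_integral_sum//; last 2 first.
  - move=> i; under eq_fun do rewrite EFinM.
    apply: measurable_funeM; apply: measurable_normpowR; exact: measurable_funPT.
  - by move=> i x _; rewrite lee_fin mulr_ge0 ?powR_ge0.
  rewrite -sumEFin; apply: eq_bigr => i _.
  under eq_integral do rewrite EFinM.
  rewrite ge0_integralZl_EFin//.
  - by rewrite EFinM Lnorm_powR.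
  - by apply: measurable_normpowR; exact: measurable_funPT.
have M (K : finType) (e : K -> R) (k : K -> Lf) :
    measurable_fun setT (fun x => (\sum_i e i * `|k i x| `^ p)%:E).
  under eq_fun do rewrite -sumEFin.
  apply: emeasurable_sum => i; under eq_fun do rewrite EFinM.
  apply: measurable_funeM; apply: measurable_normpowR; exact: measurable_funPT.
rewrite -lee_fin !E//; apply: ge0_le_integral => //.
- by move=> x _; rewrite lee_fin sumr_ge0// => i _; rewrite mulr_ge0 ?powR_ge0.
- by move=> x _; rewrite lee_fin; exact: gh.
Qed.

Lemma Lspace_poincare : poincare_on (@norm_dist R Lp) setT.
Proof.
move=> u _; pose f s := Lfun_of (u s).
pose c := #|T|%:R^-1 *: \sum_t f t.
exists (Lclass c) => //.
have uE s : u s = Lclass (f s) by rewrite /f Lfun_ofK.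
have H := @Lp_sum_le T (T * T)%type (fun s => lam * deg s) (fun st => A st.1 st.2)
  (fun s => f s - c) (fun st => f st.1 - f st.2).
rewrite mulr_sumr; under eq_bigr do rewrite mulrA uE /norm_dist Lclass_sub.
rewrite pair_big/=; under [leRHS]eq_bigr do rewrite !uE /norm_dist Lclass_sub.
apply: H => [s|st|x]; [by rewrite mulr_ge0|by []|].
have cE : c x = #|T|%:R^-1 * \sum_t f t x.
  rewrite /c /=; congr (_ * _); elim/big_ind2 : _ => //.
  by move=> y1 y2 z1 z2 <- <-.
have := mean_poincare (fun s => f s x); rewrite -cE; exact.
Qed.

End Lp.
End PoincareSpaces.

(** * Link graphs and contraction of the energy *)

Section LinkGraph.
Context {R : realType} {T : finType}.
Variable inv : T -> T.
Hypothesis invK : involutive inv.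
Implicit Types (A : {set 3.-tuple T}) (w : seq T).

(** In the Cayley graph the neighbours [x] and [z^-1] of [1] are joined by the
    third side of the triangle with boundary [x y z], and the same holds for the
    cyclic conjugates of the relator: these are the edges that it contributes to
    the link of [1], each taken with both orientations. *)
Definition links w : seq (T * T) :=
  if w is [:: x; y; z] then
    [:: (x, inv z); (inv z, x); (y, inv x); (inv x, y); (z, inv y); (inv y, z)]
  else [::].

Definition link_adj A (s t : T) : R :=
  \sum_(w in A) (count_mem (s, t) (links w))%:R.

Definition link_deg A (s : T) : R := \sum_t link_adj A s t.

Lemma tuple3E (w : 3.-tuple T) : exists x y z, w = [:: x; y; z] :> seq T.
Proof. by case: w => -[|x [|y [|z []]]]//= _; exists x, y, z. Qed.

Lemma link_adj_ge0 A s t : 0 <= link_adj A s t.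
Proof. exact: sumr_ge0. Qed.

Lemma count_links_sym w s t : count_mem (s, t) (links w) = count_mem (t, s) (links w).
Proof.
have E (a b : T) : ((a, b) == (s, t)) = ((b, a) == (t, s)).
  by rewrite !xpair_eqE andbC.
case: w => [|x [|y [|z []]]]//=; rewrite !E.
do 6 (move: (nat_of_bool _) => ?); lia.
Qed.

Lemma link_adjC A s t : link_adj A s t = link_adj A t s.
Proof. by apply: eq_bigr => w _; rewrite count_links_sym. Qed.

Lemma sum_link_adj A (phi : T -> T -> R) :
  \sum_s \sum_t link_adj A s t * phi s t =
  \sum_(w in A) \sum_(e <- links w) phi e.1 e.2.
Proof.
rewrite pair_big/=; under eq_bigr do rewrite mulr_suml.
rewrite exchange_big/=; apply: eq_bigr => w _.
elim: (links w) => [|e l IH].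
  by rewrite big_nil big1// => st _; rewrite mul0r.
rewrite big_cons -IH /=; under eq_bigr do rewrite natrD mulrDl.
rewrite big_split/=; congr (_ + _).
rewrite (bigD1 e)//= -surjective_pairing eqxx mul1r big1 ?addr0// => st ste.
by rewrite -surjective_pairing eq_sym (negPf ste) mul0r.
Qed.

Lemma sum_link_deg A (phi : T -> R) :
  \sum_s link_deg A s * phi s = \sum_(w in A) \sum_(e <- links w) phi e.1.
Proof.
rewrite -(sum_link_adj A (fun s _ => phi s)); apply: eq_bigr => s _.
by rewrite mulr_suml.
Qed.

Lemma sum_link_deg_inv A (phi : T -> R) :
  \sum_s link_deg A s * phi (inv s) = \sum_s link_deg A s * phi s.
Proof.
rewrite !sum_link_deg; apply: eq_bigr => w _.
have [x [y [z ->]]] := tuple3E w; rewrite /= !big_cons !big_nil /= !invK; ring.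
Qed.

End LinkGraph.

Section FixedPoint.
Local Open Scope classical_set_scope.
Context {R : realType} {T : finType}.
Variable inv : T -> T.
Hypothesis invK : involutive inv.
Variables (A : {set 3.-tuple T}) (p lam d0 : R).
Hypothesis p1 : 1 <= p.
Hypothesis lam1 : 1 < lam.
Hypothesis d00 : 0 < d0.
Hypothesis degA : forall s, d0 <= link_deg inv A s.

Variables (V : lmodType R) (N : V -> R).
Hypothesis ND : forall u v, N (u + v) <= N u + N v.
Hypothesis NZ : forall a u, N (a *: u) = `|a| * N u.
Hypothesis N_eq0 : forall u, N u = 0 -> u = 0.
Hypothesis N_complete : forall (u : nat -> V) (M th : R), 0 <= th < 1 ->
  (forall k, N (u k.+1 - u k) <= M * th ^+ k) ->
  exists l, (fun k => N (u k - l)) @ \oo --> (0 : R).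
Hypothesis poincare :
  poincare_on (link_adj inv A) p lam (fun u v => N (u - v)) setT.

Variable act : T -> V -> V.
Hypothesis act_affine : forall s a u v,
  act s (a *: u + (1 - a) *: v) = a *: act s u + (1 - a) *: act s v.
Hypothesis act_isom : forall s u v, N (act s u - act s v) = N (u - v).
Hypothesis actK : forall s v, act s (act (inv s) v) = v.
Hypothesis act_rel : forall (w : 3.-tuple T) x y z, w \in A ->
  w = [:: x; y; z] :> seq T -> forall v, act x (act y (act z v)) = v.

Let N0 : N 0 = 0. Proof. by rewrite -(scale0r 0) NZ normr0 mul0r. Qed.
Let NN u : N (- u) = N u. Proof. by rewrite -scaleN1r NZ normrN normr1 mul1r. Qed.
Let N_ge0 u : 0 <= N u.
Proof. by have := ND u (- u); rewrite subrr N0 NN; lra. Qed.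
Let NB u v : N (u - v) = N (v - u). Proof. by rewrite -NN opprB. Qed.
Let p0 : 0 < p. Proof. exact: lt_le_trans p1. Qed.
Let actVK s v : act (inv s) (act s v) = v.
Proof. by rewrite -{2}(invK s) actK. Qed.
Let lam0 : 0 < lam. Proof. exact: lt_trans lam1. Qed.

Let deg := link_deg inv A : T -> R.
Let deg_ge0 s : 0 <= deg s. Proof. by apply: le_trans (degA s); exact: ltW. Qed.
Let cost u v := \sum_s deg s * N (act s u - v) `^ p.
Let energy v := cost v v.

Let energy_ge0 v : 0 <= energy v.
Proof. by apply: sumr_ge0 => s _; rewrite mulr_ge0 ?powR_ge0. Qed.

(** For a relator [x y z] the link edge from [x] to [z^-1] spans the points
    [x v] and [x y v], whose distance is the displacement of [v] by [y]. *)
Let link_energy v :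
  \sum_s \sum_t link_adj inv A s t * N (act s v - act t v) `^ p = energy v.
Proof.
rewrite /energy /cost (sum_link_adj inv A (fun s t => N (act s v - act t v) `^ p)).
rewrite (sum_link_deg inv A (fun s => N (act s v - v) `^ p)).
apply: eq_bigr => w wA; have [x [y [z wE]]] := tuple3E w.
have xyz := act_rel wA wE.
have Vz u : act (inv z) u = act x (act y u) by rewrite -[in RHS](actK z u) xyz.
have Vx u : act (inv x) u = act y (act z u) by rewrite -[in LHS](xyz u) actVK.
have Vy u : act (inv y) u = act z (act x u).
  have yzx : act y (act z (act x u)) = u by rewrite -[LHS](actVK x) xyz actVK.
  by rewrite -[in LHS]yzx actVK.
have dispV s : N (act (inv s) v - v) = N (act s v - v).
  by rewrite -(act_isom s) actK NB.
rewrite wE /= !big_cons !big_nil /= !dispV Vz Vx Vy.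
rewrite !act_isom !(NB v); ring.
Qed.

Let cost_sym u v : cost u v = cost v u.
Proof.
rewrite /cost -(sum_link_deg_inv invK); apply: eq_bigr => s _.
by rewrite -[in LHS](act_isom s) actK NB.
Qed.

Let cost_root s u v e : cost u v <= e -> N (act s u - v) <= (e / d0) `^ p^-1.
Proof.
move=> uve; have H : N (act s u - v) `^ p <= e / d0.
  rewrite ler_pdivlMr// mulrC; apply: (@le_trans _ _ (deg s * N (act s u - v) `^ p)).
    by rewrite ler_wpM2r ?powR_ge0.
  apply: le_trans uve; rewrite /cost (bigD1 s)//= lerDl.
  by apply: sumr_ge0 => t _; rewrite mulr_ge0 ?powR_ge0.
have e0 : 0 <= e / d0 by apply: le_trans H; exact: powR_ge0.
rewrite -[leLHS]powRr1// -[X in _ `^ X](@mulfV _ p) ?gt_eqF// powRrM.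
by apply: ge0_ler_powR; rewrite ?nnegrE ?powR_ge0 ?invr_ge0// ltW.
Qed.

Let le_root s v : N (act s v - v) <= (energy v / d0) `^ p^-1.
Proof. exact: cost_root. Qed.

(** Moving half-way towards the centre of the orbit points contracts the
    energy: the displacement of the midpoint of [v] and [v'] by [s] is the mean
    of [s v - v'] and [s v' - v], and both have the same total cost since the
    action is isometric. *)
Let improve (s0 : T) v : exists v', energy v' <= energy v / lam /\
  N (v' - v) <= (energy v / d0) `^ p^-1.
Proof.
have [//|v' _] := poincare (u := fun s => act s v).
rewrite link_energy -/(cost v v') => H.
have cost_le : cost v v' <= energy v / lam by rewrite ler_pdivlMr// mulrC.
exists (2^-1 *: v + (1 - 2^-1) *: v'); split.
  apply: le_trans cost_le.
  have -> : cost v v' = \sum_s deg s * ((N (act s v - v') `^ p + N (act s v' - v) `^ p) / 2).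
    transitivity ((cost v v' + cost v' v) / 2).
      by rewrite cost_sym; field.
    rewrite /cost -big_split/= mulr_suml; apply: eq_bigr => s _ /=; by field.
  rewrite /energy /cost; apply: ler_sum => s _; rewrite ler_wpM2l//.
  apply: le_trans (powR_midpoint (N_ge0 _) (N_ge0 _) p1).
  apply: ge0_ler_powR; rewrite ?nnegrE ?divr_ge0 ?addr_ge0// ?(ltW p0)//.
  have h2 : 1 - 2^-1 = 2^-1 :> R by field.
  rewrite act_affine h2 -!scalerDr -scalerBr NZ ger0_norm// mulrC.
  rewrite ler_pM2r// [act s v + _ - _](_ : _ = (act s v - v') + (act s v' - v)) ?ND//.
  by rewrite addrACA -opprD [v' + v]addrC.
have energy_lam : energy v / lam <= energy v by rewrite ler_pdivrMr// ler_peMr// ltW.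
have close : N (act s0 v - v') <= (energy v / d0) `^ p^-1.
  exact/cost_root/(le_trans cost_le).
have -> : 2^-1 *: v + (1 - 2^-1) *: v' - v = 2^-1 *: (v' - v).
  have h2 : 1 - 2^-1 = 2^-1 :> R by field.
  rewrite h2 scalerBr addrAC addrC; congr (_ + _).
  rewrite -[X in _ - X]scale1r -scalerBl (_ : 2^-1 - 1 = - 2^-1) ?scaleNr//.
  by field.
rewrite NZ ger0_norm//.
have := ND (act s0 v - v) (v' - act s0 v).
rewrite [X in N X <= _](_ : _ = v' - v); last by rewrite addrC addrA subrK.
have := le_root s0 v; rewrite (NB v' (act s0 v)); lra.
Qed.

Lemma letters_fixed_point : exists v, forall s, act s v = v.
Proof.
have [T0|[s0 _]] := set_0Vmem [set: T]%SET.
  by exists 0 => s; have := finset.in_setT s; rewrite T0 finset.in_set0.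
have [next nextP] := choice (improve s0).
pose v k := iter k next 0; pose E0 := energy 0.
have En k : energy (v k) <= E0 * lam^-1 ^+ k.
  elim: k => [|k IH]; first by rewrite expr0 mulr1.
  have [H _] := nextP (v k); apply: (le_trans H).
  by rewrite exprSr mulrA ler_wpM2r// invr_ge0 ltW.
have E00 : 0 <= E0 by exact: energy_ge0.
pose th := lam^-1 `^ p^-1; pose M := (E0 / d0) `^ p^-1.
have root k : (energy (v k) / d0) `^ p^-1 <= M * th ^+ k.
  have -> : th ^+ k = (lam^-1 ^+ k) `^ p^-1.
    by rewrite powR_expn// invr_ge0 ltW.
  rewrite /M -powRM ?divr_ge0 ?exprn_ge0 ?invr_ge0 ?(ltW lam0) ?(ltW d00)//.
  apply: ge0_ler_powR; rewrite ?nnegrE ?invr_ge0 ?mulr_ge0 ?exprn_ge0 ?invr_ge0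
    ?(ltW p0) ?(ltW d00) ?(ltW lam0)//.
  by rewrite mulrAC ler_wpM2r// invr_ge0 ltW.
have lamV : 0 < lam^-1 < 1 by rewrite invr_gt0 lam0 invf_lt1.
have th01 : 0 <= th < 1.
  have pV : 0 < p^-1 by rewrite invr_gt0.
  have := @gt0_ltr_powR R p^-1 pV lam^-1 1; rewrite powR1 powR_ge0 !nnegrE.
  by case/andP: lamV => /ltW -> ->; apply.
have [l vl] := N_complete th01 (fun k => le_trans (proj2 (nextP (v k))) (root k)).
exists l => s; apply/eqP; rewrite -subr_eq0; apply/eqP/N_eq0/le_anti.
rewrite N_ge0 andbT.
have thc : (fun k => M * th ^+ k) @ \oo --> (0 : R).
  rewrite -[X in _ --> X](mulr0 M); apply: cvgMl_tmp; apply: cvg_expr.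
  by rewrite ger0_norm; case/andP: th01.
have lim : (fun k => N (v k - l) + N (v k - l) + M * th ^+ k) @ \oo --> (0 : R).
  rewrite -[X in _ --> X](_ : 0 + 0 + 0 = _); last by rewrite !addr0.
  exact: cvgD (cvgD vl vl) thc.
apply: (ler_cvg_to (cvg_cst (N (act s l - l))) lim); apply: nearW => k /=.
have := ND (act s l - act s (v k)) (act s (v k) - l).
rewrite addrA subrK act_isom (NB l) => /le_trans; apply.
rewrite -addrA lerD2l.
have := ND (act s (v k) - v k) (v k - l); rewrite addrA subrK => /le_trans; apply.
by have := root k; have := le_root s (v k); lra.
Qed.

End FixedPoint.

(** * Presented groups and their affine actions *)

Section PresentedGroup.
Context {X : choiceType}.
Variable rels : set (seq (letter X)).
Local Open Scope quotient_scope.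

Definition word_class (w : seq (letter X)) : presented rels := \pi_(presented rels) w.

Lemma word_class_eq u v : clos_refl_sym_trans _ (word_step rels) u v ->
  word_class u = word_class v.
Proof. by move=> uv; apply/eqmodP/asboolP. Qed.

Lemma word_class_repr g : word_class (repr g) = g.
Proof. exact: reprK. Qed.

Lemma word_class_cons x w :
  word_class (x :: w) = (word_class [:: x] * word_class w)%g.
Proof.
have step_ctx u v w1 w2 : clos_refl_sym_trans _ (word_step rels) u v ->
    clos_refl_sym_trans _ (word_step rels) (w1 ++ u ++ w2) (w1 ++ v ++ w2).
  elim=> [a b ab|a|a b _|a b c _ ab _ bc].
  - apply/rst_step; case: ab => [a' b' y|a' b' r rr].
      by rewrite -!catA !(catA w1); exact: (@step_cancel _ rels (w1 ++ a') (b' ++ w2) y).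
    by rewrite -!catA !(catA w1); exact: (@step_relator _ rels (w1 ++ a') (b' ++ w2) r).
  - exact: rst_refl.
  - exact: rst_sym.
  - exact: rst_trans ab bc.
have reprE w1 : clos_refl_sym_trans _ (word_step rels) (repr (word_class w1)) w1.
  by have /eqmodP/asboolP := reprK (word_class w1).
transitivity (word_class (repr (word_class [:: x]) ++ repr (word_class w))); last by [].
apply: word_class_eq; apply: rst_sym.
apply: (@rst_trans _ _ _ ([:: x] ++ repr (word_class w))).
  exact: (step_ctx _ _ [::] (repr (word_class w)) (reprE [:: x])).
by have := step_ctx _ _ [:: x] [::] (reprE w); rewrite !cats0.
Qed.

Lemma word_class_nil : word_class [::] = 1%g. Proof. by []. Qed.

Lemma letter_invK : involutive (@letter_inv X).
Proof. by move=> [x e]; rewrite /letter_inv/= negbK. Qed.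

Lemma word_class_letterV x :
  (word_class [:: x] * word_class [:: letter_inv x])%g = 1%g.
Proof.
rewrite -word_class_cons -word_class_nil; apply: word_class_eq.
exact/rst_step/(step_cancel _ [::] [::]).
Qed.

Lemma word_class_rel r : rels r -> word_class r = 1%g.
Proof.
move=> rr; rewrite -word_class_nil; apply: word_class_eq; apply/rst_step.
by have := @step_relator _ rels [::] [::] r rr; rewrite /= cats0.
Qed.

End PresentedGroup.

Section AffineAction.
Context {R : realType} {G : groupType} {V : lmodType R}.
Variables (pi : G -> {linear V -> V}) (b : G -> V).
Hypothesis act : affine_action pi b.

Lemma affine_actionM g h v :
  pi (g * h)%g v + b (g * h)%g = pi g (pi h v + b h) + b g.
Proof. by case: act. Qed.

Lemma affine_action1 v : pi 1%g v + b 1%g = v.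
Proof. by case: act. Qed.

Lemma linear_part1 v : pi 1%g v = v.
Proof.
have := affine_action1 v; have := affine_action1 0.
by rewrite linear0 add0r => ->; rewrite addr0.
Qed.

Lemma linear_partM g h v : pi (g * h)%g v = pi g (pi h v).
Proof.
have := affine_actionM g h v; have := affine_actionM g h 0.
rewrite !linearD !linear0 !add0r => ->.
by rewrite -!addrA => /addIr.
Qed.

End AffineAction.

Section TriangularFixedPoint.
Local Open Scope classical_set_scope.
Context {R : realType} {m : nat}.
Variables (A : {set 3.-tuple (letter 'I_m)}) (p lam d0 : R).

(** The relators give the identities between the affine maps of the letters on
    which the energy argument rests, and a point fixed by the letters is fixed by
    the group they generate. The norm [N] may differ from a given norm of [V]:
    for Lipschitz actions it is the supremum over an orbit. *)
Lemma triangular_fixed_point (V : lmodType R) (N : V -> R)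
    (pi : triangular_group A -> {linear V -> V}) (b : triangular_group A -> V) :
  1 <= p -> 1 < lam -> 0 < d0 ->
  (forall s, d0 <= link_deg (@letter_inv 'I_m) A s) ->
  (forall u v, N (u + v) <= N u + N v) ->
  (forall a u, N (a *: u) = `|a| * N u) ->
  (forall u, N u = 0 -> u = 0) ->
  (forall (u : nat -> V) (M th : R), 0 <= th < 1 ->
    (forall k, N (u k.+1 - u k) <= M * th ^+ k) ->
    exists l, (fun k => N (u k - l)) @ \oo --> (0 : R)) ->
  poincare_on (link_adj (@letter_inv 'I_m) A) p lam (fun u v => N (u - v)) setT ->
  affine_action pi b -> (forall g v, N (pi g v) = N v) -> has_fixed_point pi b.
Proof.
move=> p1 lam1 d00 degA ND NZ N_eq0 Nc poin actP isom.
pose gen s : triangular_group A := word_class _ [:: s].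
pose act s v := pi (gen s) v + b (gen s).
have fix_letters : exists v, forall s, act s v = v.
  apply: (@letters_fixed_point _ _ _ (@letter_invK _) A p lam d0 p1 lam1 d00 degA
    V N ND NZ N_eq0 Nc poin act).
  - move=> s a u v; rewrite /act linearD !linearZ/= !scalerDr addrACA -scalerDl.
    by rewrite [a + (1 - a)]addrC subrK scale1r.
  - by move=> s u v; rewrite /act opprD addrACA subrr addr0 -linearB isom.
  - move=> s v; rewrite /act -affine_actionM//.
    by rewrite [X in pi X](_ : _ = 1%g) ?[X in b X](_ : _ = 1%g)
      ?affine_action1//; exact: word_class_letterV.
  - move=> w x y z wA wE v; rewrite /act -!affine_actionM//.
    have -> : (gen x * gen y * gen z)%g = 1%g.
      rewrite -mulgA /gen -(word_class_cons _ y [:: z]) -(word_class_cons _ x [:: y; z]).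
      apply: word_class_rel.
      by exists w.
    exact: affine_action1.
have [v vP] := fix_letters; exists v => g.
rewrite -(word_class_repr g); elim: (repr g) => [|x w IH].
  exact: (affine_action1 actP).
rewrite word_class_cons; apply: etrans (affine_actionM actP _ _ _) _.
by rewrite IH; exact: vP.
Qed.

End TriangularFixedPoint.

(** * Finite-dimensional geometry and isometric actions *)

Section FiniteDimension.
Local Open Scope classical_set_scope.
Context {R : realType} (V : lmodType R).

Lemma finite_family_dim (r : seq V) :
  exists (n : nat) (E : set V), has_dim n E /\ forall x, x \in r -> E x.
Proof.
elim: r => [|v r [n [E [[e [efree EE]] rE]]]].
  exists 0%N, [set 0]; split => //; exists (fun=> 0); split.
    by move=> c _ [].
  apply/seteqP; split => [x -> |x [c _ <-]] /=; last by rewrite big_ord0.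
  by exists (fun=> 0) => //; rewrite big_ord0.
have [Ev|Ev] := pselect (E v).
  exists n, E; split; first by exists e.
  by move=> x; rewrite inE => /predU1P[->//|]; exact: rE.
pose e' (i : 'I_n.+1) := if unlift ord0 i is Some j then e j else v.
have e'0 : e' ord0 = v by rewrite /e' unlift_none.
have e'S j : e' (lift ord0 j) = e j by rewrite /e' liftK.
have sumE (c : 'I_n.+1 -> R) : \sum_i c i *: e' i =
    c ord0 *: v + \sum_i c (lift ord0 i) *: e i.
  rewrite big_ord_recl e'0; congr (_ + _).
  by apply: eq_bigr => i _; rewrite e'S.
exists n.+1, (range (fun c : 'I_n.+1 -> R => \sum_i c i *: e' i)); split.
  exists e'; split => // c; rewrite sumE => c0.
  have c00 : c ord0 = 0.
    apply/eqP/negP => /negP cn0; apply: Ev; rewrite EE.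
    exists (fun i => - (c ord0)^-1 * c (lift ord0 i)) => //.
    have {}c0 : \sum_i c (lift ord0 i) *: e i = - (c ord0 *: v).
      by apply/eqP; rewrite -addr_eq0 addrC c0.
    under eq_bigr do rewrite -scalerA; rewrite -scaler_sumr c0.
    by rewrite scalerN scaleNr opprK scalerA mulVf// scale1r.
  move=> i; case: (unliftP ord0 i) => [j ->|-> //].
  apply: (efree (fun j => c (lift ord0 j))).
  by move: c0; rewrite c00 scale0r add0r.
move=> x; rewrite inE => /predU1P[->|/rE].
  exists (fun i => (i == ord0)%:R) => //.
  by rewrite sumE eqxx scale1r big1 ?addr0// => i _; rewrite scale0r.
rewrite EE => -[c _ <-].
exists (fun i => if unlift ord0 i is Some j then c j else 0) => //.
rewrite sumE unlift_none scale0r add0r.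
by apply: eq_bigr => i _; rewrite liftK.
Qed.

End FiniteDimension.

Section Transfer.
Local Open Scope classical_set_scope.
Context {R : realType} {T : finType}.
Variables (A : T -> T -> R) (p lam L : R).
Hypothesis A0 : forall s t, 0 <= A s t.
Hypothesis lam0 : 0 <= lam.
Hypothesis p0 : 0 < p.
Hypothesis L0 : 0 < L.

Lemma bilipschitz_poincare (V W : Type) (dV : V -> V -> R) (dW : W -> W -> R)
    (E : set V) (F : set W) :
  (forall u v, 0 <= dV u v) -> (forall u v, 0 <= dW u v) ->
  bilipschitz_equiv dV dW L E F -> poincare_on A p lam dW F ->
  poincare_on A p (lam / (L `^ p * L `^ p)) dV E.
Proof.
move=> dV0 dW0 [f [fEF _ fsurj] fL] poin u uE.
have [//|c Fc H] := poin (f \o u); first by move=> s; apply: fEF; exact: uE.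
have [c' Ec' fc'] := fsurj c Fc; exists c' => //.
have Lp0 : 0 < L `^ p by exact: powR_gt0.
rewrite mulrAC ler_pdivrMr ?mulr_gt0//.
have up s : dV (u s) c' `^ p <= L `^ p * dW (f (u s)) c `^ p.
  rewrite -powRM ?(ltW L0)//; apply: ge0_ler_powR; rewrite ?nnegrE ?mulr_ge0 ?(ltW L0) ?(ltW p0)//.
  by have /andP[+ _] := fL _ _ (uE s) Ec'; rewrite fc' mulrC ler_pdivrMr// mulrC.
have lo s t : dW (f (u s)) (f (u t)) `^ p <= L `^ p * dV (u s) (u t) `^ p.
  rewrite -powRM ?(ltW L0)//; apply: ge0_ler_powR; rewrite ?nnegrE ?mulr_ge0 ?(ltW L0) ?(ltW p0)//.
  by have /andP[_] := fL _ _ (uE s) (uE t).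
apply: (@le_trans _ _ (L `^ p * (lam * (\sum_s (\sum_t A s t) * dW (f (u s)) c `^ p)))).
  rewrite mulrCA ler_wpM2l// mulr_sumr; apply: ler_sum => s _.
  by rewrite mulrCA ler_wpM2l ?sumr_ge0.
apply: (@le_trans _ _ (L `^ p * \sum_s \sum_t A s t * dW (f (u s)) (f (u t)) `^ p)).
  by rewrite ler_wpM2l// ltW.
rewrite [leRHS]mulrC -mulrA ler_wpM2l ?(ltW Lp0)// mulr_sumr; apply: ler_sum => s _.
rewrite mulr_sumr; apply: ler_sum => t _.
by rewrite mulrCA ler_wpM2l.
Qed.

Hypothesis p1 : 1 <= p.
Hypothesis real_poincare : mean_zero_poincare A p lam.

Lemma Lp_geometry_poincare (p1e : (1 <= p%:E)%E) (V : normedModType R) :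
  Lp_geometry p1e L V ->
  poincare_on A p (lam / (L `^ p * L `^ p)) (fun u v : V => `|u - v|) setT.
Proof.
move=> geo u _.
have [n [E [Edim uE]]] := finite_family_dim [seq u s | s <- enum T].
have [F [_ EF Fgeo]] := geo n E Edim.
have uF s : F (u s) by apply: EF; apply: uE; apply: map_f; rewrite mem_enum.
suff poin : poincare_on A p (lam / (L `^ p * L `^ p)) (@norm_dist R V) F.
  by have [c _ H] := poin u uF; exists c.
case: Fgeo => [[k _ bl]|bl|[d [X [mu bl]]]].
- apply: (bilipschitz_poincare _ _ bl) => [x y|x y|]; first exact: normr_ge0.
    exact: powR_ge0.
  exact: finite_lp_poincare.
- apply: (bilipschitz_poincare _ _ bl) => [x y|x y|]; first exact: normr_ge0.
    exact: powR_ge0.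
  exact: lp_poincare.
- apply: (bilipschitz_poincare _ _ bl) => [x y|x y|]; [exact: normr_ge0..|].
  exact: Lspace_poincare.
Qed.

End Transfer.

Section GeometricCauchy.
Local Open Scope classical_set_scope.
Context {R : realType}.

Lemma geometric_cauchy (V : completeNormedModType R) (u : nat -> V) (M th : R) :
  0 <= th < 1 -> (forall k, `|u k.+1 - u k| <= M * th ^+ k) ->
  exists2 l, u @ \oo --> l & forall k, `|u k - l| <= M * th ^+ k / (1 - th).
Proof.
move=> /andP[th0 th1] uM.
have M0 : 0 <= M by have := uM 0%N; rewrite expr0 mulr1; exact: le_trans.
have cu : cvgn (series (telescope u)).
  apply: normed_cvg; rewrite /normed_series_of/=.
  apply: (@series_le_cvg _ _ (geometric M th)).
  - by move=> k; exact: normr_ge0.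
  - by move=> k; rewrite /geometric/= mulr_ge0 ?exprn_ge0.
  - by move=> k; rewrite /telescope/=; exact: uM.
  - by apply: is_cvg_geometric_series; rewrite ger0_norm.
pose l := u 0%N + limn (series (telescope u)).
have ul : u @ \oo --> l.
  rewrite (_ : u = cst (u 0%N) + series (telescope u)).
    by apply: cvgD; [exact: cvg_cst|exact: cu].
  by apply/funext => n; rewrite {1}eq_sum_telescope.
exists l => // k.
have th1' : 0 < 1 - th by rewrite subr_gt0.
have step n : `|u k - u (n + k)%N| <= M * th ^+ k / (1 - th).
  have S : `|u k - u (n + k)%N| <= M * th ^+ k * (1 - th ^+ n) / (1 - th).
    elim: n => [|n IH]; first by rewrite add0n subrr normr0 expr0 subrr mulr0 mul0r.
    have -> : u k - u (n.+1 + k)%N = (u k - u (n + k)%N) - (u (n + k).+1 - u (n + k)%N).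
      by rewrite opprB addrA subrK.
    apply: le_trans (ler_normB _ _) _; apply: le_trans (lerD IH (uM _)) _.
    rewrite exprD exprS le_eqVlt; apply/orP; left; apply/eqP.
    by field; rewrite gt_eqF.
  apply: (le_trans S); rewrite ler_wpM2r ?invr_ge0 ?(ltW th1')//.
  by rewrite ler_piMr ?mulr_ge0 ?exprn_ge0// gerBl exprn_ge0.
have ul' : (fun n => `|u k - u (n + k)%N|) @ \oo --> `|u k - l|.
  apply: cvg_norm; apply: cvgB; first exact: cvg_cst.
  by have := ul; rewrite -(cvg_shiftn k).
apply: (ler_cvg_to ul' (cvg_cst _)); exact: nearW.
Qed.

Lemma geometric_bound_cvg0 (a : nat -> R) (M th : R) : 0 <= th < 1 ->
  (forall k, 0 <= a k <= M * th ^+ k) -> a @ \oo --> (0 : R).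
Proof.
move=> /andP[th0 th1] aM.
have H : (fun k => M * th ^+ k) @ \oo --> (0 : R).
  rewrite -[X in _ --> X](mulr0 M); apply: cvgMl_tmp; apply: cvg_expr.
  by rewrite ger0_norm.
by apply: (squeeze_cvgr _ (cvg_cst 0) H); apply: nearW => k; exact: aM.
Qed.

End GeometricCauchy.

Section FLpTriangular.
Local Open Scope classical_set_scope.
Context {R : realType} {m : nat}.
Variables (A : {set 3.-tuple (letter 'I_m)}) (p kap d0 L : R).
Hypothesis p1 : 1 <= p.
Hypothesis d00 : 0 < d0.
Hypothesis degA : forall s, d0 <= link_deg (@letter_inv 'I_m) A s.
Hypothesis L0 : 0 < L.
Hypothesis kapL : L `^ p * L `^ p < kap.
Hypothesis real_poincare : mean_zero_poincare (link_adj (@letter_inv 'I_m) A) p kap.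

Lemma triangular_FLp (p1e : (1 <= p%:E)%E) : FLp p1e L (triangular_group A).
Proof.
move=> V geo pi b actP isom _.
have kap0 : 0 <= kap by apply: ltW; apply: le_lt_trans kapL; rewrite mulr_ge0 ?powR_ge0.
apply: (@triangular_fixed_point _ _ A p (kap / (L `^ p * L `^ p)) d0 V
  (fun v => `|v|)) => //.
- by rewrite ltr_pdivlMr ?mul1r// mulr_gt0 ?powR_gt0.
- exact: ler_normD.
- exact: normrZ.
- exact: normr0_eq0.
- move=> u M th th01 uM; have [l _ ul] := geometric_cauchy th01 uM.
  exists l; apply: (@geometric_bound_cvg0 _ _ (M / (1 - th)) th) => // k.
  by rewrite normr_ge0/= mulrAC; exact: ul.
- apply: Lp_geometry_poincare => //; first by move=> s t; exact: link_adj_ge0.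
  exact: lt_le_trans p1.
Qed.

End FLpTriangular.

(** * Lipschitz actions on Lebesgue spaces *)

Section LspaceComplete.
Local Open Scope classical_set_scope.
Context {R : realType} d (X : measurableType d) (mu : {measure set X -> \bar R}).
Variables (p : R) (p1e : (1 <= p%:E)%E).
Local Notation Lp := (LspaceType mu p1e).
Local Notation Lf := (LfunType mu p1e).

Let p1 : 1 <= p. Proof. by rewrite -lee_fin. Qed.
Let p0 : 0 < p. Proof. exact: lt_le_trans p1. Qed.

Lemma Lfun_of_powR_integral (f : X -> R) (B : R) : measurable_fun setT f ->
  (\int[mu]_x (`|f x| `^ p)%:E <= B%:E)%E -> f \in Lfun mu p%:E.
Proof.
move=> mf fB; apply/andP; split; rewrite inE//= /finite_norm.
rewrite unlock.
apply: poweR_lty; exact: le_lt_trans fB (ltry _).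
Qed.

(** Completeness of the Lebesgue space along geometrically Cauchy sequences.
    Weighting the increments by the square root of the ratio makes the sum of
    their [p]-th powers integrable; its finiteness at a point bounds all
    increments there geometrically, so representatives converge pointwise with
    an explicit rate that integrates to the norm estimate. *)
Lemma Lspace_geometric_cauchy (u : nat -> Lp) (M th : R) : 0 <= th < 1 ->
  (forall k, `|u k.+1 - u k| <= M * th ^+ k) ->
  exists l, (fun k => `|u k - l|) @ \oo --> (0 : R).
Proof.
move=> /andP[th0 th1] uM'.
have M0 : 0 <= M by have := uM' 0%N; rewrite expr0 mulr1; exact: le_trans.
pose r := Num.max th 2^-1.
have r0 : 0 < r by rewrite lt_max invr_gt0 ltr0n orbT.
have r1 : r < 1 by rewrite gt_max th1/=; lra.
have uM k : `|u k.+1 - u k| <= M * r ^+ k.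
  apply: (le_trans (uM' k)); rewrite ler_wpM2l// lerXn2r ?nnegrE ?(ltW r0)//.
  by rewrite le_max lexx.
pose sg := Num.sqrt r.
have sg0 : 0 < sg by rewrite sqrtr_gt0.
have sg2 : sg * sg = r by rewrite -expr2 sqr_sqrtr// ltW.
have sg1 : sg < 1 by rewrite -sqrtr1 ltr_sqrt.
pose q := sg `^ p.
have q0 : 0 <= q by exact: powR_ge0.
have q1 : q < 1.
  have := @gt0_ltr_powR R p p0 sg 1; rewrite powR1 !nnegrE; apply => //.
  exact: ltW.
pose f k : Lf := Lfun_of (u k).
have fE k : u k = Lclass (f k) by rewrite /f Lfun_ofK.
have mf k : measurable_fun setT (f k : X -> R) by exact: measurable_funPT.
pose w k := (sg^-1 ^+ k) `^ p.
have w0 k : 0 <= w k by exact: powR_ge0.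
pose e k x := w k * `|f k.+1 x - f k x| `^ p.
have e0 k x : 0 <= e k x by rewrite mulr_ge0 ?powR_ge0.
have me k : measurable_fun setT (fun x => (e k x)%:E).
  under eq_fun do rewrite EFinM.
  apply: measurable_funeM; apply: measurable_normpowR.
  exact: measurable_funB.
have int_e k : (\int[mu]_x (e k x)%:E <= (M `^ p * q ^+ k)%:E)%E.
  under eq_integral do rewrite EFinM.
  rewrite ge0_integralZl_EFin//; last first.
    by apply: measurable_normpowR; exact: measurable_funB.
  have := Lnorm_powR p1 (f k.+1 - f k); rewrite -Lclass_sub -!fE => <-.
  rewrite -EFinM lee_fin /w -powRM ?exprn_ge0 ?invr_ge0 ?(ltW sg0)//.
  rewrite /q -(powR_expn p k (ltW sg0)) -powRM ?exprn_ge0 ?(ltW sg0)//.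
  apply: ge0_ler_powR; rewrite ?nnegrE ?mulr_ge0 ?exprn_ge0 ?invr_ge0 ?(ltW sg0) ?(ltW p0)//.
  rewrite exprVn mulrC ler_pdivrMr ?exprn_gt0// -mulrA -exprMn sg2; exact: uM.
pose S x := (\sum_(0 <= k <oo) (e k x)%:E)%E.
have S0 x : (0 <= S x)%E by apply: nneseries_ge0 => k _ _; rewrite lee_fin.
have mS : measurable_fun setT S.
  apply: (ge0_emeasurable_sum (P := xpredT)) => // k x _ _.
  by rewrite lee_fin.
pose B := M `^ p / (1 - q).
have B0 : 0 <= B by rewrite divr_ge0 ?powR_ge0// subr_ge0 ltW.
have intS : (\int[mu]_x S x <= B%:E)%E.
  rewrite integral_nneseries//; last by move=> k x _; rewrite lee_fin.
  apply: lime_le.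
    apply: is_cvg_nneseries => k _ _; apply: integral_ge0 => x _.
    by rewrite lee_fin.
  apply: nearW => n; apply: (@le_trans _ _ (\sum_(0 <= k < n) (M `^ p * q ^+ k)%:E)%E).
    by apply: lee_sum => k _; exact: int_e.
  rewrite sumEFin lee_fin.
  have -> : \sum_(0 <= k < n) (M `^ p * q ^+ k) = series (geometric (M `^ p) q) n by [].
  rewrite geometric_seriesE ?lt_eqF//= /B ler_wpM2r ?invr_ge0 ?subr_ge0 ?(ltW q1)//.
  by rewrite ler_piMr ?powR_ge0// gerBl exprn_ge0.
pose D := [set x | S x \is a fin_num].
have mD : measurable D.
  by have := emeasurable_fin_num measurableT mS; rewrite setTI.
have aeD : {ae mu, forall x, D x}.
  have iS : mu.-integrable setT S.
    apply/integrableP; split => //.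
    under eq_integral do rewrite gee0_abs//.
    exact: le_lt_trans intS (ltry _).
  by have := integrable_ae measurableT iS; apply: filterS => x; exact.
pose s x := fine (S x) `^ p^-1.
have fs k x : D x -> `|f k.+1 x - f k x| <= s x * sg ^+ k.
  move=> Dx; have ek : e k x <= fine (S x).
    rewrite -lee_fin fineK//.
    have := @nneseries_lim_ge R (fun k => (e k x)%:E) xpredT 0%N k.+1.
    move=> /(_ _) H; apply: le_trans (H _); last by move=> n _ _; rewrite lee_fin.
    rewrite big_nat_recr//= leeDr// sume_ge0// => i _; by rewrite lee_fin.
  rewrite -ler_pdivrMr ?exprn_gt0// -exprVn mulrC.
  have a0 : 0 <= sg^-1 ^+ k * `|f k.+1 x - f k x|.
    by rewrite mulr_ge0 ?exprn_ge0 ?invr_ge0 ?(ltW sg0).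
  rewrite -[leLHS]powRr1// -[X in _ `^ X](@mulfV _ p) ?gt_eqF// powRrM.
  apply: ge0_ler_powR; rewrite ?nnegrE ?powR_ge0 ?fine_ge0 ?invr_ge0 ?(ltW p0)//.
  by rewrite powRM// exprn_ge0// invr_ge0 ltW.
have sg01 : 0 <= sg < 1 by rewrite ltW.
pose h k x := f k x * \1_D x.
have hcvg x : cvgn (h^~ x).
  have [Dx|Dx] := pselect (D x).
    rewrite (_ : h^~ x = (fun k => f k x)).
      have [l fl _] := @geometric_cauchy R R (fun k => f k x) (s x) sg sg01 (fun k => fs k x Dx).
      by apply/cvg_ex; exists l.
    by apply/funext => k; rewrite /h indicE mem_set// mulr1.
  rewrite (_ : h^~ x = cst 0); first exact: is_cvg_cst.
  by apply/funext => k; rewrite /h indicE memNset// mulr0.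
pose g x := limn (h^~ x).
have mg : measurable_fun setT g.
  apply: (@measurable_fun_cvg _ _ _ setT h g) => [k|x _]; last exact: hcvg.
  by apply: measurable_funM => //; exact: measurable_indic.
have fg k x : D x -> `|f k x - g x| <= s x * sg ^+ k / (1 - sg).
  move=> Dx.
  have [l fl fb] := @geometric_cauchy R R (fun k => f k x) (s x) sg sg01 (fun k => fs k x Dx).
  suff -> : g x = l by exact: fb.
  rewrite /g (_ : h^~ x = (fun k => f k x)); first exact/cvg_lim.
  by apply/funext => j; rewrite /h indicE mem_set// mulr1.
pose c k := (sg ^+ k / (1 - sg)) `^ p.
have mfg k : measurable_fun setT (fun x => f k x - g x) by exact: measurable_funB.
have int_fg k : (\int[mu]_x (`|f k x - g x| `^ p)%:E <= (c k * B)%:E)%E.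
  apply: (@le_trans _ _ (\int[mu]_x ((c k)%:E * S x))%E); last first.
    rewrite ge0_integralZl_EFin ?powR_ge0// EFinM lee_wpmul2l// lee_fin powR_ge0 //.
  apply: ae_ge0_le_integral => //.
  - exact: measurable_normpowR.
  - by move=> x _; rewrite mule_ge0// lee_fin powR_ge0.
  - exact: measurable_funeM.
  apply: filterS aeD => x Dx _.
  rewrite -(fineK Dx) -EFinM lee_fin.
  have -> : fine (S x) = s x `^ p.
    by rewrite /s -powRrM mulVf ?gt_eqF// powRr1// fine_ge0.
  rewrite /c -powRM ?powR_ge0 ?divr_ge0 ?exprn_ge0 ?subr_ge0 ?(ltW sg0) ?(ltW sg1)//.
  apply: ge0_ler_powR; rewrite ?nnegrE ?(ltW p0)//.
    by rewrite mulr_ge0 ?powR_ge0// divr_ge0 ?exprn_ge0 ?subr_ge0 ?(ltW sg0) ?(ltW sg1).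
  by rewrite mulrC mulrA; exact: fg.
pose phi : Lf := Lfun_Sub p1e (Lfun_of_powR_integral (mfg 0%N) (int_fg 0%N)).
exists (Lclass (f 0%N - phi)).
apply: (@geometric_bound_cvg0 _ _ (B `^ p^-1 / (1 - sg)) sg) => // k.
rewrite normr_ge0/= fE Lclass_sub.
have : `|Lclass (f k - (f 0%N - phi))| `^ p <= c k * B.
  rewrite -lee_fin (Lnorm_powR p1); apply: le_trans (int_fg k).
  apply: ge0_le_integral => //.
  - by apply: measurable_normpowR; exact: measurable_funPT.
  - exact: measurable_normpowR.
  move=> x _; rewrite le_eqVlt; apply/orP; left; apply/eqP; congr (_ `^ _)%:E.
  congr (`| _ |); transitivity (f k x - (f 0%N x - (f 0%N x - g x))); first by [].
  by rewrite opprB addrAC subrr sub0r.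
have cB : c k * B = (B `^ p^-1 / (1 - sg) * sg ^+ k) `^ p.
  have -> : B `^ p^-1 / (1 - sg) * sg ^+ k = (sg ^+ k / (1 - sg)) * B `^ p^-1.
    by rewrite mulrC mulrA mulrAC.
  rewrite powRM ?powR_ge0 ?divr_ge0 ?exprn_ge0 ?subr_ge0 ?(ltW sg0) ?(ltW sg1)//.
  by rewrite -powRrM mulVf ?gt_eqF// powRr1.
rewrite cB => H.
have pV0 : 0 <= p^-1 by rewrite invr_ge0 ltW.
have K0 : 0 <= B `^ p^-1 / (1 - sg) * sg ^+ k.
  by rewrite mulr_ge0 ?exprn_ge0 ?divr_ge0 ?powR_ge0 ?subr_ge0 ?(ltW sg0) ?(ltW sg1).
set x := `|_|; set y := _ * sg ^+ k in K0 H *.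
have x0 : 0 <= x by exact: normr_ge0.
have : (x `^ p) `^ p^-1 <= (y `^ p) `^ p^-1.
  by apply: ge0_ler_powR; rewrite ?nnegrE ?powR_ge0.
by rewrite -!powRrM mulfV ?gt_eqF// !powRr1.
Qed.

End LspaceComplete.

Section LipschitzAction.
Local Open Scope classical_set_scope.
Context {R : realType} {G : groupType} {V : normedModType R}.
Variables (pi : G -> {linear V -> V}) (b : G -> V) (L : R).
Hypothesis act : affine_action pi b.
Hypothesis piL : forall g v, `|pi g v| <= L * `|v|.

(** The equivalent norm for which a uniformly Lipschitz action is isometric. *)
Definition orbit_norm (v : V) : R := sup (range (fun g => `|pi g v|)).

Let has_ub_orbit v : has_ubound (range (fun g => `|pi g v|)).
Proof. by exists (L * `|v|) => _ [g _ <-]. Qed.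

Lemma le_orbit_norm g v : `|pi g v| <= orbit_norm v.
Proof. by apply: ub_le_sup => //; exists g. Qed.

Lemma norm_le_orbit_norm v : `|v| <= orbit_norm v.
Proof. by rewrite -{1}(linear_part1 act v); exact: le_orbit_norm. Qed.

Lemma orbit_norm_le v x : (forall g, `|pi g v| <= x) -> orbit_norm v <= x.
Proof.
move=> vx; apply: ge_sup; first by exists `|pi 1%g v|; exists 1%g.
by move=> _ [g _ <-].
Qed.

Lemma orbit_norm_lip v : orbit_norm v <= L * `|v|.
Proof. by apply: orbit_norm_le => g; exact: piL. Qed.

Lemma orbit_normD u v : orbit_norm (u + v) <= orbit_norm u + orbit_norm v.
Proof.
apply: orbit_norm_le => g; rewrite linearD.
by apply: le_trans (ler_normD _ _) (lerD _ _); exact: le_orbit_norm.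
Qed.

Lemma orbit_normZ a v : orbit_norm (a *: v) = `|a| * orbit_norm v.
Proof.
have H c u : orbit_norm (c *: u) <= `|c| * orbit_norm u.
  apply: orbit_norm_le => g; rewrite linearZ/= normrZ ler_wpM2l//.
  exact: le_orbit_norm.
apply/le_anti; rewrite H/=; have [->|a0] := eqVneq a 0.
  by rewrite normr0 mul0r; apply: le_trans (norm_le_orbit_norm _).
have := H a^-1 (a *: v); rewrite scalerA mulVf// scale1r normfV.
by rewrite ler_pdivlMl// normr_gt0.
Qed.

Lemma orbit_norm_isom g v : orbit_norm (pi g v) = orbit_norm v.
Proof.
have H h u : orbit_norm (pi h u) <= orbit_norm u.
  apply: orbit_norm_le => k; rewrite -(linear_partM act); exact: le_orbit_norm.
apply/le_anti; rewrite H/= -[in leLHS](linear_part1 act v) -(mulVg g).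
by rewrite (linear_partM act).
Qed.

End LipschitzAction.

Section LipschitzTriangular.
Local Open Scope classical_set_scope.
Context {R : realType} {m : nat}.
Variables (A : {set 3.-tuple (letter 'I_m)}) (p kap d0 L : R).
Hypothesis p1 : 1 <= p.
Hypothesis d00 : 0 < d0.
Hypothesis degA : forall s, d0 <= link_deg (@letter_inv 'I_m) A s.
Hypothesis L1 : 1 <= L.
Hypothesis kapL : L `^ p * L `^ p < kap.
Hypothesis real_poincare : mean_zero_poincare (link_adj (@letter_inv 'I_m) A) p kap.

Lemma triangular_Lp_lipschitz (p1e : (1 <= p%:E)%E) :
  Lp_lipschitz_fixed_points p1e L (triangular_group A).
Proof.
move=> d X mu pi b actP piL.
have L0 : 0 < L by exact: lt_le_trans L1.
have p0 : 0 < p by exact: lt_le_trans p1.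
have kap0 : 0 <= kap by apply: ltW; apply: le_lt_trans kapL; rewrite mulr_ge0 ?powR_ge0.
pose N := orbit_norm pi.
have NL v : N v <= L * `|v| := orbit_norm_lip piL v.
have leN v : `|v| <= N v := norm_le_orbit_norm actP piL v.
apply: (@triangular_fixed_point _ _ A p (kap / (L `^ p * L `^ p)) d0 _ N) => //.
- by rewrite ltr_pdivlMr ?mul1r// mulr_gt0 ?powR_gt0.
- exact: (orbit_normD piL).
- exact: (orbit_normZ actP piL).
- by move=> u u0; apply: normr0_eq0; apply/le_anti; rewrite normr_ge0 -u0 leN.
- move=> u M th th01 uM.
  have [l ul] := Lspace_geometric_cauchy th01 (fun k => le_trans (leN _) (uM k)).
  exists l.
  have H : (fun k => L * `|u k - l|) @ \oo --> (0 : R).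
    by rewrite -[X in _ --> X](mulr0 L); exact: cvgMl_tmp.
  apply: (squeeze_cvgr _ (cvg_cst 0) H); apply: nearW => k.
  by rewrite NL andbT; exact: le_trans (leN _).
- apply: (bilipschitz_poincare _ kap0 p0 L0 (dW := @norm_dist _ _) (F := setT)).
  + by move=> s t; exact: link_adj_ge0.
  + by move=> u v; exact: le_trans (leN _).
  + by move=> u v; exact: normr_ge0.
  + exists id; first by split=> // v _; exists v.
    move=> u v _ _; rewrite ler_pdivrMl// NL/= /norm_dist.
    by apply: (le_trans (leN _)); rewrite ler_peMl// (le_trans _ (leN _)).
  + by apply: Lspace_poincare => // s t; exact: link_adj_ge0.
- exact: (orbit_norm_isom actP piL).
Qed.

End LipschitzTriangular.

(** * Chernoff bounds for random subsets *)

Section BernoulliSubset.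
Context {R : realType} {U : finType}.
Variables (W : {set U}) (rho : R).
Hypothesis rho01 : 0 <= rho <= 1.
Implicit Types (A : {set U}) (Q : pred {set U}) (c : U -> R).

Let rho0 : 0 <= rho. Proof. by case/andP: rho01. Qed.
Let rho1 : 0 <= 1 - rho. Proof. by rewrite subr_ge0; case/andP: rho01. Qed.

Definition bernoulli_weight A : R := rho ^+ #|A| * (1 - rho) ^+ (#|W| - #|A|).

Definition bernoulli_prob Q : R :=
  \sum_(A : {set U} | (A \subset W) && Q A) bernoulli_weight A.

Lemma bernoulli_weight_ge0 A : 0 <= bernoulli_weight A.
Proof. by rewrite mulr_ge0 ?exprn_ge0. Qed.

Lemma bernoulli_mgf (x : U -> R) :
  \sum_(A : {set U} | A \subset W) bernoulli_weight A * \prod_(w in A) x w =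
  \prod_(w in W) (1 - rho + rho * x w).
Proof.
rewrite [RHS]big_mkcond/=.
rewrite (eq_bigr (fun w => (if w \in W then rho * x w else 0) +
   (if w \in W then 1 - rho else 1))); last first.
  by move=> w _; case: ifP; rewrite ?add0r// addrC.
rewrite bigA_distr big_mkcond; apply: eq_bigr => A _.
case: ifPn => [AW|/subsetPn[w wA wW]]; last first.
  by rewrite (bigD1 w)//= wA (negPf wW) mul0r.
rewrite /bernoulli_weight [RHS](bigID (mem A))/= mulrAC; congr (_ * _).
  transitivity (\prod_(w in A) (rho * x w)).
    by rewrite big_split/= prodr_const.
  by apply: eq_bigr => w wA; rewrite wA (fintype.subsetP AW).
rewrite -cardsDS// -prodr_const [LHS]big_mkcond [RHS]big_mkcond/=.
apply: eq_bigr => w _; rewrite !inE.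
by case: (w \in A) => //=; case: (w \in W).
Qed.

Lemma bernoulli_prob_predT : bernoulli_prob predT = 1.
Proof.
have := bernoulli_mgf (fun=> 1).
rewrite [RHS]big1; last by move=> w _; rewrite mulr1 subrK.
move=> <-; apply: eq_big => [A|A _]; first by rewrite andbT.
by rewrite big1 ?mulr1.
Qed.

Lemma le_bernoulli_prob Q1 Q2 : (forall A, A \subset W -> Q1 A -> Q2 A) ->
  bernoulli_prob Q1 <= bernoulli_prob Q2.
Proof.
move=> Q12; rewrite /bernoulli_prob [leLHS]big_mkcond [leRHS]big_mkcond/=.
apply: ler_sum => A _; case: ifPn => [/andP[AW QA]|_].
  by rewrite AW Q12.
by case: ifP => // _; exact: bernoulli_weight_ge0.
Qed.

Lemma bernoulli_probC Q : bernoulli_prob Q = 1 - bernoulli_prob (predC Q).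
Proof.
rewrite -bernoulli_prob_predT {2}/bernoulli_prob (bigID Q)/=.
rewrite (eq_bigl (fun A => (A \subset W) && Q A)); last by move=> A; rewrite andbT.
rewrite [X in _ = _ + X - _](eq_bigl (fun A => (A \subset W) && predC Q A)) ?addrK//.
by move=> A; rewrite andbT.
Qed.

Lemma bernoulli_prob_union (I : finType) (P : pred I) (Q : I -> pred {set U}) :
  bernoulli_prob (fun A => [exists (i | P i), Q i A]) <=
  \sum_(i | P i) bernoulli_prob (Q i).
Proof.
rewrite /bernoulli_prob (exchange_big_dep (fun A => A \subset W))/=; last first.
  by move=> i A _ /andP[].
rewrite [leLHS]big_mkcondr; apply: ler_sum => A AW.
case: ifPn => [/existsP[i /andP[Pi Qi]]|_]; last first.
  by apply: sumr_ge0 => i _; exact: bernoulli_weight_ge0.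
rewrite (bigD1 i) ?Pi ?AW//= lerDl.
by apply: sumr_ge0 => j _; exact: bernoulli_weight_ge0.
Qed.

Lemma bernoulli_probU Q1 Q2 : bernoulli_prob (fun A => Q1 A || Q2 A) <=
  bernoulli_prob Q1 + bernoulli_prob Q2.
Proof.
have := bernoulli_prob_union xpredT (fun b : bool => if b then Q1 else Q2).
rewrite big_bool; apply: le_trans; apply: le_bernoulli_prob => A _ /orP[QA|QA].
  by apply/existsP; exists true.
by apply/existsP; exists false.
Qed.

Variables (c : U -> R) (K : R).
Hypothesis cK : forall w, 0 <= c w <= K.

Let mu := rho * \sum_(w in W) c w.

Let chernoff_mgf (s kap y : R) (Q : pred {set U}) :
  (forall w, w \in W -> expR (s * c w) <= 1 + kap * c w) ->
  (forall A, A \subset W -> Q A -> s * y <= s * \sum_(w in A) c w) ->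
  bernoulli_prob Q <= expR (- (s * y) + kap * mu).
Proof.
move=> sk Qy.
have H : bernoulli_prob Q <= \sum_(A : {set U} | A \subset W)
    bernoulli_weight A * expR (s * (\sum_(w in A) c w) - s * y).
  rewrite /bernoulli_prob [leLHS]big_mkcondr; apply: ler_sum => A AW.
  case: ifPn => [QA|_]; last by rewrite mulr_ge0 ?expR_ge0// bernoulli_weight_ge0.
  rewrite ler_peMr ?bernoulli_weight_ge0// -expR0 ler_expR subr_ge0.
  exact: Qy.
apply: (le_trans H).
have -> : \sum_(A : {set U} | A \subset W)
    bernoulli_weight A * expR (s * (\sum_(w in A) c w) - s * y) =
    expR (- (s * y)) * \prod_(w in W) (1 - rho + rho * expR (s * c w)).
  rewrite -bernoulli_mgf mulr_sumr; apply: eq_bigr => A _.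
  by rewrite expRD mulrC mulr_sumr expR_sum -mulrA mulrC -!mulrA; congr (_ * _); rewrite mulrC.
rewrite expRD ler_wpM2l ?expR_ge0// /mu mulrCA mulr_sumr mulr_sumr expR_sum.
apply: ler_prod => w wW; apply/andP; split.
  by rewrite addr_ge0// mulr_ge0// expR_ge0.
apply: le_trans (expR_ge1Dx _).
have := ler_wpM2l rho0 (sk w wW); lra.
Qed.

(** Exponential moments of a sum of independent weights in [[0, K]], with the
    exponential replaced by its second order expansion: the quadratic term is
    bounded by a multiple of the mean [mu]. *)
Lemma chernoff_upper (s y : R) : 0 <= s ->
  bernoulli_prob (fun A => y <= \sum_(w in A) c w) <=
  expR (- (s * y) + (s + K * s ^+ 2 * expR (K * s)) * mu).
Proof.
move=> s0; apply: chernoff_mgf => [w wW|A AW yA]; last by rewrite ler_wpM2l.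
have /andP[c0 cK'] := cK w.
have sc0 : 0 <= s * c w by rewrite mulr_ge0.
apply: (le_trans (expR_le_quad sc0)).
have h : expR (s * c w) <= expR (K * s) by rewrite ler_expR mulrC ler_wpM2r.
have h2 : (s * c w) ^+ 2 <= K * s ^+ 2 * c w.
  have -> : K * s ^+ 2 * c w = s ^+ 2 * (K * c w) by ring.
  by rewrite exprMn ler_wpM2l ?sqr_ge0// [c w ^+ 2]expr2 ler_wpM2r.
have := ler_pM (sqr_ge0 (s * c w)) (expR_ge0 _) h2 h.
lra.
Qed.

Lemma chernoff_lower (s y : R) : 0 <= s ->
  bernoulli_prob (fun A => \sum_(w in A) c w <= y) <=
  expR (s * y + (- s + K * s ^+ 2) * mu).
Proof.
move=> s0; have := @chernoff_mgf (- s) (- s + K * s ^+ 2) y (fun A => \sum_(w in A) c w <= y).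
rewrite mulNr opprK; apply => [w wW|A AW yA]; last by rewrite !mulNr lerN2 ler_wpM2l.
have /andP[c0 cK'] := cK w.
have sc0 : 0 <= s * c w by rewrite mulr_ge0.
rewrite mulNr; apply: (le_trans (expRN_le_quad sc0)).
have h2 : (s * c w) ^+ 2 <= K * s ^+ 2 * c w.
  have -> : K * s ^+ 2 * c w = s ^+ 2 * (K * c w) by ring.
  by rewrite exprMn ler_wpM2l ?sqr_ge0// [c w ^+ 2]expr2 ler_wpM2r.
lra.
Qed.

End BernoulliSubset.

Section SubsetCount.
Context {R : realType} {T : finType}.

(** Up to a factor [b], the logarithmic size of the family of sets with at most
    [b] out of [n] elements. *)
Definition entropy (n b : nat) : R := 1 + ln (n%:R / b%:R).

Lemma sum_expr_card (x : R) : \sum_(S : {set T}) x ^+ #|S| = (1 + x) ^+ #|T|.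
Proof.
have -> : (1 + x) ^+ #|T| = \prod_(i : T) (x + 1) by rewrite prodr_const addrC.
rewrite bigA_distr; apply: eq_bigr => S _.
rewrite (bigID (mem S))/= [X in _ * X]big1 ?mulr1; last first.
  by move=> i /negPf ->.
by rewrite -prodr_const; apply: eq_bigr => i ->.
Qed.

Lemma card_small_sets (b : nat) : (0 < b <= #|T|)%N ->
  #|[set S : {set T} | (#|S| <= b)%N]|%:R <= expR (b%:R * entropy #|T| b).
Proof.
move=> /andP[b0 bn]; have n0 : (0 < #|T|)%N by exact: leq_trans bn.
pose x : R := b%:R / #|T|%:R.
have x0 : 0 < x by rewrite divr_gt0 ?ltr0n.
have x1 : x <= 1 by rewrite ler_pdivrMr ?ltr0n// mul1r ler_nat.
have H : #|[set S : {set T} | (#|S| <= b)%N]|%:R * x ^+ b <= expR b%:R.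
  apply: (@le_trans _ _ (\sum_(S : {set T}) x ^+ #|S|)).
    rewrite mulr_natl -sumr_const [leRHS](bigID (mem [set S : {set T} | (#|S| <= b)%N]))/=.
    rewrite ler_wpDr ?sumr_ge0//; first by move=> S _; rewrite exprn_ge0// ltW.
    by apply: ler_sum => S; rewrite inE => Sb; rewrite ler_wiXn2l// ltW.
  rewrite sum_expr_card.
  have -> : expR b%:R = expR x ^+ #|T| :> R.
    by rewrite -expRM_natr /x divfK// pnatr_eq0 -lt0n.
  by rewrite lerXn2r ?nnegrE ?expR_ge0 ?addr_ge0 ?(ltW x0)// expR_ge1Dx.
have -> : expR (b%:R * entropy #|T| b) = expR b%:R / x ^+ b :> R.
  rewrite /entropy mulrDr mulr1 expRD; congr (_ * _).
  have -> : #|T|%:R / b%:R = x^-1 :> R by rewrite invf_div.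
  by rewrite lnV ?posrE// mulrN expRN -ln_powR powR_mulrn ?(ltW x0)// lnK// posrE exprn_gt0.
by rewrite ler_pdivlMr// exprn_gt0.
Qed.

Lemma entropy_ge (n b : nat) : (0 < b <= n)%N ->
  entropy n 1 <= b%:R * entropy n b.
Proof.
move=> /andP[b0 bn]; have n0 : (0 < n)%N by exact: leq_trans bn.
have b0' : 0 < b%:R :> R by rewrite ltr0n.
have n0' : 0 < n%:R :> R by rewrite ltr0n.
have b1 : 1 <= b%:R :> R by rewrite ler1n.
rewrite /entropy divr1 lnM ?posrE ?invr_gt0// lnV ?posrE//.
have h1 : ln b%:R <= ln n%:R :> R by rewrite ler_ln ?posrE// ler_nat.
have h2 : ln b%:R <= b%:R - 1 :> R.
  have := @le_ln1Dx R (b%:R - 1); rewrite (_ : 1 + (b%:R - 1) = b%:R); last by lra.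
  by apply; lra.
nra.
Qed.

End SubsetCount.

(** * Counting reduced triangles *)

Section ReducedTriangles.
Context {R : realType} {T : finType}.
Variable inv : T -> T.
Hypothesis invK : involutive inv.

Definition reduced_triangles : {set 3.-tuple T} :=
  [set w : 3.-tuple T | cycle (fun x y => y != inv x) w]%SET.
Local Notation W := reduced_triangles.
Local Notation n := #|T|.

Let reduced x y z := [&& y != inv x, z != inv y & x != inv z].

Lemma sum_triangles (F : seq T -> nat) :
  (\sum_(w in W) F w = \sum_x \sum_y \sum_z reduced x y z * F [:: x; y; z])%N.
Proof.
pose tr (u : T * T * T) : 3.-tuple T := [tuple u.1.1; u.1.2; u.2].
pose rt (w : 3.-tuple T) := (tnth w ord0, tnth w (inord 1), tnth w (inord 2)).
have trK : cancel tr rt.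
  by move=> [[x y] z]; rewrite /rt /tr !(tnth_nth x)/= !inordK.
have rtK : cancel rt tr.
  move=> w; apply/val_inj; have [x [y [z wE]]] := tuple3E w.
  by rewrite /rt /tr/= !(tnth_nth x)/= !inordK// wE.
rewrite (reindex tr); last by exists rt => ? _.
rewrite pair_big/= pair_big/= big_mkcond/=; apply: eq_bigr => -[[x y] z] _ /=.
rewrite inE /= /reduced andbT.
by case: ifP; rewrite ?mul1n.
Qed.

Lemma sum_pick (a : T) (F : T -> nat) : (\sum_x (x == a) * F x = F a)%N.
Proof.
rewrite (bigD1 a)//= eqxx mul1n big1 ?addn0// => x xa.
by rewrite (negPf xa).
Qed.

(** Number of reduced triangles putting the edge from [s] to [t] at a given
    position of the link. *)
Definition third_letters (s t : T) : nat :=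
  #|[set y | [&& s != t, y != inv s & y != t]]%SET|.

Lemma third_letters_le s t : (third_letters s t <= n)%N.
Proof. exact: max_card. Qed.

Lemma third_letters_ge s t : s != t -> (n - 2 <= third_letters s t)%N.
Proof.
move=> st; rewrite leq_subLR.
rewrite -(cardC (mem [set inv s; t]%SET)) leq_add//.
  by rewrite cards2; case: (_ == _).
rewrite /third_letters subset_leq_card//; apply/fintype.subsetP => y.
by rewrite !inE negb_or st.
Qed.

(** Up to cyclic permutation, the three positions of an edge in the link of a
    triangle are equivalent, and each occurs in both orientations. *)
Lemma link_adj_triangles s t :
  link_adj inv W s t = (3 * (third_letters s t + third_letters t s))%:R :> R.
Proof.
rewrite /link_adj -natr_sum; congr _%:R.
rewrite (sum_triangles (fun w => count_mem (s, t) (links inv w)))/=.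
have cardE (P : pred T) : (\sum_y P y = #|[set y | P y]%SET|)%N.
  rewrite -sum1_card [RHS]big_mkcond; apply: eq_bigr => y _.
  by rewrite inE; case: (P y).
have invE (x y : T) : (inv x == y) = (x == inv y).
  by apply/eqP/eqP => [<-|->]; rewrite invK.
have h13 (a b : T) : (\sum_x \sum_y \sum_z reduced x y z * ((x == a) && (z == b)) =
    \sum_y reduced a y b)%N.
  under eq_bigr => x _ do under eq_bigr => y _ do under eq_bigr => z _ do
    rewrite -mulnb mulnCA (mulnC _ (z == b)).
  under eq_bigr => x _ do under eq_bigr => y _ do
    rewrite -big_distrr/= (sum_pick b (fun z => reduced x y z)).
  under eq_bigr do rewrite -big_distrr/=.
  exact: (sum_pick a (fun x => \sum_y reduced x y b)%N).
have h12 (a b : T) : (\sum_x \sum_y \sum_z reduced x y z * ((x == a) && (y == b)) =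
    \sum_z reduced a b z)%N.
  under eq_bigr => x _ do rewrite exchange_big/=.
  under eq_bigr => x _ do under eq_bigr => z _ do under eq_bigr => y _ do
    rewrite -mulnb mulnCA (mulnC _ (y == b)).
  under eq_bigr => x _ do under eq_bigr => z _ do
    rewrite -big_distrr/= (sum_pick b (fun y => reduced x y z)).
  under eq_bigr do rewrite -big_distrr/=.
  exact: (sum_pick a (fun x => \sum_z reduced x b z)%N).
have h23 (a b : T) : (\sum_x \sum_y \sum_z reduced x y z * ((y == a) && (z == b)) =
    \sum_x reduced x a b)%N.
  apply: eq_bigr => x _.
  under eq_bigr => y _ do under eq_bigr => z _ do
    rewrite -mulnb mulnCA (mulnC _ (z == b)).
  under eq_bigr => y _ do rewrite -big_distrr/= (sum_pick b (fun z => reduced x y z)).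
  exact: (sum_pick a (fun y => reduced x y b)).
have -> : (\sum_x \sum_y \sum_z reduced x y z *
     (((x, inv z) == (s, t)) + (((inv z, x) == (s, t)) + (((y, inv x) == (s, t)) +
     (((inv x, y) == (s, t)) + (((z, inv y) == (s, t)) + (((inv y, z) == (s, t)) + 0)))))) =
   \sum_y reduced s y (inv t) + \sum_y reduced t y (inv s) +
   \sum_z reduced (inv t) s z + \sum_z reduced (inv s) t z +
   \sum_x reduced x (inv t) s + \sum_x reduced x (inv s) t)%N.
  rewrite -!h13 -!h12 -!h23 -!big_split/=; apply: eq_bigr => x _.
  rewrite -!big_split/=; apply: eq_bigr => y _.
  rewrite -!big_split/=; apply: eq_bigr => z _.
  rewrite !xpair_eqE !invE (andbC (z == inv s)) (andbC (y == s)) (andbC (z == s)).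
  by rewrite !mulnDr muln0 addn0 !addnA.
rewrite !cardE.
have E1 : [set y | reduced s y (inv t)]%SET = [set y | [&& s != t, y != inv s & y != t]]%SET.
  apply/setP => y; rewrite !inE /reduced invK (can_eq invK) (eq_sym t y).
  by case: (s != t); case: (y != inv s); case: (y != t).
have E2 : [set y | reduced t y (inv s)]%SET = [set y | [&& t != s, y != inv t & y != s]]%SET.
  apply/setP => y; rewrite !inE /reduced invK (can_eq invK) (eq_sym s y).
  by case: (t != s); case: (y != inv t); case: (y != s).
have E3 : [set y | reduced (inv t) s y]%SET = [set y | [&& s != t, y != inv s & y != t]]%SET.
  apply/setP => y; rewrite !inE /reduced invK (can_eq invK) (eq_sym t y).
  by case: (s != t); case: (y != inv s); case: (y != t).
have E4 : [set y | reduced (inv s) t y]%SET = [set y | [&& t != s, y != inv t & y != s]]%SET.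
  apply/setP => y; rewrite !inE /reduced invK (can_eq invK) (eq_sym s y).
  by case: (t != s); case: (y != inv t); case: (y != s).
have E5 : [set y | reduced y (inv t) s]%SET = [set y | [&& s != t, y != inv s & y != t]]%SET.
  apply/setP => y; rewrite !inE /reduced invK (can_eq invK) (eq_sym t y).
  by case: (s != t); case: (y != inv s); case: (y != t).
have E6 : [set y | reduced y (inv s) t]%SET = [set y | [&& t != s, y != inv t & y != s]]%SET.
  apply/setP => y; rewrite !inE /reduced invK (can_eq invK) (eq_sym s y).
  by case: (t != s); case: (y != inv t); case: (y != s).
rewrite E1 E2 E3 E4 E5 E6 -/(third_letters s t) -/(third_letters t s); lia.
Qed.

Definition edges_between (S U : {set T}) (w : seq T) : R :=
  \sum_(e <- links inv w) ((e.1 \in S) && (e.2 \in U))%:R.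

Lemma edges_between_bounds (S U : {set T}) (w : 3.-tuple T) : 0 <= edges_between S U w <= 6.
Proof.
rewrite /edges_between; apply/andP; split; first exact: sumr_ge0.
apply: (@le_trans _ _ (\sum_(e <- links inv w) 1)).
  by apply: ler_sum => e _; case: (_ && _) => //; exact: ler01.
by have [x [y [z ->]]] := tuple3E w; rewrite /= !big_cons big_nil; lra.
Qed.

Lemma sum_edges_between A (S U : {set T}) :
  \sum_(s in S) \sum_(t in U) link_adj inv A s t = \sum_(w in A) edges_between S U w :> R.
Proof.
rewrite -(sum_link_adj inv A (fun s t => ((s \in S) && (t \in U))%:R)).
rewrite big_mkcond; apply: eq_bigr => s _; case: ifPn => sS /=.
  rewrite big_mkcond; apply: eq_bigr => t _.
  by case: ifPn => tU; rewrite ?mulr1 ?mulr0.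
by rewrite big1// => t _; rewrite mulr0.
Qed.

Lemma link_adj_triangles_le s t : link_adj inv W s t <= 6 * n%:R :> R.
Proof.
rewrite link_adj_triangles -[6 * _]natrM ler_nat.
by have := third_letters_le s t; have := third_letters_le t s; lia.
Qed.

Lemma link_adj_triangles_ge s t : s != t -> 6 * n%:R - 12 <= link_adj inv W s t :> R.
Proof.
move=> st; rewrite link_adj_triangles lerBlDr -[6 * _]natrM -natrD ler_nat.
have := third_letters_ge st; rewrite eq_sym in st; have := third_letters_ge st; lia.
Qed.

Lemma sum_edges_triangles_le (S U : {set T}) :
  \sum_(w in W) edges_between S U w <= 6 * n%:R * (#|S|%:R * #|U|%:R).
Proof.
rewrite -sum_edges_between.
apply: (@le_trans _ _ (\sum_(s in S) \sum_(t in U) 6 * n%:R)).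
  by apply: ler_sum => s _; apply: ler_sum => t _; exact: link_adj_triangles_le.
rewrite !sumr_const -mulr_natl -[X in _ * X]mulr_natl le_eqVlt; apply/orP; left.
by apply/eqP; ring.
Qed.

Lemma sum_edges_triangles_ge (S U : {set T}) :
  6 * n%:R * (#|S|%:R * #|U|%:R) - 12 * (#|S|%:R * #|U|%:R) - 6 * n%:R * #|S :&: U|%:R
  <= \sum_(w in W) edges_between S U w.
Proof.
rewrite -sum_edges_between.
apply: (@le_trans _ _ (\sum_(s in S) \sum_(t in U) (6 * n%:R - 12 - 6 * n%:R * (s == t)%:R))).
  under eq_bigr => s _ do rewrite sumrB sumr_const -mulr_sumr.
  rewrite sumrB sumr_const -mulr_sumr.
  have -> : \sum_(s in S) \sum_(t in U) (s == t)%:R = #|S :&: U|%:R :> R.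
    rewrite -sum1_card natr_sum big_mkcond [RHS]big_mkcond; apply: eq_bigr => s _.
    rewrite inE; case: (s \in S) => //=; rewrite big_mkcond/= (bigD1 s)//= eqxx.
    rewrite big1 ?addr0; first by case: ifP.
    by move=> t ts; rewrite eq_sym (negPf ts); case: ifP.
  have -> : (6 * n%:R - 12) *+ #|U| *+ #|S| = #|S|%:R * (#|U|%:R * (6 * n%:R - 12)) :> R.
    by rewrite !mulr_natl.
  by rewrite le_eqVlt; apply/orP; left; apply/eqP; ring.
apply: ler_sum => s _; apply: ler_sum => t _.
case: eqVneq => [->|st] /=; last by rewrite mulr0 subr0; exact: link_adj_triangles_ge.
rewrite mulr1 addrAC subrr add0r; apply: le_trans (link_adj_ge0 _ _ _ _); lra.
Qed.

End ReducedTriangles.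

(** * Quasirandomness of random links *)

Section Quasirandom.
Context {R : realType} {T : finType}.
Variable inv : T -> T.
Hypothesis invK : involutive inv.
Variables (rho F K B sg : R).
Local Notation W := (reduced_triangles inv).
Local Notation n := #|T|.
Local Notation N := (#|T|%:R : R).
Hypothesis rho01 : 0 <= rho <= 1.
Hypothesis n6 : (6 <= n)%N.
Hypothesis rhoF : rho * N ^+ 2 = 4 * F.
Hypothesis Fn : F <= N.
Hypothesis K1 : 1 <= K.
Hypothesis FK : 144 * K <= F.
Hypothesis sgB : 24 * K * B <= sg * F.
Hypothesis sgK : 48 * 48 * 2 * (sg * K) <= 1.
Hypothesis sg0 : 0 < sg.

Let th : R := 6 * rho * N.
Let al : R := F / K.

(** The constant weight [6 rho n] is the expected multiplicity of an edge of the
    link graph up to lower order, and the discrepancy is smaller than the degree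
    scale [F] by the expansion ratio [K]. *)
Definition quasirandom (A : {set 3.-tuple T}) : Prop :=
  discrepancy (fun s t => link_adj inv A s t - 6 * rho * N) (F / K) /\
  forall s, F <= link_deg inv A s <= 100 * F.

Let N0 : 0 < N. Proof. by rewrite ltr0n (leq_trans _ n6). Qed.
Let K0 : 0 < K. Proof. by apply: lt_le_trans K1. Qed.
Let F0 : 0 < F. Proof. by apply: lt_le_trans FK; rewrite mulr_gt0. Qed.
Let rho0 : 0 <= rho. Proof. by case/andP: rho01. Qed.
Let rhoN : rho * N <= 4.
Proof. by rewrite -(ler_pM2r N0) -mulrA -expr2 rhoF ler_pM2l. Qed.
Let al144 : 144 <= al.
Proof. by rewrite /al ler_pdivlMr. Qed.
Let thN : th * N = 24 * F.
Proof. by rewrite /th -mulrA -expr2 -mulrA rhoF; ring. Qed.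

Let expR_half_le (x : R) : 0 <= x -> x <= 2 * expR (x / 2).
Proof. by move=> x0; have := expR_ge1Dx (x / 2); lra. Qed.

Let edges S U (A : {set 3.-tuple T}) : R := \sum_(w in A) edges_between inv S U w.

Let disc_edges (S U : {set T}) A :
  \sum_(s in S) \sum_(t in U) (link_adj inv A s t - th) =
  edges S U A - th * (#|S|%:R * #|U|%:R).
Proof.
under eq_bigr do rewrite sumrB sumr_const.
rewrite sumrB sumr_const sum_edges_between -/(edges S U A); congr (_ - _).
by rewrite -mulrnA -[LHS]mulr_natr natrM (mulrC #|U|%:R).
Qed.

(** The balance condition on the sizes makes the allowed deviation comparable to
    [F |U|].  The exponent of the Chernoff bound
    is taken proportional to the entropy of [U], so that the bound beats the
    number of pairs of sets whatever the size of [U]. *)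
Lemma prob_edges_deviate (S U : {set T}) :
  (0 < #|S| <= #|U|)%N ->
  #|U|%:R <= B * Num.sqrt (#|S|%:R * #|U|%:R) ->
  bernoulli_prob W rho (fun A => al * Num.sqrt (#|S|%:R * #|U|%:R) <
    `|\sum_(s in S) \sum_(t in U) (link_adj inv A s t - th)|) <=
  2 * expR (- (6 * (#|U|%:R * entropy n #|U|))).
Proof.
move=> /andP[S0 SU] Ur.
pose a : R := #|S|%:R; pose b : R := #|U|%:R; pose r := Num.sqrt (a * b).
rewrite -/a -/b -/r in Ur *.
have U0 : (0 < #|U|)%N by exact: leq_trans SU.
have Un : (#|U| <= n)%N by exact: max_card.
have a0 : 0 < a by rewrite ltr0n.
have b0 : 0 < b by rewrite ltr0n.
have ab : a <= b by rewrite ler_nat.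
have bN : b <= N by rewrite ler_nat.
have r2 : r * r = a * b by rewrite -expr2 sqr_sqrtr// mulr_ge0// ltW.
have r0 : 0 < r by rewrite sqrtr_gt0 mulr_gt0.
have ar : a <= r.
  by rewrite -(ler_pXn2r (ltn0Sn 1)) ?nnegrE ?(ltW a0) ?(ltW r0)// !expr2 r2 ler_pM2l.
have rb : r <= b.
  by rewrite -(ler_pXn2r (ltn0Sn 1)) ?nnegrE ?(ltW b0) ?(ltW r0)// !expr2 r2 ler_pM2r.
pose l := entropy n #|U| : R.
have l1 : 1 <= l.
  rewrite /l /entropy lerDl; apply: ln_ge0; rewrite ler_pdivlMr// mul1r//.
have l0 : 0 <= l by lra.
have sg12 : 6 * sg <= 2^-1.
  have h : sg <= sg * K by rewrite ler_peMr// ltW.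
  by have := sgK; lra.
pose s := sg * l.
have s0 : 0 <= s by rewrite mulr_ge0// ltW.
pose la := al * r / 2.
pose mu := rho * \sum_(w in W) edges_between inv S U w.
have mu_le : mu <= th * (a * b).
  have := ler_wpM2l rho0 (sum_edges_triangles_le invK S U).
  by rewrite -/mu /th -/a -/b; lra.
have mu_ge : th * (a * b) - la <= mu.
  have := ler_wpM2l rho0 (sum_edges_triangles_ge invK S U).
  rewrite -/mu -/a -/b.
  have h1 : rho * (a * b) <= 4 * r.
    apply: (@le_trans _ _ (rho * (r * N))).
      by rewrite ler_wpM2l// -r2 ler_wpM2l ?(ltW r0)// (le_trans rb).
    by rewrite mulrCA mulrC ler_wpM2r// ltW.
  have h2 : rho * N * #|S :&: U|%:R <= 4 * r.
    apply: ler_pM => //; first by rewrite mulr_ge0// ltW.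
    by apply: le_trans ar; rewrite ler_nat subset_leq_card// subsetIl.
  have h3 : 144 * r <= al * r by rewrite ler_pM2r.
  rewrite /th /la; lra.
have la0 : 0 <= la by rewrite /la divr_ge0// mulr_ge0 ?(ltW r0)//; have := al144; lra.
have mu0 : 0 <= mu.
  rewrite mulr_ge0// sumr_ge0// => w _.
  by have /andP[] := @edges_between_bounds R T inv S U w.
have sla : 12 * (b * l) <= s * la.
  have -> : s * la = sg * F * (l * r / (2 * K)).
    by rewrite /s /la /al; field; rewrite gt_eqF.
  apply: (@le_trans _ _ (24 * K * B * (l * r / (2 * K)))); last first.
    by rewrite ler_wpM2r// divr_ge0 ?mulr_ge0 ?(ltW r0) ?(ltW K0).
  have -> : 24 * K * B * (l * r / (2 * K)) = 12 * (l * (B * r)).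
    by field; rewrite gt_eqF.
  by rewrite ler_pM2l// (mulrC b) ler_wpM2l.
have bl : b = N * expR 1 * expR (- l).
  rewrite /l /entropy -mulrA -expRD opprD addrA subrr add0r -lnV ?posrE ?divr_gt0//.
  by rewrite lnK ?posrE ?invr_gt0 ?divr_gt0// invf_div mulrC divfK// gt_eqF.
have quad : 6 * s ^+ 2 * expR (6 * s) * mu <= s * la / 2.
  have e1 : expR (6 * s) <= expR (l / 2).
    rewrite ler_expR /s mulrA mulrC ler_wpM2l//.
  have h : 12 * s * expR (6 * s) * mu <= la.
    have p0 := expR_gt0 (6 * s).
    apply: (@le_trans _ _ (12 * s * expR (l / 2) * (th * (a * b)))).
      apply: ler_pM => //; first by rewrite !mulr_ge0// ltW.
      by rewrite ler_wpM2l// mulr_ge0.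
    have h1 : s * expR (l / 2) * b <= 8 * sg * N.
      rewrite bl.
      have -> : s * expR (l / 2) * (N * expR 1 * expR (- l)) =
          sg * N * expR 1 * (l * expR (- (l / 2))).
        rewrite /s (_ : - l = - (l / 2) + - (l / 2)); last by field.
        rewrite expRD.
        have : expR (l / 2) * expR (- (l / 2)) = 1 by rewrite -expRD addrN expR0.
        set x := expR (l / 2); set y := expR (- (l / 2)) => xy.
        have -> : sg * l * x * (N * expR 1 * (y * y)) = sg * N * expR 1 * (l * y) * (x * y) by ring.
        by rewrite xy mulr1.
      have h2 : l * expR (- (l / 2)) <= 2.
        by rewrite expRN ler_pdivrMr ?expR_gt0//; exact: expR_half_le.
      have h3 : 0 <= l * expR (- (l / 2)) by rewrite mulr_ge0// expR_ge0.
      apply: (@le_trans _ _ (sg * N * 4 * 2)); last by lra.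
      apply: ler_pM => //; first by rewrite !mulr_ge0 ?expR_ge0// ltW.
      by rewrite ler_wpM2l ?expR1_le4// mulr_ge0// ltW.
    rewrite /la -r2.
    have -> : 12 * s * expR (l / 2) * (th * (r * r)) =
        (12 * th * r) * (s * expR (l / 2) * r) by ring.
    have th0 : 0 <= th by rewrite /th !mulr_ge0// ltW.
    apply: (@le_trans _ _ ((12 * th * r) * (8 * sg * N))).
      rewrite ler_wpM2l ?mulr_ge0 ?(ltW r0)//; apply: le_trans h1.
      by rewrite ler_wpM2l// mulr_ge0// expR_ge0.
    have -> : 12 * th * r * (8 * sg * N) = 48 * 48 * (F * sg * r).
      by transitivity (96 * (th * N) * sg * r); [ring|rewrite thN; ring].
    have -> : al * r / 2 = F * r / K / 2 by rewrite /al [F / K * r]mulrAC.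
    rewrite ler_pdivlMr// ler_pdivlMr//.
    have -> : 48 * 48 * (F * sg * r) * 2 * K = F * r * (48 * 48 * 2 * (sg * K)) by ring.
    have Fr : 0 <= F * r by rewrite mulr_ge0 ?(ltW r0) ?(ltW F0).
    by rewrite -[leRHS]mulr1; exact: ler_wpM2l Fr _ _ sgK.
  have := ler_wpM2l s0 h; rewrite expr2.
  set e := expR _; clearbody e; lra.
have cb := @edges_between_bounds R T inv S U.
have up : bernoulli_prob W rho (fun A => th * (a * b) + al * r <= edges S U A) <=
    expR (- (6 * (b * l))).
  apply: (le_trans (chernoff_upper W rho01 cb (th * (a * b) + al * r) s0)).
  rewrite -/mu ler_expR.
  have : s * (th * (a * b) + al * r - mu) >= s * la.
    by rewrite ler_wpM2l//; have := la0; rewrite /la; lra.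
  move: quad; lra.
have lo : bernoulli_prob W rho (fun A => edges S U A <= th * (a * b) - al * r) <=
    expR (- (6 * (b * l))).
  apply: (le_trans (chernoff_lower W rho01 cb (th * (a * b) - al * r) s0)).
  rewrite -/mu ler_expR.
  have h1 : s * la <= s * (mu - (th * (a * b) - al * r)).
    by rewrite ler_wpM2l//; move: mu_ge; rewrite /la; lra.
  have h2 : 6 * s ^+ 2 * mu <= 6 * s ^+ 2 * expR (6 * s) * mu.
    have e1 : 1 <= expR (6 * s) by rewrite -[leLHS]expR0 ler_expR mulr_ge0.
    rewrite ler_wpM2r// ler_peMr//.
    by rewrite mulr_ge0 ?sqr_ge0.
  move: quad; lra.
have := lerD up lo; rewrite -mulr2n -[leRHS]mulr_natl; apply: le_trans.
apply: le_trans (bernoulli_probU W rho01 _ _); apply: le_bernoulli_prob => // A _.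
rewrite disc_edges -/a -/b ltr_normr => /orP[h|h]; apply/orP; [left|right]; lra.
Qed.

Lemma prob_low_degree s :
  bernoulli_prob W rho (fun A => link_deg inv A s < F) <= expR (- (5 / 12 * F)).
Proof.
have degE A : link_deg inv A s = edges [set s]%SET [set: T]%SET A.
  rewrite /edges -sum_edges_between big_set1 /link_deg.
  by apply: eq_bigl => t; rewrite inE.
have cb := @edges_between_bounds R T inv [set s]%SET [set: T]%SET.
pose mu := rho * \sum_(w in W) edges_between inv [set s]%SET [set: T]%SET w.
have mu_ge : 12 * F <= mu.
  have := ler_wpM2l rho0 (sum_edges_triangles_ge invK [set s]%SET [set: T]%SET).
  rewrite -/mu finset.setIT cards1 cardsT.
  have h : rho * N ^+ 2 / 2 <= rho * (N ^+ 2 - 3 * N).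
    rewrite -mulrA ler_wpM2l// expr2.
    have : 6 * N <= N * N by rewrite ler_pM2r// ler_nat.
    lra.
  rewrite rhoF in h; rewrite expr2 in h; lra.
have s0 : 0 <= 12^-1 :> R by [].
apply: (@le_trans _ _ (bernoulli_prob W rho (fun A => edges [set s]%SET [set: T]%SET A <= F))).
  by apply: le_bernoulli_prob => // A _; rewrite degE => /ltW.
apply: (le_trans (chernoff_lower W rho01 cb F s0)).
rewrite -/mu ler_expR; lra.
Qed.

Lemma prob_high_degree s :
  bernoulli_prob W rho (fun A => 100 * F < link_deg inv A s) <= expR (- (5 / 12 * F)).
Proof.
have degE A : link_deg inv A s = edges [set s]%SET [set: T]%SET A.
  rewrite /edges -sum_edges_between big_set1 /link_deg.
  by apply: eq_bigl => t; rewrite inE.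
have cb := @edges_between_bounds R T inv [set s]%SET [set: T]%SET.
pose mu := rho * \sum_(w in W) edges_between inv [set s]%SET [set: T]%SET w.
have mu_le : mu <= 24 * F.
  have := ler_wpM2l rho0 (sum_edges_triangles_le invK [set s]%SET [set: T]%SET).
  rewrite -/mu cards1 cardsT; have := rhoF; rewrite expr2; lra.
have mu0 : 0 <= mu.
  rewrite mulr_ge0// sumr_ge0// => w _.
  by have /andP[] := @edges_between_bounds R T inv [set s]%SET [set: T]%SET w.
have s0 : 0 <= 12^-1 :> R by [].
apply: (@le_trans _ _ (bernoulli_prob W rho (fun A => 100 * F <= edges [set s]%SET [set: T]%SET A))).
  by apply: le_bernoulli_prob => // A _; rewrite degE => /ltW.
apply: (le_trans (chernoff_upper W rho01 cb (100 * F) s0)).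
rewrite -/mu ler_expR.
have h : expR (6 * 12^-1 : R) <= 4.
  by apply: le_trans expR1_le4; rewrite ler_expR; lra.
have := ler_wpM2r mu0 h; have := F0; lra.
Qed.

Hypothesis KB : 124 * K <= B.

Lemma row_sum_le A s : link_deg inv A s <= 100 * F ->
  \sum_t `|link_adj inv A s t - th| <= 124 * F.
Proof.
move=> degs; have th0 : 0 <= th by rewrite /th !mulr_ge0// ltW.
apply: (@le_trans _ _ (\sum_t (link_adj inv A s t + th))).
  apply: ler_sum => t _; apply: le_trans (ler_normB _ _) _.
  by rewrite !ger0_norm// link_adj_ge0.
rewrite big_split/= sumr_const -/(link_deg inv A s).
have -> : th *+ #|T| = th * N by rewrite mulr_natr.
by rewrite thN; lra.
Qed.

Lemma quasirandom_balanced A :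
  (forall s, F <= link_deg inv A s <= 100 * F) ->
  (forall S U : {set T}, (0 < #|S| <= #|U|)%N ->
    #|U|%:R <= B * Num.sqrt (#|S|%:R * #|U|%:R) ->
    `|\sum_(s in S) \sum_(t in U) (link_adj inv A s t - th)| <=
    al * Num.sqrt (#|S|%:R * #|U|%:R)) -> quasirandom A.
Proof.
move=> degA balA; split=> //.
have al0 : 0 <= al by have := al144; lra.
have main (S U : {set T}) : (#|S| <= #|U|)%N ->
    `|\sum_(s in S) \sum_(t in U) (link_adj inv A s t - th)| <=
    al * Num.sqrt (#|S|%:R * #|U|%:R).
  move=> SU; have [S0|S0] := posnP #|S|.
    move/eqP: S0; rewrite cards_eq0 => /eqP ->; rewrite big_set0 normr0.
    by rewrite mulr_ge0// sqrtr_ge0.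
  pose a : R := #|S|%:R; pose b : R := #|U|%:R; pose r := Num.sqrt (a * b).
  rewrite -/a -/b -/r.
  have [Ur|Ur] := leP b (B * r); first by apply: balA; rewrite ?S0.
  have a0 : 0 < a by rewrite ltr0n.
  have b0 : 0 < b by rewrite ltr0n (leq_trans S0).
  have r2 : r * r = a * b by rewrite -expr2 sqr_sqrtr// mulr_ge0// ltW.
  have r0 : 0 < r by rewrite sqrtr_gt0 mulr_gt0.
  have Ba : B * a <= r.
    rewrite -(ler_pM2r r0) r2 mulrAC [leRHS]mulrC ler_pM2r// ltW//.
  have Ka : 124 * K * a <= r by apply: le_trans Ba; rewrite ler_pM2r.
  apply: (@le_trans _ _ (\sum_(s in S) 124 * F)).
    apply: le_trans (ler_norm_sum _ _ _) _; apply: ler_sum => s _.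
    apply: le_trans (ler_norm_sum _ _ _) _.
    apply: (@le_trans _ _ (\sum_t `|link_adj inv A s t - th|)).
      rewrite [leLHS]big_mkcond; apply: ler_sum => t _; case: ifP => // _.
    by apply: row_sum_le; case/andP: (degA s).
  rewrite sumr_const -[leLHS]mulr_natr -/a.
  have -> : 124 * F * a = al * (124 * K * a) by rewrite /al; field; rewrite gt_eqF.
  by rewrite ler_wpM2l.
move=> S U; case/orP: (leq_total #|S| #|U|) => SU; first exact: main.
have -> : \sum_(s in S) \sum_(t in U) (link_adj inv A s t - 6 * rho * N) =
    \sum_(t in U) \sum_(s in S) (link_adj inv A t s - th).
  rewrite exchange_big/=; apply: eq_bigr => t _; apply: eq_bigr => s _.
  by rewrite link_adjC.
by rewrite [_%:R * _]mulrC; exact: main.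
Qed.

Let g (b : nat) : R := b%:R * entropy n b.

Let sum_pairs_le :
  \sum_(p : {set T} * {set T} | (0 < #|p.1| <= #|p.2|)%N &&
      (#|p.2|%:R <= B * Num.sqrt (#|p.1|%:R * #|p.2|%:R)))
    2 * expR (- (6 * g #|p.2|)) <= 2 * N * expR (- (4 * (1 + ln N))).
Proof.
apply: (@le_trans _ _ (\sum_(U : {set T}) \sum_(S : {set T})
   if (0 < #|U|)%N && (#|S| <= #|U|)%N then 2 * expR (- (6 * g #|U|)) else 0)).
  rewrite exchange_big pair_bigA big_mkcond; apply: ler_sum => -[S U] _ /=.
  case: ifPn => [/andP[/andP[S0 SU] _]|_]; first by rewrite (leq_trans S0 SU) SU.
  by case: ifP => // _; rewrite mulr_ge0 ?expR_ge0.
apply: (@le_trans _ _ (\sum_(U : {set T})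
   if (0 < #|U|)%N then 2 * expR (- (5 * g #|U|)) else 0)).
  apply: ler_sum => U _; have [U0|U0] := posnP #|U|; first by rewrite big1.
  rewrite -big_mkcond/=.
  rewrite (eq_bigl (fun S => S \in [set S : {set T} | (#|S| <= #|U|)%N]%SET)); last first.
    by move=> S; rewrite inE.
  rewrite sumr_const -[leLHS]mulr_natl.
  have := @card_small_sets R T #|U|; rewrite U0 max_card => /(_ isT).
  rewrite -/(g _) => h; have e0 := expR_ge0 (- (6 * g #|U|)).
  have -> : - (5 * g #|U|) = g #|U| + - (6 * g #|U|) by ring.
  by rewrite expRD mulrCA ler_wpM2l// ler_wpM2r.
rewrite (partition_big (fun U : {set T} => inord #|U| : 'I_n.+1) predT)//=.
have cardI (U : {set T}) (b : 'I_n.+1) : (inord #|U| == b) = (#|U| == b :> nat).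
  by rewrite -val_eqE /= inordK// ltnS max_card.
apply: (@le_trans _ _ (\sum_(b < n.+1)
   if (0 < b)%N then 2 * expR (- (4 * g b)) else 0)).
  apply: ler_sum => b _.
  have [b0|b0] := posnP b.
    by rewrite big1// => U; rewrite cardI => /eqP ->; rewrite b0.
  apply: (@le_trans _ _ (\sum_(U in [set U : {set T} | (#|U| <= b)%N]%SET)
      2 * expR (- (5 * g b)))).
    rewrite [leLHS]big_mkcond [leRHS]big_mkcond; apply: ler_sum => U _.
    rewrite cardI inE; case: eqVneq => [->|_]; first by rewrite b0 leqnn.
    by case: ifP => // _; rewrite mulr_ge0 ?expR_ge0.
  rewrite sumr_const -[leLHS]mulr_natl.
  have bn : (b <= n)%N by rewrite -ltnS.
  have := @card_small_sets R T b; rewrite b0 bn => /(_ isT).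
  rewrite -/(g _) => h; have e0 := expR_ge0 (- (5 * g b)).
  have -> : - (4 * g b) = g b + - (5 * g b) by ring.
  by rewrite expRD mulrCA ler_wpM2l// ler_wpM2r.
rewrite big_ord_recl/= add0r.
apply: (@le_trans _ _ (\sum_(i < n) 2 * expR (- (4 * (1 + ln N))))).
  apply: ler_sum => i _; rewrite ler_wpM2l// ler_expR lerN2 ler_wpM2l//.
  have := @entropy_ge R n i.+1; rewrite /= ltn_ord => /(_ isT).
  by rewrite {1}/entropy divr1.
by rewrite sumr_const card_ord -[leLHS]mulr_natl mulrCA mulrA.
Qed.

(** Union bound.  Pairs of sets of very different sizes are covered by the
    degrees; the others are summed by the size of the larger set, whose entropy
    is at least that of a single letter. *)
Lemma prob_quasirandom :
  1 - (2 * N * expR (- (5 / 12 * F)) + 2 * N * expR (- (4 * (1 + ln N)))) <=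
  bernoulli_prob W rho (fun A => `[< quasirandom A >]).
Proof.
rewrite bernoulli_probC// lerD2l lerN2.
pose P (p : {set T} * {set T}) := (0 < #|p.1| <= #|p.2|)%N &&
      (#|p.2|%:R <= B * Num.sqrt (#|p.1|%:R * #|p.2|%:R)).
pose bad (p : {set T} * {set T}) (A : {set 3.-tuple T}) :=
  al * Num.sqrt (#|p.1|%:R * #|p.2|%:R) <
    `|\sum_(s in p.1) \sum_(t in p.2) (link_adj inv A s t - th)|.
pose low s (A : {set 3.-tuple T}) := link_deg inv A s < F.
pose high s (A : {set 3.-tuple T}) := 100 * F < link_deg inv A s.
apply: (@le_trans _ _ (bernoulli_prob W rho (fun A =>
    ([exists (s | predT s), low s A] || [exists (s | predT s), high s A]) ||
    [exists (p | P p), bad p A]))).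
  apply: le_bernoulli_prob => // A _ /= /asboolPn nq.
  apply/negPn/negP; rewrite !negb_or => /andP[/andP[nlow nhigh] nbad]; apply: nq.
  apply: quasirandom_balanced => [s|S U SU Ur].
    rewrite !leNgt; apply/andP; split; apply/negP => h.
      by move/negP: nlow; apply; apply/existsP; exists s.
    by move/negP: nhigh; apply; apply/existsP; exists s.
  rewrite leNgt; apply/negP => h; move/negP: nbad; apply.
  by apply/existsP; exists (S, U); rewrite /P /= SU Ur.
apply: (le_trans (bernoulli_probU W rho01 _ _)); apply: lerD; last first.
  apply: (le_trans (bernoulli_prob_union W rho01 P bad)).
  apply: le_trans sum_pairs_le; apply: ler_sum => -[S U] /andP[/= SU Ur].
  exact: prob_edges_deviate.
apply: (le_trans (bernoulli_probU W rho01 _ _)).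
have -> : 2 * N * expR (- (5 / 12 * F)) =
   \sum_(s : T) expR (- (5 / 12 * F)) + \sum_(s : T) expR (- (5 / 12 * F)).
  by rewrite sumr_const -[X in X + X]mulr_natl; ring.
apply: lerD.
  apply: (le_trans (bernoulli_prob_union W rho01 predT low)).
  by apply: ler_sum => s _; exact: prob_low_degree.
apply: (le_trans (bernoulli_prob_union W rho01 predT high)).
by apply: ler_sum => s _; exact: prob_high_degree.
Qed.

End Quasirandom.

(** * Asymptotics of the Poincare constant *)

Section Asymptotics.
Context {R : realType}.
Implicit Types (p Y X F eps : R).

Lemma succ_sqr_le_expn N : (N.+1 ^ 2 <= 4 * 2 ^ N)%N.
Proof.
elim: N => [|[|[|N]] IH] //; apply: (@leq_trans (2 * N.+3 ^ 2)).
  by rewrite -!mulnn; nia.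
by rewrite [X in (_ <= 4 * X)%N]expnS mulnCA leq_mul2l IH orbT.
Qed.

Lemma expR_ge_sqr (u : R) : 0 <= u -> u ^+ 2 / 4 <= expR u.
Proof.
move=> u0; have -> : expR u = expR (u / 2) ^+ 2.
  by rewrite expr2 -expRD; congr expR; field.
have -> : u ^+ 2 / 4 = (u / 2) ^+ 2 by field.
rewrite lerXn2r ?nnegrE ?divr_ge0 ?expR_ge0//.
by have := expR_ge1Dx (u / 2); lra.
Qed.

Lemma two_powR_le (x : R) : 0 <= x -> 2 `^ x <= expR x.
Proof.
move=> x0; rewrite /powR pnatr_eq0/= ler_expR ler_piMr//.
have := @le_ln1Dx R 1; rewrite (_ : 1 + 1 = 2)//; apply; lra.
Qed.

(** With [N] about [sqrt (ln F)] dyadic levels and [p] at most a sixteenth of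
    that, the factor [2^(p (N + 1))] is at most [F^(1/8)], which the discrepancy
    ratio [F^(1/4)] absorbs, while [p / 2^N] is of order [1 / sqrt (ln F)]. *)
Lemma poincare_loss F p (Y := Num.sqrt (ln F)) (K := expR (ln F / 4)) :
  0 < F -> 1 <= Y -> 2 <= p -> p <= Y / 16 ->
  3 * p * form_bound (F / K) (124 * F) p (Num.trunc Y) / F <= 100 * 100 / Y.
Proof.
move=> F0 Y1 p2 pY.
have Y0 : 0 <= Y by lra.
have /andP[] := Num.Theory.trunc_itv Y0.
move: (Num.trunc Y) => N NY YN.
have X0 : 0 < ln F by rewrite -sqrtr_gt0; apply: lt_le_trans Y1.
have YX : Y * Y = ln F by rewrite -expr2 sqr_sqrtr// ltW.
have K0 : 0 < K by exact: expR_gt0.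
have T0 : 0 < 2 ^+ N :> R by exact: exprn_gt0.
have -> : 3 * p * form_bound (F / K) (124 * F) p N / F =
    12 * p * (2 `^ p * (2 ^+ N) `^ p * N.*2.+1%:R / K) + 48 * 31 / 2 * (p / 2 ^+ N).
  rewrite /form_bound; move: (2 `^ p) ((2 ^+ N) `^ p) T0 => u v; move: (2 ^+ N) => w T0.
  by field; rewrite !gt_eqF.
have first : 2 `^ p * (2 ^+ N) `^ p * N.*2.+1%:R / K <= (3 * Y) * (4 * 8 * 8 / Y ^+ 4).
  have -> : 2 `^ p * (2 ^+ N) `^ p = 2 `^ (p * N.+1%:R) :> R.
    rewrite -powRM ?exprn_ge0// -exprS mulrC powRrM.
    by rewrite powR_mulrn.
  have h1 : 2 `^ (p * N.+1%:R) <= expR (ln F / 8).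
    apply: le_trans (two_powR_le _) _; first by rewrite mulr_ge0//; lra.
    rewrite ler_expR -YX -natr1.
    apply: (@le_trans _ _ (Y / 16 * (Y + Y))); last by lra.
    by apply: ler_pM => //; lra.
  have h2 : N.*2.+1%:R <= 3 * Y.
    by rewrite -addnn -addn1 !natrD; lra.
  have h3 : expR (ln F / 8) / K <= 4 * 8 * 8 / Y ^+ 4.
    have -> : expR (ln F / 8) / K = (expR (ln F / 8))^-1.
      by rewrite /K -expRN -expRN -expRD; congr expR; field.
    have u0 : 0 <= ln F / 8 by rewrite divr_ge0// ltW.
    have := expR_ge_sqr u0; rewrite -YX => h.
    have Y40 : 0 < Y ^+ 4 by rewrite exprn_gt0//; lra.
    rewrite -[leRHS]invrK lef_pV2 ?posrE ?expR_gt0 ?invr_gt0 ?divr_gt0//.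
    apply: le_trans h; rewrite invf_div le_eqVlt; apply/orP; left; apply/eqP.
    by field.
  have -> : 2 `^ (p * N.+1%:R) * N.*2.+1%:R / K = N.*2.+1%:R * (2 `^ (p * N.+1%:R) / K).
    by rewrite mulrAC mulrC.
  apply: ler_pM => //; first by rewrite divr_ge0 ?powR_ge0// ltW.
  apply: le_trans h3; rewrite ler_wpM2r// invr_ge0 ltW//.
have second : p / 2 ^+ N <= (Y / 16) * (4 / Y ^+ 2).
  have Y20 : 0 < Y ^+ 2 by rewrite exprn_gt0//; lra.
  apply: ler_pM; rewrite ?invr_ge0 ?(ltW T0)//; first by lra.
  rewrite -[4 / _]invrK lef_pV2 ?posrE ?invr_gt0 ?divr_gt0// invf_div.
  rewrite ler_pdivrMr// mulrC.
  have h : N.+1%:R ^+ 2 <= 4 * 2 ^+ N :> R.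
    by rewrite -natrX -natrX -natrM ler_nat succ_sqr_le_expn.
  apply: le_trans h; rewrite lerXn2r ?nnegrE ?ler0n//.
  exact: ltW.
have Yp : 0 < Y by lra.
have m1 : 12 * p * (2 `^ p * (2 ^+ N) `^ p * N.*2.+1%:R / K) <=
   12 * (Y / 16) * ((3 * Y) * (4 * 8 * 8 / Y ^+ 4)).
  apply: ler_pM => //; first by rewrite mulr_ge0//; lra.
    by rewrite !mulr_ge0 ?powR_ge0 ?invr_ge0// ltW.
  by rewrite ler_wpM2l.
have m2 : 48 * 31 / 2 * (p / 2 ^+ N) <= 48 * 31 / 2 * ((Y / 16) * (4 / Y ^+ 2)).
  by rewrite ler_wpM2l.
apply: (le_trans (lerD m1 m2)).
have -> : 12 * (Y / 16) * (3 * Y * (4 * 8 * 8 / Y ^+ 4)) = 36 * 16 / Y / Y.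
  by field; rewrite gt_eqF.
have -> : 48 * 31 / 2 * (Y / 16 * (4 / Y ^+ 2)) = 6 * 31 / Y.
  by field; rewrite gt_eqF.
have h : 36 * 16 / Y / Y <= 36 * 16 / Y.
  by rewrite ler_pdivrMr// ler_peMr// divr_ge0.
apply: (le_trans (lerD h (lexx _))).
rewrite -mulrDl ler_wpM2r ?invr_ge0//; lra.
Qed.

End Asymptotics.

(** * The random triangular group *)

Section QuasirandomFixedPoints.
Context {R : realType} {m : nat}.
Variables (rho F eps : R) (A : {set 3.-tuple (letter 'I_m)}).
Let Y := Num.sqrt (ln F).
Let K := expR (ln F / 4).
Hypothesis rho01 : 0 <= rho <= 1.
Hypothesis n6 : (6 <= #|{: letter 'I_m}|)%N.
Hypothesis rhoF : rho * #|{: letter 'I_m}|%:R ^+ 2 = 4 * F.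
Hypothesis F0 : 0 < F.
Hypothesis Y1 : 1 <= Y.
Hypothesis eps01 : 0 < eps <= 2^-1.
Hypothesis Yeps : 100 * 100 / Y < 2 * eps.
Hypothesis qA : quasirandom (@letter_inv 'I_m) rho F K A.

Lemma quasirandom_poincare p : 2 <= p -> p <= Y / 16 ->
  exists2 kap, 2 - 2 * eps < kap &
    mean_zero_poincare (link_adj (@letter_inv 'I_m) A) p kap.
Proof.
move=> p2 pY; have [dA degA] := qA.
exists (2 - 3 * p * form_bound (F / K) (124 * F) p (Num.trunc Y) / F).
  rewrite ltrD2l ltrN2; apply: le_lt_trans Yeps; exact: poincare_loss.
have N0 : 0 < #|{: letter 'I_m}|%:R :> R by rewrite ltr0n (leq_trans _ n6).
move=> f f0; apply: (@discrepancy_poincare _ _ _ (6 * rho * #|{: letter 'I_m}|%:R)) => //.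
- by move=> s t; exact: link_adjC.
- by move=> s t; exact: link_adj_ge0.
- by rewrite !mulr_ge0//; case/andP: rho01.
- by rewrite divr_ge0// ltW// expR_gt0.
- by move=> s; apply: row_sum_le => //; case/andP: (degA s).
- by rewrite mulr_ge0// ltW.
- by move=> s; case/andP: (degA s).
Qed.

Lemma quasirandom_fixed_points p (p1 : (1 <= p%:E)%E) : 2 <= p -> p <= Y / 16 ->
  FLp p1 ((2 - 2 * eps) `^ (2 * p)^-1) (triangular_group A) /\
  Lp_lipschitz_fixed_points p1 ((2 - 2 * eps) `^ (2 * p)^-1) (triangular_group A).
Proof.
move=> p2 pY; have [kap kapL poin] := quasirandom_poincare p2 pY.
have p0 : 0 < p by lra.
have p1' : 1 <= p by lra.
have [e0 e1] := andP eps01.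
have base : 1 <= 2 - 2 * eps by lra.
pose L := (2 - 2 * eps) `^ (2 * p)^-1.
have L2 : L `^ p * L `^ p = 2 - 2 * eps.
  rewrite /L -!powRrM (_ : (2 * p)^-1 * p = 2^-1); last by field; rewrite gt_eqF.
  rewrite -powRD; last by rewrite gt_eqF.
  by rewrite (_ : 2^-1 + 2^-1 = 1) ?powRr1//; [lra|field].
have L1 : 1 <= L.
  have := @ler_powR R _ base 0 (2 * p)^-1; rewrite powRr0; apply.
  by rewrite invr_ge0 mulr_ge0// ltW.
have degA s : F <= link_deg (@letter_inv 'I_m) A s.
  by have [_ /(_ s)/andP[]] := qA.
split.
  by apply: (triangular_FLp p1' F0 degA _ _ poin); rewrite ?L2//; exact: lt_le_trans L1.
by apply: (triangular_Lp_lipschitz p1' F0 degA L1 _ poin); rewrite L2.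
Qed.

End QuasirandomFixedPoints.

Section AlmostSure.
Local Open Scope classical_set_scope.
Context {R : realType}.

Lemma card_letter m : #|{: letter 'I_m}| = (2 * m)%N.
Proof. by rewrite card_prod card_ord card_bool mulnC. Qed.

Lemma card_letter_ge6 m : (3 <= m)%N -> (6 <= #|{: letter 'I_m}|)%N.
Proof. by rewrite card_letter -(leq_pmul2l (isT : 0 < 2)%N). Qed.

(** What the expansion ratio [K] has to exceed for the hypotheses of
    [prob_quasirandom] to hold with [F = K^4] and [sg = 24 K (124 K) / F]. *)
Definition large_constant (c : R) : Prop := 48 * 48 * 2 * (24 * 124) <= c.

Lemma large_constant_ge144 c : large_constant c -> 144 <= c.
Proof.
apply: le_trans.
have h1 : 1 <= 48 * 48 * 2 :> R by lra.
have h2 : 144 <= 24 * 124 :> R by lra.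
by apply: (le_trans h2); rewrite ler_peMl//; lra.
Qed.

Variable c0 : R.
Hypothesis c0L : large_constant c0.

Let c0_ge144 : 144 <= c0. Proof. exact: large_constant_ge144. Qed.

Let large_gap (K : R) : c0 <= K -> 144 * K <= K ^+ 4.
Proof.
move=> cK; have K144 : 144 <= K by exact: le_trans cK.
have K1 : 1 <= K by apply: le_trans K144; lra.
rewrite exprSr ler_pM2r; last by lra.
by apply: (le_trans K144); rewrite -[leLHS]expr1 ler_weXn2l.
Qed.

(** With [f m] at least [16 ln m] the failure probability is at most [5 / m]:
    the exponential tail of a degree, [exp (- 5 f / 12)], outweighs the number
    of letters. *)
Lemma quasirandom_aas (f : nat -> R) (P : nat -> topologicalGroupType -> Prop) (X0 : R) :
  (forall m, 0 < f m) ->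
  (\forall m \near \oo, 16 * ln m%:R <= f m <= m%:R) ->
  (forall m (A : {set 3.-tuple (letter 'I_m)}), X0 <= ln (f m) -> (3 <= m)%N ->
    f m <= m%:R ->
    quasirandom (@letter_inv 'I_m) (f m / m%:R ^+ 2) (f m) (expR (ln (f m) / 4)) A ->
    P m (triangular_group A)) ->
  triangular_aas (fun m => f m / m%:R ^+ 2) P.
Proof.
move=> f0 fm PA.
have lower : \forall m \near \oo, 1 - 5 * m%:R^-1 <=
    triangular_prob m (f m / m%:R ^+ 2) (P m).
  pose M1 := expR (expR (Num.max X0 (4 * c0)) / 16).
  near=> m.
  have /andP[f16 fle] : 16 * ln m%:R <= f m <= m%:R by near: m.
  have m3 : (3 <= m)%N by near: m; exact: nbhs_infty_ge.
  have mM1 : M1 <= m%:R by near: m; exact: nbhs_infty_ger.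
  have m0 : 0 < m%:R :> R by rewrite ltr0n (leq_trans _ m3).
  have lnF : Num.max X0 (4 * c0) <= ln (f m).
    rewrite -ler_expR lnK ?posrE//; apply: le_trans f16.
    by rewrite [16 * _]mulrC -ler_pdivrMr// -ler_expR lnK ?posrE.
  have X0F : X0 <= ln (f m) by apply: le_trans lnF; rewrite le_max lexx.
  have cF : 4 * c0 <= ln (f m) by apply: le_trans lnF; rewrite le_max lexx orbT.
  pose F := f m; pose K := expR (ln F / 4); pose rho := F / m%:R ^+ 2.
  have F0 : 0 < F by exact: f0.
  have cK : c0 <= K.
    by rewrite /K; have := expR_ge1Dx (ln F / 4); move: cF; rewrite -/F; lra.
  have K1 : 1 <= K by apply: le_trans cK; apply: le_trans c0_ge144; lra.
  have K4 : K ^+ 4 = F.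
    by rewrite /K -expRM_natr divfK// lnK.
  have K0 : 0 < K by exact: expR_gt0.
  have FK : 144 * K <= F.
    by rewrite -[leRHS]K4; exact: large_gap.
  have rho01 : 0 <= rho <= 1.
    rewrite /rho divr_ge0 ?(ltW F0) ?sqr_ge0//= ler_pdivrMr ?exprn_gt0// mul1r.
    by apply: (le_trans fle); rewrite expr2 ler_peMr ?(ltW m0)// ler1n (leq_trans _ m3).
  have NE : #|{: letter 'I_m}|%:R = 2 * m%:R :> R by rewrite card_letter natrM.
  have n6 := card_letter_ge6 m3.
  have rhoF : rho * #|{: letter 'I_m}|%:R ^+ 2 = 4 * F.
    by rewrite NE /rho; field; rewrite gt_eqF.
  have Fn : F <= #|{: letter 'I_m}|%:R by rewrite NE; apply: (le_trans fle); lra.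
  pose B := 124 * K; pose sg := 24 * K * B / F.
  have sgB : 24 * K * B <= sg * F by rewrite /sg divfK// gt_eqF.
  have sg0 : 0 < sg by rewrite /sg /B divr_gt0// !mulr_gt0.
  have sgK : 48 * 48 * 2 * (sg * K) <= 1.
    have -> : 48 * 48 * 2 * (sg * K) = 48 * 48 * 2 * (24 * 124) * (K ^+ 3 / F).
      rewrite /sg /B; move: (48 * 48 * 2) => x; field; rewrite gt_eqF//.
    apply: (@le_trans _ _ (K * (K ^+ 3 / F))).
      rewrite ler_wpM2r ?divr_ge0 ?exprn_ge0 ?(ltW F0) ?(ltW K0)//.
      exact: le_trans c0L cK.
    by rewrite mulrA -exprS K4 divff// gt_eqF.
  have := @prob_quasirandom R _ _ (@letter_invK 'I_m) rho F K B sg rho01 n6 rhoF Fn K1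
    FK sgB sgK sg0 (lexx _).
  move=> H; apply: (@le_trans _ _ (bernoulli_prob (triangular_words m) rho
      (fun A => `[< P m (triangular_group A) >]))); last by [].
  have H2 : bernoulli_prob (reduced_triangles (@letter_inv 'I_m)) rho
       (fun A => `[< quasirandom (@letter_inv 'I_m) rho F K A >]) <=
      bernoulli_prob (triangular_words m) rho
      (fun A => `[< P m (triangular_group A) >]).
    apply: le_bernoulli_prob => // A _ /asboolP qA; apply/asboolP; exact: PA.
  apply: le_trans H2; apply: le_trans H; rewrite lerD2l lerN2 NE.
  have e1 : expR (- (5 / 12 * F)) <= (m%:R ^+ 2)^-1.
    have h : 2 * ln m%:R <= 5 / 12 * F.
      have : 0 <= ln m%:R :> R by rewrite ln_ge0// ler1n (leq_trans _ m3).
      by move: f16; rewrite -/F; lra.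
    apply: (@le_trans _ _ (expR (- (2 * ln m%:R)))); first by rewrite ler_expR lerN2.
    by rewrite expRN -ln_powR lnK ?posrE ?powR_gt0// powR_mulrn// ltW.
  have e2 : expR (- (4 * (1 + ln (2 * m%:R)))) <= (m%:R ^+ 2)^-1 / 4 :> R.
    have m2 : 0 < 2 * m%:R :> R by rewrite mulr_gt0.
    apply: (@le_trans _ _ (expR (- (2 * ln (2 * m%:R))))).
      rewrite ler_expR lerN2.
      have : 0 <= ln (2 * m%:R) :> R by rewrite ln_ge0// -natrM ler1n muln_gt0 (leq_trans _ m3).
      lra.
    rewrite expRN -ln_powR lnK ?posrE ?powR_gt0// powR_mulrn ?(ltW m2)//.
    by rewrite exprMn invfM mulrC (_ : 2 ^+ 2 = 4)// -natrX.
  apply: (@le_trans _ _ (2 * (2 * m%:R) * (m%:R ^+ 2)^-1 +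
     2 * (2 * m%:R) * ((m%:R ^+ 2)^-1 / 4))).
    by apply: lerD; rewrite ler_wpM2l ?mulr_ge0 ?(ltW m0).
  by rewrite le_eqVlt; apply/orP; left; apply/eqP; field; rewrite gt_eqF.
have upper : \forall m \near \oo, triangular_prob m (f m / m%:R ^+ 2) (P m) <= 1.
  near=> m.
  have /andP[f16 fle] : 16 * ln m%:R <= f m <= m%:R by near: m.
  have m1 : (1 <= m)%N by near: m; exact: nbhs_infty_ge.
  have m0 : 0 < m%:R :> R by rewrite ltr0n.
  have rho01 : 0 <= f m / m%:R ^+ 2 <= 1.
    rewrite divr_ge0 ?(ltW (f0 m)) ?sqr_ge0//= ler_pdivrMr ?exprn_gt0// mul1r.
    by apply: (le_trans fle); rewrite expr2 ler_peMr ?(ltW m0)// ler1n.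
  rewrite -[leRHS](bernoulli_prob_predT (triangular_words m) (f m / m%:R ^+ 2)).
  apply: (@le_trans _ _ (bernoulli_prob (triangular_words m) (f m / m%:R ^+ 2)
      (fun A => `[< P m (triangular_group A) >]))); first by [].
  by apply: le_bernoulli_prob.
have lim : (fun m : nat => 1 - 5 * m%:R^-1 : R) @ \oo --> (1 : R).
  rewrite -[X in _ --> X]subr0; apply: cvgB; first exact: cvg_cst.
  rewrite -[X in _ --> X](mulr0 5); apply: cvgMl_tmp.
  by rewrite -(cvg_shiftS (fun m : nat => m%:R^-1 : R)); exact: cvg_harmonic.
have lim1 : (fun _ : nat => 1 : R) @ \oo --> (1 : R) by exact: cvg_cst.
rewrite /triangular_aas; apply: (squeeze_cvgr _ lim lim1).
near=> m; apply/andP; split; near: m; [exact: lower|exact: upper].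
Unshelve. all: by end_near. Qed.

Lemma aas_FLp (eps : R) (f : nat -> R) : 0 < eps <= 2^-1 ->
  (forall m, 0 < f m) ->
  (\forall m \near \oo, 16 * ln m%:R <= f m <= m%:R) ->
  aas_FLp_conclusion eps 16 f.
Proof.
move=> eps01 f0 fm; have [e0 e1] := andP eps01.
pose Y0 : R := 100 * 100 / (2 * eps) + 1.
have Y00 : 1 <= Y0 by rewrite /Y0 lerDr divr_ge0// mulr_ge0// ltW.
pose X0 : R := Num.max (4 * c0) (Y0 ^+ 2).
have all m (A : {set 3.-tuple (letter 'I_m)}) : X0 <= ln (f m) -> (3 <= m)%N ->
    f m <= m%:R ->
    quasirandom (@letter_inv 'I_m) (f m / m%:R ^+ 2) (f m) (expR (ln (f m) / 4)) A ->
    forall (p : R) (p1 : (1 <= p%:E)%E), p_range 16 f m p ->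
    FLp p1 ((2 - 2 * eps) `^ (2 * p)^-1) (triangular_group A) /\
    Lp_lipschitz_fixed_points p1 ((2 - 2 * eps) `^ (2 * p)^-1) (triangular_group A).
  move=> XF m3 fle qA p p1 /andP[p2 pr].
  have cF : 4 * c0 <= ln (f m) by apply: le_trans XF; rewrite le_max lexx.
  have YF : Y0 ^+ 2 <= ln (f m) by apply: le_trans XF; rewrite le_max lexx orbT.
  have m0 : 0 < m%:R :> R by rewrite ltr0n (leq_trans _ m3).
  have F0 := f0 m.
  have ln0 : 0 < ln (f m) by apply: lt_le_trans YF; rewrite exprn_gt0//; lra.
  have YY : Y0 <= Num.sqrt (ln (f m)).
    have Y0p : 0 <= Y0 by lra.
    by rewrite -[leLHS](ger0_norm Y0p) -sqrtr_sqr ler_sqrt// ltW.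
  have K4 : expR (ln (f m) / 4) ^+ 4 = f m by rewrite -expRM_natr divfK// lnK.
  have cK : c0 <= expR (ln (f m) / 4).
    by have := expR_ge1Dx (ln (f m) / 4); lra.
  apply: (@quasirandom_fixed_points R m (f m / m%:R ^+ 2) (f m) eps A) => //.
  - rewrite divr_ge0 ?(ltW F0) ?sqr_ge0//= ler_pdivrMr ?exprn_gt0// mul1r.
    by apply: (le_trans fle); rewrite expr2 ler_peMr ?(ltW m0)// ler1n (leq_trans _ m3).
  - exact: card_letter_ge6.
  - by rewrite card_letter natrM; field; rewrite gt_eqF.
  - exact: le_trans YY.
  - have Yp : 0 < Num.sqrt (ln (f m)) by rewrite sqrtr_gt0.
    have e20 : 0 < 2 * eps by rewrite mulr_gt0.
    rewrite ltr_pdivrMr// -ltr_pdivrMl//; apply: lt_le_trans YY.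
    by rewrite /Y0 [_^-1 * _]mulrC ltrDl.
  - apply: (le_trans pr); rewrite mulrC ler_wpM2r ?invr_ge0// ler_sqrt ?(ltW ln0)//.
    have lnln : 1 <= ln (ln (f m)).
      rewrite -ler_expR lnK ?posrE//; apply: (le_trans expR1_le4); apply: le_trans cF.
      by have := c0_ge144; lra.
    have lnln0 : 0 < ln (ln (f m)) by apply: lt_le_trans lnln; exact: ltr01.
    by rewrite ler_pdivrMr// ler_peMr// ltW.
split; apply: (quasirandom_aas (X0 := X0)) => // m A XF m3 fle qA p p1 pr.
  by have [] := all m A XF m3 fle qA p p1 pr.
by have [] := all m A XF m3 fle qA p p1 pr.
Qed.

End AlmostSure.

Lemma exists_large_constant (R : realType) : exists c : R, large_constant c.
Proof. by eexists; exact: lexx. Qed.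

Local Open Scope classical_set_scope.

Theorem theorem9p4 (R : realType) :
  (forall eps : R, 0 < eps <= 2^-1 ->
     exists2 C : R, 0 < C &
     forall f : nat -> R, (forall m, 0 < f m) ->
       (\forall m \near \oo, C * ln m%:R <= f m <= m%:R) ->
       aas_FLp_conclusion eps C f) /\
  (exists2 C : R, 0 < C &
     forall eps : R, 0 < eps <= 2^-1 ->
     forall f : nat -> R, (forall m, 0 < f m) ->
       (\forall m \near \oo, C * ln m%:R <= f m <= m%:R) ->
       (fun m => f m / ln m%:R) @ \oo --> +oo ->
       aas_FLp_conclusion eps C f).
Proof.
have [c cL] := exists_large_constant R.
split=> [eps eps01|]; exists 16 => //.
  by move=> f f0 fm; exact: aas_FLp cL _ _ eps01 f0 fm.
by move=> eps eps01 f f0 fm _; exact: aas_FLp cL _ _ eps01 f0 fm.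
Qed.
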